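(* Let $L$ be a $(k\vert l)$-superdimensional nilpotent Lie superalgebra such that $L/Z(L)$ is finitely generated. Then: (i) $st(L)=(0,0)$ if and only if $L$ is isomorphic to one of the Lie superalgebras $A(k\vert l)$ with $k+l\geq 1$; $H(m,n)\oplus A(k-2m-1\vert l-n)$ with $k\geq 2m+1$ and $l\geq n$; or $H_m\oplus A(k-m\vert l-m-1)$ with $k\geq m$ and $l\geq m+1$. (ii) $st(L)=(1,0)$ if and only if $L$ is isomorphic to $(4\vert 0)_{2}\oplus A(k-4\vert l)$ with $k\geq 4$ and $l\geq 0$, or $(1\vert 3)_{1}\oplus A(k-1\vert l-3)$ with $k\geq 1$ and $l\geq 3$. (iii) There is no nilpotent Lie superalgebra with $st(L)=(0,1)$. (iv) $st(L)=(2,0)$ if and only if $L$ is isomorphic to one of $(5\vert 0)_{3}\oplus A(k-5\vert l)$, $(5\vert 0)_{4}\oplus A(k-5\vert l)$, $(5\vert 0)_{5}\oplus A(k-5\vert l)$ (each with $k\geq 5$ and $l\geq 0$), $(1\vert 4)_{7}\oplus A(k-1\vert l-4)$ with $k\geq 1$ and $l\geq 4$, or $(2\vert 3)_{23}\oplus A(k-2\vert l-3)$ with $k\geq 2$ and $l\geq 3$. (v) $st(L)=(0,2)$ if and only if $L$ is isomorphic to one of $(2\vert 2)_{1}\oplus A(k-2\vert l-2)$, $(2\vert 2)_{4}\oplus A(k-2\vert l-2)$ (each with $k\geq 2$ and $l\geq 2$), $(2\vert 3)_{18}\oplus A(k-2\vert l-3)$, $(2\vert 3)_{19}\oplus A(k-2\vert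 l-3)$, or $(2\vert 3)_{24}\oplus A(k-2\vert l-3)$ (each with $k\geq 2$ and $l\geq 3$). (vi) $st(L)=(1,1)$ if and only if $L$ is isomorphic to $(2\vert 2)_{6}\oplus A(k-2\vert l-2)$ with $k\geq 2$ and $l\geq 2$, $(4\vert 1)_{6}\oplus A(k-4\vert l-1)$ with $k\geq 4$ and $l\geq 1$, or $(3\vert 2)_{13}\oplus A(k-3\vert l-2)$ with $k\geq 3$ and $l\geq 2$.
   Context: Lie superalgebras are over a field of characteristic not equal to $2$ or $3$. For $L=L_{\overline{0}}\oplus L_{\overline{1}}$, the superdimension is $\mathrm{sdim}\,L=(\dim L_{\overline{0}},\dim L_{\overline{1}})$; $L$ is $(k\vert l)$-superdimensional if $\mathrm{sdim}\,L=(k,l)$ (with $k,l$ finite). $L^{2}=[L,L]$ is the derived superalgebra and $Z(L)$ the center. The minimal generator number pair $(p\vert q)$ of a Lie superalgebra records the numbers of even ($p$) and odd ($q$) elements in a minimal homogeneous generating set; for a finite-dimensional nilpotent Lie superalgebra $M$ it equals $\mathrm{sdim}\,M/M^{2}$. With $(p\vert q)$ the minimal generator number pair of $L/Z(L)$, put $$\lambda(L^{2},p,q)=\left(p\dim L^{2}_{\overline{0}}+q\dim L^{2}_{\overline{1}},\ q\dim L^{2}_{\overline{0}}+p\dim L^{2}_{\overline{1}}\right),\qquad st(L)=\lambda(L^{2},p,q)-\mathrm{sdim}\,L/Z(L).$$ $A(a\vert b)$ is the abelian Lie superalgebra of superdimension $(a\vert b)$. $H(m,n)$ is the Heisenberg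 Lie superalgebra with even center, of superdimension $(2m+1\vert n)$, with even basis $x_1,\dots,x_{2m},z$, odd basis $y_1,\dots,y_n$ and brackets $[x_i,x_{m+i}]=z$ ($1\le i\le m$), $[y_j,y_j]=z$ ($1\le j\le n$). $H_m$ is the Heisenberg Lie superalgebra with odd center, of superdimension $(m\vert m+1)$, with even basis $x_1,\dots,x_m$, odd basis $y_1,\dots,y_m,z$ and brackets $[x_j,y_j]=z$ ($1\le j\le m$). The algebra named $(a\vert b)_i$ has even basis $e_1,\dots,e_a$ and odd basis $f_1,\dots,f_b$, with the following brackets (all brackets of basis elements not determined by these through super-skew-symmetry are zero): $(4\vert 0)_{2}$: $[e_1,e_2]=e_3$, $[e_1,e_3]=e_4$. $(2\vert 2)_{1}$: $[f_1,f_1]=e_1$, $[f_2,f_2]=e_2$. $(2\vert 2)_{4}$: $[f_1,f_2]=e_1$, $[f_2,f_2]=e_2$. $(2\vert 2)_{6}$: $[e_2,f_2]=f_1$, $[f_2,f_2]=e_1$. $(1\vert 3)_{1}$: $[e_1,f_2]=f_1$, $[e_1,f_3]=f_2$. $(5\vert 0)_{3}$: $[e_1,e_2]=e_3$, $[e_1,e_3]=e_4$, $[e_1,e_4]=e_5$, $[e_2,e_3]=e_5$. $(5\vert 0)_{4}$: $[e_1,e_2]=e_3$, $[e_1,e_3]=e_4$, $[e_1,e_4]=e_5$. $(5\vert 0)_{5}$: $[e_1,e_2]=e_3$, $[e_1,e_4]=e_5$, $[e_2,e_3]=e_5$. $(4\vert 1)_{6}$: $[e_1,e_2]=e_3$,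 $[e_1,e_3]=e_4$, $[f_1,f_1]=e_4$. $(1\vert 4)_{7}$: $[e_1,f_2]=f_1$, $[e_1,f_3]=f_2$, $[e_1,f_4]=f_3$. $(3\vert 2)_{13}$: $[e_1,e_2]=e_3$, $[e_1,f_2]=f_1$, $[f_1,f_2]=e_3$, $[f_2,f_2]=2e_2$. $(2\vert 3)_{18}$: $[e_1,f_3]=f_1$, $[e_2,f_2]=f_1$, $[f_2,f_2]=2e_1$, $[f_2,f_3]=-e_2$. $(2\vert 3)_{19}$: $[e_1,f_3]=f_1$, $[e_2,f_2]=f_1$, $[f_2,f_3]=-e_1$, $[f_3,f_3]=2e_2$. $(2\vert 3)_{23}$: $[e_1,f_2]=f_1$, $[e_1,f_3]=f_2$, $[f_1,f_3]=-e_2$, $[f_2,f_2]=e_2$. $(2\vert 3)_{24}$: $[e_1,f_2]=f_1$, $[e_1,f_3]=f_2$, $[e_2,f_3]=f_1$.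
   Formalization: L is taken nonzero, and the ''only if'' parts of (i) and (v) are stated only over fields in which every element is a square; over any other field they fail, e.g. [y1,y1]=z, [y2,y2]=cz with c a non-square has st(L)=(0,0) but is not in list (i). *)

(* Defs.v *)
From HB Require Import structures.
From mathcomp Require Import all_boot all_order all_algebra.
From mathcomp Require Import zify.
Set Implicit Arguments.
Unset Strict Implicit.
Unset Printing Implicit Defensive.
Import Order.TTheory GRing.Theory Num.Theory.
Local Open Scope ring_scope.

(* Parities are booleans, [true] being odd, so that parities add by [(+)] and *)
(* |a||b| is [a && b]. The bracket is the linear map x |-> ad x, so that      *)
(* [bracket x y] is [x, y] and bilinearity is built in.                       *)
Record lieSuperalg (F : fieldType) := LieSuperalg {
  carrier :> vectType F;
  part : bool -> {vspace carrier};
  bracket : 'Hom(carrier, 'End(carrier));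
  part_sum : (part false + part true)%VS = fullv;
  part_cap : (part false :&: part true)%VS = 0%VS;
  bracket_part : forall a b x y, x \in part a -> y \in part b ->
    bracket x y \in part (a (+) b);
  bracket_skew : forall a b x y, x \in part a -> y \in part b ->
    bracket x y = - ((-1) ^+ (a && b) *: bracket y x);
  bracket_jacobi : forall a b x y z, x \in part a -> y \in part b ->
    bracket x (bracket y z) =
      bracket (bracket x y) z + (-1) ^+ (a && b) *: bracket y (bracket x z)
}.

Section Basics.
Variable F : fieldType.
Implicit Type L M : lieSuperalg F.

Definition brv L (U V : {vspace L}) : {vspace L} :=
  <<[seq bracket L u v | u <- vbasis U, v <- vbasis V]>>%VS.

Definition derived L : {vspace L} := brv fullv fullv.

(* z is central iff ad z = 0 *)
Definition center L : {vspace L} := lker (bracket L).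

Definition lower_central L (n : nat) : {vspace L} := iter n (brv fullv) fullv.

Definition nilpotent_lie L : Prop := exists n, lower_central L n = 0%VS.

Definition graded L (U : {vspace L}) : Prop :=
  ((U :&: part L false) + (U :&: part L true))%VS = U.

Definition sub_sdim L (U : {vspace L}) : nat * nat :=
  (\dim (U :&: part L false), \dim (U :&: part L true)).

Definition sdim L : nat * nat := (\dim (part L false), \dim (part L true)).

Definition lie_hom L M (g : 'Hom(L, M)) : Prop :=
  (forall a, (g @: part L a <= part M a)%VS) /\
  (forall x y, g (bracket L x y) = bracket M (g x) (g y)).

Definition lie_iso L M : Prop :=
  exists g : 'Hom(L, M), [/\ lie_hom g, lker g = 0%VS & limg g = fullv].

Definition sub_superalg L (K : {vspace L}) : Prop :=
  graded K /\ (brv K K <= K)%VS.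

Definition generates L (X : seq L) : Prop :=
  forall K : {vspace L}, sub_superalg K -> {subset X <= K} -> K = fullv.

Definition finitely_generated L : Prop := exists X : seq L, generates X.

(* X and Y are the even and the odd elements of the generating set *)
Definition min_hom_generating L (X Y : seq L) : Prop :=
  [/\ {subset X <= part L false}, {subset Y <= part L true},
      uniq (X ++ Y), generates (X ++ Y) &
      forall W : seq L, {subset W <= X ++ Y} -> generates W ->
        {subset X ++ Y <= W}].

Definition min_generator_pair L (p q : nat) : Prop :=
  exists X Y : seq L, [/\ min_hom_generating X Y, size X = p & size Y = q].

Lemma brv_mem L (U V : {vspace L}) x y :
  x \in U -> y \in V -> bracket L x y \in brv U V.
Proof.
move=> Ux Vy; rewrite (coord_vbasis Ux) (coord_vbasis Vy).
rewrite (linear_sum (bracket L)) /= sum_lfunE memv_suml // => i _.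
rewrite (linear_sum (bracket L _)) memv_suml // => j _.
rewrite !linearZ /= scale_lfunE !memvZ // memv_span //.
by apply/allpairs_f; apply: memt_nth.
Qed.

Lemma center_bracket L z x : z \in center L -> bracket L z x = 0.
Proof. by rewrite memv_ker => /eqP->; rewrite zero_lfunE. Qed.

Lemma part_decomp L (x : L) : exists x0 x1,
  [/\ x0 \in part L false, x1 \in part L true & x = x0 + x1].
Proof.
have /memv_addP[x0 L0 [x1 L1 ->]] : x \in (part L false + part L true)%VS.
  by rewrite part_sum memvf.
by exists x0, x1.
Qed.

Lemma part_cap0 L (x : L) : x \in part L false -> x \in part L true -> x = 0.
Proof.
by move=> x0 x1; apply/eqP; rewrite -memv0 -part_cap memv_cap x0 x1.
Qed.

Lemma part_eq0 L (x y : L) : x \in part L false -> y \in part L true ->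
  x + y = 0 -> x = 0 /\ y = 0.
Proof.
move=> x0 y1 /eqP; rewrite addr_eq0 => /eqP xy.
have x_0 : x = 0 by apply: part_cap0 => //; rewrite xy rpredN.
by split=> //; apply/eqP; rewrite -oppr_eq0 -xy x_0.
Qed.

Lemma center_hom L z0 z1 : z0 \in part L false -> z1 \in part L true ->
  z0 + z1 \in center L -> z0 \in center L /\ z1 \in center L.
Proof.
move=> Lz0 Lz1 Zz.
suff zz x : bracket L z0 x = 0 /\ bracket L z1 x = 0.
  by split; rewrite memv_ker; apply/eqP/lfunP => x;
    rewrite zero_lfunE; case: (zz x).
have hom b y : y \in part L b -> bracket L z0 y = 0 /\ bracket L z1 y = 0.
  move=> Ly; have := center_bracket y Zz; rewrite linearD /= add_lfunE.
  have := bracket_part Lz0 Ly; have := bracket_part Lz1 Ly.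
  case: b {Ly} => /= H1 H0 H; last exact: part_eq0.
  by move: H; rewrite addrC => /part_eq0[].
have [x0 [x1 [/hom[h00 h10] /hom[h01 h11] ->]]] := part_decomp x.
by rewrite !linearD /= h00 h10 h01 h11 addr0.
Qed.

Lemma bracket_center L z x : z \in center L -> bracket L x z = 0.
Proof.
have [z0 [z1 [L0 L1 ->]]] := part_decomp z => /(center_hom L0 L1)[Z0 Z1].
have [x0 [x1 [Lx0 Lx1 ->]]] := part_decomp x.
rewrite !linearD /= !add_lfunE.
rewrite (bracket_skew Lx0 L0) (bracket_skew Lx0 L1).
rewrite (bracket_skew Lx1 L0) (bracket_skew Lx1 L1).
by rewrite !center_bracket // !scaler0 oppr0 !addr0.
Qed.

End Basics.

Section BilinearMap.
Variables (F : fieldType) (V : vectType F) (g : V -> V -> V).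
Hypotheses (gl : forall y, linear (g^~ y)) (gr : forall x, linear (g x)).

Let g_r x : {linear V -> V} :=
  HB.pack (g x) (GRing.isLinear.Build F V V *:%R (g x) (gr x)).
Let g_ad x : 'End(V) := linfun (g_r x).
Fact g_ad_linear : linear g_ad.
Proof.
move=> c x y; apply/lfunP => z.
by rewrite add_lfunE scale_lfunE !lfunE /= gl.
Qed.
Let g_lin : {linear V -> 'End(V)} :=
  HB.pack g_ad (GRing.isLinear.Build F V 'End(V) *:%R g_ad g_ad_linear).
Definition bilfun : 'Hom(V, 'End(V)) := linfun g_lin.
Lemma bilfunE x y : bilfun x y = g x y.
Proof. by rewrite /bilfun lfunE /= lfunE. Qed.
End BilinearMap.

(* The quotient L / Z(L), carried by a complement of Z(L) onto which L is     *)
(* projected along Z(L); the complement need not be graded, its homogeneous   *)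
(* parts are the images of those of L.                                        *)
Section CentralQuotient.
Variables (F : fieldType) (L : lieSuperalg F).
Local Notation Z := (center L).

Definition quo_carrier : vectType F := subvs_of (Z^C)%VS.
Definition quo_proj : 'Hom(L, quo_carrier) :=
  (linfun (vsproj Z^C) \o daddv_pi Z^C Z)%VF.
Definition quo_bracket (u v : quo_carrier) : quo_carrier :=
  quo_proj (bracket L (vsval u) (vsval v)).
Definition quo_part (a : bool) : {vspace quo_carrier} :=
  (quo_proj @: part L a)%VS.

Let ZCZ : (Z^C :&: Z = 0)%VS. Proof. by rewrite capvC capv_compl. Qed.

Lemma quo_projE x : vsval (quo_proj x) = daddv_pi Z^C Z x.
Proof. by rewrite comp_lfunE lfunE /= vsprojK // memv_pi. Qed.

Lemma quo_proj_val u : quo_proj (vsval u) = u.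
Proof. by apply/val_inj; rewrite /= quo_projE daddv_pi_id ?subvsP. Qed.

Lemma quo_decomp x : exists2 z, z \in Z & x = vsval (quo_proj x) + z.
Proof.
exists (daddv_pi Z Z^C x); first exact: memv_pi.
rewrite quo_projE daddv_pi_add // addvC addv_complf; exact: memvf.
Qed.

Lemma quo_ker x : (quo_proj x == 0) = (x \in Z).
Proof.
apply/eqP/idP => [px | Zx].
  by have [z Zz ->] := quo_decomp x; rewrite px add0r.
apply/val_inj; rewrite /= quo_projE.
have := @daddv_pi_add _ _ _ _ x ZCZ.
rewrite addvC addv_complf memvf => /(_ isT).
rewrite (@daddv_pi_id _ _ Z Z^C) ?capv_compl //.
by rewrite -[RHS]add0r => /addIr.
Qed.

Lemma quo_bracketE x y :
  quo_bracket (quo_proj x) (quo_proj y) = quo_proj (bracket L x y).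
Proof.
have [z Zz {2}->] := quo_decomp x; have [w Zw {2}->] := quo_decomp y.
rewrite (linearD (bracket L)) /= add_lfunE (center_bracket _ Zz) addr0.
by rewrite (linearD (bracket L _)) /= (bracket_center _ Zw) addr0.
Qed.

Fact quo_bracket_l y : linear (quo_bracket^~ y).
Proof.
by move=> c x x'; rewrite /quo_bracket !linearP /= add_lfunE scale_lfunE linearP.
Qed.
Fact quo_bracket_r x : linear (quo_bracket x).
Proof. by move=> c y y'; rewrite /quo_bracket !linearP. Qed.
Let brQ := bilfun quo_bracket_l quo_bracket_r.

Fact quo_sum : (quo_part false + quo_part true)%VS = fullv.
Proof.
apply/vspaceP => u; rewrite memvf -limgD part_sum.
by apply/memv_imgP; exists (vsval u); rewrite ?memvf ?quo_proj_val.
Qed.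

Fact quo_cap : (quo_part false :&: quo_part true)%VS = 0%VS.
Proof.
apply/eqP; rewrite -subv0; apply/subvP => u; rewrite memv_cap.
move=> /andP[/memv_imgP[x Lx ->] /memv_imgP[y Ly xy]]; rewrite memv0 quo_ker.
have : x + - y \in center L by rewrite -quo_ker linearB /= -xy subrr.
by case/center_hom => //; rewrite rpredN.
Qed.

Fact quo_bracket_part a b u v : u \in quo_part a -> v \in quo_part b ->
  brQ u v \in quo_part (a (+) b).
Proof.
move=> /memv_imgP[x Lx ->] /memv_imgP[y Ly ->].
by rewrite bilfunE quo_bracketE memv_img // bracket_part.
Qed.

Fact quo_skew a b u v : u \in quo_part a -> v \in quo_part b ->
  brQ u v = - ((-1) ^+ (a && b) *: brQ v u).
Proof.
move=> /memv_imgP[x Lx ->] /memv_imgP[y Ly ->].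
by rewrite !bilfunE !quo_bracketE (bracket_skew Lx Ly) linearN linearZ.
Qed.

Fact quo_jacobi a b u v w : u \in quo_part a -> v \in quo_part b ->
  brQ u (brQ v w) = brQ (brQ u v) w + (-1) ^+ (a && b) *: brQ v (brQ u w).
Proof.
move=> /memv_imgP[x Lx ->] /memv_imgP[y Ly ->]; rewrite -(quo_proj_val w).
rewrite !bilfunE !quo_bracketE (bracket_jacobi (vsval w) Lx Ly).
by rewrite linearD linearZ.
Qed.

Definition central_quotient : lieSuperalg F :=
  LieSuperalg quo_sum quo_cap quo_bracket_part quo_skew quo_jacobi.
End CentralQuotient.

(* lambda(L^2, p, q) and st(L), with (p|q) the minimal generator number pair  *)
(* of L / Z(L); the difference is taken in int.                               *)
Definition lambda (F : fieldType) (L : lieSuperalg F) (p q : nat) : nat * nat :=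
  let d := sub_sdim (derived L) in
  (p * d.1 + q * d.2, q * d.1 + p * d.2)%N.

Definition st (F : fieldType) (L : lieSuperalg F) (p q : nat) : int * int :=
  let s := sdim (central_quotient L) in
  ((lambda L p q).1%:Z - s.1%:Z, (lambda L p q).2%:Z - s.2%:Z).

Section DirectSum.
Variables (F : fieldType) (L M : lieSuperalg F).

Definition sum_carrier : vectType F := (L * M)%type.
Definition sum_part (a : bool) : {vspace sum_carrier} :=
  (linfun (fst : sum_carrier -> L) @^-1: part L a :&:
   linfun (snd : sum_carrier -> M) @^-1: part M a)%VS.
Definition sum_bracket (u v : sum_carrier) : sum_carrier :=
  (bracket L u.1 v.1, bracket M u.2 v.2).

Lemma sum_partE a u : (u \in sum_part a) = (u.1 \in part L a) && (u.2 \in part M a).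
Proof. by rewrite memv_cap -!memv_preim !lfunE. Qed.

Fact sum_bracket_l y : linear (sum_bracket^~ y).
Proof.
by move=> c x x'; rewrite /sum_bracket !linearP /= !add_lfunE !scale_lfunE.
Qed.
Fact sum_bracket_r x : linear (sum_bracket x).
Proof. by move=> c y y'; rewrite /sum_bracket !linearP. Qed.
Let brS := bilfun sum_bracket_l sum_bracket_r.

Fact sum_sum : (sum_part false + sum_part true)%VS = fullv.
Proof.
apply/vspaceP => -[x y]; rewrite memvf.
have [x0 [x1 [Lx0 Lx1 ->]]] := part_decomp x.
have [y0 [y1 [My0 My1 ->]]] := part_decomp y.
have -> : (x0 + x1, y0 + y1) = (x0, y0) + (x1, y1) :> sum_carrier by [].
by apply: memv_add; rewrite sum_partE /= ?Lx0 ?Lx1 ?My0 ?My1.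
Qed.

Fact sum_cap : (sum_part false :&: sum_part true)%VS = 0%VS.
Proof.
apply/eqP; rewrite -subv0; apply/subvP => -[x y]; rewrite memv_cap !sum_partE /=.
move=> /andP[/andP[x0 y0] /andP[x1 y1]].
by rewrite (part_cap0 x0 x1) (part_cap0 y0 y1) memv0.
Qed.

Fact sum_bracket_part a b u v : u \in sum_part a -> v \in sum_part b ->
  brS u v \in sum_part (a (+) b).
Proof.
rewrite !sum_partE bilfunE => /andP[u1 u2] /andP[v1 v2].
by rewrite !bracket_part.
Qed.

Fact sum_skew a b u v : u \in sum_part a -> v \in sum_part b ->
  brS u v = - ((-1) ^+ (a && b) *: brS v u).
Proof.
rewrite !sum_partE !bilfunE => /andP[u1 u2] /andP[v1 v2].
by congr (_, _); rewrite /= (bracket_skew (a := a) (b := b)).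
Qed.

Fact sum_jacobi a b u v w : u \in sum_part a -> v \in sum_part b ->
  brS u (brS v w) = brS (brS u v) w + (-1) ^+ (a && b) *: brS v (brS u w).
Proof.
rewrite !sum_partE !bilfunE => /andP[u1 u2] /andP[v1 v2].
by congr (_, _); rewrite /= (bracket_jacobi (a := a) (b := b)).
Qed.

Definition lie_sum : lieSuperalg F :=
  LieSuperalg sum_sum sum_cap sum_bracket_part sum_skew sum_jacobi.
End DirectSum.

(* Algebras given by a multiplication table on a homogeneous basis e_1, ...,  *)
(* e_a | f_1, ..., f_b. A row (x, y, c, z) contributes c z to [x, y], hence   *)
(* -(-1)^(|x||y|) c z to [y, x]; unlisted brackets vanish.                    *)
Definition label : eqType := (nat + nat)%type.
Definition elabel (i : nat) : label := inl i.
Definition flabel (j : nat) : label := inr j.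
Definition parity (x : label) : bool := if x is inr _ then true else false.

Definition row_coef (r : label * label * int * label) (x y z : label) : int :=
  let: (x0, y0, c, z0) := r in
  if z != z0 then 0
  else if (x == x0) && (y == y0) then c
  else if (x == y0) && (y == x0) then - ((-1) ^+ (parity x && parity y) * c)
  else 0.

Definition table := seq (label * label * int * label).

Definition coef (t : table) (x y z : label) : int :=
  \sum_(r <- t) row_coef r x y z.

Definition labels (a b : nat) : seq label :=
  [seq elabel i.+1 | i <- iota 0 a] ++ [seq flabel j.+1 | j <- iota 0 b].

Definition graded_table (t : table) : bool :=
  all (fun r => let: (x, y, c, z) := r in
    (parity z == parity x (+) parity y) && ((x == y) ==> parity x)) t.

Definition jacobi_table (a b : nat) (t : table) : bool :=
  let B := labels a b in
  all (fun x => all (fun y => all (fun z => all (fun w =>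
    \sum_(m <- B) coef t y z m * coef t x m w ==
    \sum_(m <- B) coef t x y m * coef t m z w +
      (-1) ^+ (parity x && parity y) *
        \sum_(m <- B) coef t x z m * coef t y m w) B) B) B) B.

Definition lie_table (a b : nat) (t : table) : bool :=
  graded_table t && jacobi_table a b t.

Lemma coef_skew t x y z : graded_table t ->
  coef t x y z = - ((-1) ^+ (parity x && parity y) * coef t y x z).
Proof.
rewrite /coef mulr_sumr -sumrN => /allP gt.
apply: eq_big_seq => -[[[x0 y0] c] z0] /gt /andP[_ odd0] /=.
have [_|_] /= := eqVneq z z0; last by rewrite mulr0 oppr0.
have [-> {x}|nx] /= := eqVneq x x0; have [-> {y}|ny] /= := eqVneq y y0.
- case: (eqVneq x0 y0) odd0 => [<- /= ->|_ _].
    by rewrite ?eqxx /= expr1 mulN1r opprK.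
  by rewrite andbF mulrN opprK andbC signrMK.
- rewrite andbC; case: ifP => [/andP[/eqP-> /eqP y0x0]|_].
    by move: ny; rewrite -y0x0; case: eqP.
  by rewrite mulr0 oppr0.
- rewrite andbC; case: ifP => [/andP[/eqP-> /eqP y0x]|_].
    by move: nx; rewrite y0x; case: eqP.
  by rewrite mulr0 oppr0.
by rewrite [(y == x0) && _]andbC; case: ifP; rewrite ?mulr0 ?oppr0.
Qed.

Lemma coef_graded t x y z : graded_table t ->
  parity z != parity x (+) parity y -> coef t x y z = 0.
Proof.
move=> /allP gt pz; rewrite /coef big_seq big1 // => -[[[x0 y0] c] z0].
move=> /gt /andP[/eqP p0 _] /=.
case: eqP => // zz0; move: pz; rewrite zz0 p0.
case: ifP => [/andP[/eqP-> /eqP->]|_]; first by rewrite eqxx.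
by case: ifP => [/andP[/eqP-> /eqP->]|_] //; rewrite addbC eqxx.
Qed.

Section TableAlgebra.
Variables (F : fieldType) (a b : nat) (t : table).
Hypothesis lie_t : lie_table a b t.

Let I : finType := ('I_a + 'I_b)%type.
Let lab (i : I) : label :=
  match i with inl k => elabel k.+1 | inr k => flabel k.+1 end.

(* coordinates in the basis *)
Definition table_carrier : vectType F := {ffun 'I_a + 'I_b -> F^o}.

Definition table_bracket (u v : table_carrier) : table_carrier :=
  [ffun k => \sum_(i : I) \sum_(j : I)
     u i * v j * (coef t (lab i) (lab j) (lab k))%:~R].

Definition table_part (s : bool) : {vspace table_carrier} :=
  lker (linfun (fun u : table_carrier =>
    [ffun i => if parity (lab i) == s then 0 else u i] : table_carrier)).

Lemma table_partP s (u : table_carrier) :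
  reflect (forall i, parity (lab i) != s -> u i = 0) (u \in table_part s).
Proof.
rewrite memv_ker.
pose h (v : table_carrier) : table_carrier :=
  [ffun i => if parity (lab i) == s then 0 else v i].
have hl : linear h.
  move=> c v w; apply/ffunP => i; rewrite !ffunE /=.
  by case: ifP; rewrite // scaler0 addr0.
pose hh : {linear table_carrier -> table_carrier} :=
  HB.pack h (GRing.isLinear.Build F _ _ *:%R h hl).
rewrite -/h (lfunE hh) /=; apply: (iffP eqP) => [hu i pi|hu].
  by move/ffunP: hu => /(_ i); rewrite !ffunE (negPf pi).
by apply/ffunP => i; rewrite !ffunE; case: ifPn => // /hu.
Qed.

Fact table_bracket_l v : linear (table_bracket^~ v).
Proof.
move=> c u u'; apply/ffunP => k; rewrite !ffunE /= /GRing.scale /= mulr_sumr.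
rewrite -big_split; apply: eq_bigr => i _ /=; rewrite mulr_sumr -big_split.
by apply: eq_bigr => j _ /=; rewrite !ffunE !mulrDl !mulrA.
Qed.

Fact table_bracket_r u : linear (table_bracket u).
Proof.
move=> c v v'; apply/ffunP => k; rewrite !ffunE /= /GRing.scale /= mulr_sumr.
rewrite -big_split; apply: eq_bigr => i _ /=; rewrite mulr_sumr -big_split.
apply: eq_bigr => j _ /=; rewrite !ffunE mulrDr mulrDl /GRing.scale /=.
by rewrite !mulrA [c * _]mulrC.
Qed.

Let brT := bilfun table_bracket_l table_bracket_r.

Let gt : graded_table t. Proof. by case/andP: lie_t. Qed.

Lemma big_labels (g : label -> F) :
  \sum_(m <- labels a b) g m = \sum_(i : I) g (lab i).
Proof.
rewrite /labels big_cat !big_map big_sumType /= -[X in iota 0 X]subn0.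
rewrite big_mkord; congr (_ + _); rewrite -[X in iota 0 X]subn0.
by rewrite big_mkord.
Qed.

Lemma lab_mem i : lab i \in labels a b.
Proof.
rewrite mem_cat; case: i => i /=; apply/orP; [left|right];
  by apply: map_f; rewrite mem_iota ltn_ord.
Qed.

Local Notation cf i j k := ((coef t (lab i) (lab j) (lab k))%:~R : F).

Lemma table_jac (i j k l : I) :
  \sum_m cf j k m * cf i m l = \sum_m cf i j m * cf m k l +
   (-1) ^+ (parity (lab i) && parity (lab j)) * \sum_m cf i k m * cf j m l.
Proof.
have [_ /allP/(_ _ (lab_mem i))] := andP lie_t.
move=> /allP/(_ _ (lab_mem j)) /allP/(_ _ (lab_mem k)) /allP/(_ _ (lab_mem l)).
move=> /eqP/(congr1 (fun z : int => z%:~R : F)).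
rewrite rmorphD rmorphM /= rmorph_sign !rmorph_sum /=.
under eq_bigr do rewrite rmorphM /=.
under [X in _ = X + _ -> _]eq_bigr do rewrite rmorphM /=.
under [X in _ = _ + _ * X -> _]eq_bigr do rewrite rmorphM /=.
by rewrite !(big_labels (fun m => _%:~R * _%:~R)).
Qed.

Fact table_sum : (table_part false + table_part true)%VS = fullv.
Proof.
apply/vspaceP => u; rewrite memvf.
pose c s : table_carrier := [ffun i => if parity (lab i) == s then u i else 0].
have -> : u = c false + c true.
  by apply/ffunP => i; rewrite !ffunE; case: parity; rewrite /= ?add0r ?addr0.
by apply: memv_add; apply/table_partP => i pi; rewrite ffunE (negPf pi).
Qed.

Fact table_cap : (table_part false :&: table_part true)%VS = 0%VS.
Proof.
apply/eqP; rewrite -subv0; apply/subvP => u; rewrite memv_cap memv0.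
move=> /andP[/table_partP u0 /table_partP u1]; apply/eqP/ffunP => i.
by rewrite ffunE; case: (boolP (parity (lab i))) => pi;
  [apply: u0; rewrite pi | apply: u1; rewrite (negPf pi)].
Qed.

Fact table_bracket_part s s' u v : u \in table_part s -> v \in table_part s' ->
  brT u v \in table_part (s (+) s').
Proof.
move=> /table_partP us /table_partP vs; apply/table_partP => k pk.
rewrite bilfunE ffunE big1 // => i _; rewrite big1 // => j _.
have [pi|/us->] := eqVneq (parity (lab i)) s; last by rewrite !mul0r.
have [pj|/vs->] := eqVneq (parity (lab j)) s'; last by rewrite mulr0 mul0r.
by rewrite coef_graded ?mulr0 // pi pj.
Qed.

Fact table_skew s s' u v : u \in table_part s -> v \in table_part s' ->
  brT u v = - ((-1) ^+ (s && s') *: brT v u).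
Proof.
move=> /table_partP us /table_partP vs; apply/ffunP => k.
rewrite !bilfunE !ffunE /GRing.scale /= mulr_sumr -sumrN exchange_big /=.
apply: eq_bigr => j _; rewrite mulr_sumr -sumrN; apply: eq_bigr => i _.
have [pi|/us->] := eqVneq (parity (lab i)) s; last first.
  by rewrite mulr0 !mul0r mulr0 oppr0.
have [pj|/vs->] := eqVneq (parity (lab j)) s'; last first.
  by rewrite mulr0 !mul0r mulr0 oppr0.
rewrite (coef_skew _ _ _ gt) pi pj rmorphN rmorphM /= rmorph_sign.
by rewrite mulrN [v j * _]mulrC mulrCA.
Qed.

Lemma table_bracket3 u v w l : table_bracket u (table_bracket v w) l =
  \sum_i \sum_j \sum_k u i * v j * w k * \sum_m cf j k m * cf i m l.
Proof.
rewrite ffunE; apply: eq_bigr => i _.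
under eq_bigr do rewrite ffunE mulr_sumr mulr_suml.
rewrite exchange_big; apply: eq_bigr => j _ /=.
under eq_bigr do rewrite mulr_sumr mulr_suml.
rewrite exchange_big; apply: eq_bigr => k _ /=.
rewrite mulr_sumr; apply: eq_bigr => m _.
by rewrite !mulrA.
Qed.

Lemma table_bracket3' u v w l : table_bracket (table_bracket u v) w l =
  \sum_i \sum_j \sum_k u i * v j * w k * \sum_m cf i j m * cf m k l.
Proof.
rewrite ffunE exchange_big /=.
under eq_bigr => k _ do under eq_bigr => m _ do
  (rewrite ffunE -mulrA mulr_suml; under eq_bigr => i _ do rewrite mulr_suml).
under eq_bigr => k _ do
  (rewrite exchange_big /=; under eq_bigr => i _ do rewrite exchange_big /=).
rewrite exchange_big; apply: eq_bigr => i _ /=.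
rewrite exchange_big; apply: eq_bigr => j _ /=.
apply: eq_bigr => k _ /=; rewrite mulr_sumr; apply: eq_bigr => m _.
by rewrite -!mulrA [w k * (_ * _)]mulrCA.
Qed.

Fact table_jacobi s s' u v w : u \in table_part s -> v \in table_part s' ->
  brT u (brT v w) = brT (brT u v) w + (-1) ^+ (s && s') *: brT v (brT u w).
Proof.
move=> /table_partP us /table_partP vs; apply/ffunP => l.
rewrite !bilfunE [RHS]ffunE [X in _ = _ + X]ffunE /GRing.scale /=.
rewrite !table_bracket3 table_bracket3' [X in _ = _ + _ * X]exchange_big /=.
rewrite mulr_sumr -big_split; apply: eq_bigr => i _ /=.
rewrite mulr_sumr -big_split; apply: eq_bigr => j _ /=.
rewrite mulr_sumr -big_split; apply: eq_bigr => k _ /=.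
have [pi|/us->] := eqVneq (parity (lab i)) s; last first.
  by rewrite mulr0 !mul0r mulr0 addr0.
have [pj|/vs->] := eqVneq (parity (lab j)) s'; last first.
  by rewrite mulr0 !mul0r mulr0 addr0.
rewrite table_jac pi pj mulrDr; congr (_ + _).
by rewrite [v j * _]mulrC mulrCA.
Qed.

Definition table_alg : lieSuperalg F :=
  LieSuperalg table_sum table_cap table_bracket_part table_skew table_jacobi.
End TableAlgebra.

Local Notation e := elabel.
Local Notation f := flabel.

(* A table whose values never occur as arguments is two-step nilpotent.       *)
Lemma two_step_table (a b : nat) (t : table) (z0 : label) : graded_table t ->
  all (fun r => let: (x, y, c, z) := r in
         [&& z == z0, x != z0 & y != z0]) t -> lie_table a b t.
Proof.
move=> gt /allP tz; rewrite /lie_table gt /=.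
have val x y z : z != z0 -> coef t x y z = 0.
  move=> zz; rewrite /coef big_seq big1 // => -[[[x1 y1] c1] z1] /tz.
  by move=> /and3P[/eqP -> _ _] /=; rewrite zz.
have argr x y : coef t x z0 y = 0.
  rewrite /coef big_seq big1 // => -[[[x1 y1] c1] z1] /tz /and3P[_ nx ny] /=.
  by rewrite ![z0 == _]eq_sym (negPf nx) (negPf ny) !andbF !if_same.
have argl x y : coef t z0 x y = 0 by rewrite coef_skew // argr mulr0 oppr0.
have jr x y z w : \sum_(m <- labels a b) coef t y z m * coef t x m w = 0.
  by rewrite big1 // => m _; have [->|/val->] := eqVneq m z0;
    rewrite ?argr ?mulr0 ?mul0r.
have jl x y z w : \sum_(m <- labels a b) coef t x y m * coef t m z w = 0.
  by rewrite big1 // => m _; have [->|/val->] := eqVneq m z0;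
    rewrite ?argl ?mulr0 ?mul0r.
apply/allP => x _; apply/allP => y _; apply/allP => z _; apply/allP => w _.
by rewrite !jr jl mulr0 addr0.
Qed.

Definition table_H (m n : nat) : table :=
  [seq (e i, e (m + i), 1, e (2 * m).+1) | i <- iota 1 m] ++
  [seq (f j, f j, 1, e (2 * m).+1) | j <- iota 1 n].

Definition table_Hodd (m : nat) : table :=
  [seq (e j, f j, 1, f m.+1) | j <- iota 1 m].

Fact lie_table_H m n : lie_table (2 * m).+1 n (table_H m n).
Proof.
apply: (@two_step_table _ _ _ (e (2 * m).+1)).
  apply/allP => r; rewrite mem_cat => /orP[] /mapP[i]; rewrite mem_iota => hi -> /=.
    apply/implyP => /eqP[]/eqP; lia.
  by rewrite implybT.
apply/allP => r; rewrite mem_cat => /orP[] /mapP[i]; rewrite mem_iota => hi -> /=.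
  by rewrite eqxx /=; apply/andP; split; apply/eqP => -[]; lia.
by rewrite eqxx.
Qed.

Fact lie_table_Hodd m : lie_table m m.+1 (table_Hodd m).
Proof.
apply: (@two_step_table _ _ _ (f m.+1)).
  by apply/allP => r /mapP[i _ ->].
apply/allP => r /mapP[i]; rewrite mem_iota => hi -> /=.
by rewrite eqxx /=; apply/eqP => -[]; lia.
Qed.

Fact lie_table_nil a b : lie_table a b [::].
Proof. exact: (@two_step_table _ _ _ (e 0)). Qed.

Definition abelian_alg (F : fieldType) (a b : nat) : lieSuperalg F :=
  table_alg F (lie_table_nil a b).
(* H(m,n), even center: even basis x_1, ..., x_2m, z and odd basis y_1, ..., y_n. *)
Definition heis_even (F : fieldType) (m n : nat) : lieSuperalg F :=
  table_alg F (lie_table_H m n).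
(* H_m, odd center: even basis x_1, ..., x_m and odd basis y_1, ..., y_m, z. *)
Definition heis_odd (F : fieldType) (m : nat) : lieSuperalg F :=
  table_alg F (lie_table_Hodd m).

Definition table_4_0_2 : table :=
  [:: (e 1, e 2, 1, e 3);
      (e 1, e 3, 1, e 4)].
Definition table_2_2_1 : table :=
  [:: (f 1, f 1, 1, e 1);
      (f 2, f 2, 1, e 2)].
Definition table_2_2_4 : table :=
  [:: (f 1, f 2, 1, e 1);
      (f 2, f 2, 1, e 2)].
Definition table_2_2_6 : table :=
  [:: (e 2, f 2, 1, f 1);
      (f 2, f 2, 1, e 1)].
Definition table_1_3_1 : table :=
  [:: (e 1, f 2, 1, f 1);
      (e 1, f 3, 1, f 2)].
Definition table_5_0_3 : table :=
  [:: (e 1, e 2, 1, e 3);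
      (e 1, e 3, 1, e 4);
      (e 1, e 4, 1, e 5);
      (e 2, e 3, 1, e 5)].
Definition table_5_0_4 : table :=
  [:: (e 1, e 2, 1, e 3);
      (e 1, e 3, 1, e 4);
      (e 1, e 4, 1, e 5)].
Definition table_5_0_5 : table :=
  [:: (e 1, e 2, 1, e 3);
      (e 1, e 4, 1, e 5);
      (e 2, e 3, 1, e 5)].
Definition table_4_1_6 : table :=
  [:: (e 1, e 2, 1, e 3);
      (e 1, e 3, 1, e 4);
      (f 1, f 1, 1, e 4)].
Definition table_1_4_7 : table :=
  [:: (e 1, f 2, 1, f 1);
      (e 1, f 3, 1, f 2);
      (e 1, f 4, 1, f 3)].
Definition table_3_2_13 : table :=
  [:: (e 1, e 2, 1, e 3);
      (e 1, f 2, 1, f 1);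
      (f 1, f 2, 1, e 3);
      (f 2, f 2, 2, e 2)].
Definition table_2_3_18 : table :=
  [:: (e 1, f 3, 1, f 1);
      (e 2, f 2, 1, f 1);
      (f 2, f 2, 2, e 1);
      (f 2, f 3, -1, e 2)].
Definition table_2_3_19 : table :=
  [:: (e 1, f 3, 1, f 1);
      (e 2, f 2, 1, f 1);
      (f 2, f 3, -1, e 1);
      (f 3, f 3, 2, e 2)].
Definition table_2_3_23 : table :=
  [:: (e 1, f 2, 1, f 1);
      (e 1, f 3, 1, f 2);
      (f 1, f 3, -1, e 2);
      (f 2, f 2, 1, e 2)].
Definition table_2_3_24 : table :=
  [:: (e 1, f 2, 1, f 1);
      (e 1, f 3, 1, f 2);
      (e 2, f 3, 1, f 1)].

Ltac lie_table_tac :=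
  rewrite /lie_table /jacobi_table /coef !unlock; vm_compute; reflexivity.

Fact lie_table_4_0_2 : lie_table 4 0 table_4_0_2.
Proof. lie_table_tac. Qed.
Fact lie_table_2_2_1 : lie_table 2 2 table_2_2_1.
Proof. lie_table_tac. Qed.
Fact lie_table_2_2_4 : lie_table 2 2 table_2_2_4.
Proof. lie_table_tac. Qed.
Fact lie_table_2_2_6 : lie_table 2 2 table_2_2_6.
Proof. lie_table_tac. Qed.
Fact lie_table_1_3_1 : lie_table 1 3 table_1_3_1.
Proof. lie_table_tac. Qed.
Fact lie_table_5_0_3 : lie_table 5 0 table_5_0_3.
Proof. lie_table_tac. Qed.
Fact lie_table_5_0_4 : lie_table 5 0 table_5_0_4.
Proof. lie_table_tac. Qed.
Fact lie_table_5_0_5 : lie_table 5 0 table_5_0_5.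
Proof. lie_table_tac. Qed.
Fact lie_table_4_1_6 : lie_table 4 1 table_4_1_6.
Proof. lie_table_tac. Qed.
Fact lie_table_1_4_7 : lie_table 1 4 table_1_4_7.
Proof. lie_table_tac. Qed.
Fact lie_table_3_2_13 : lie_table 3 2 table_3_2_13.
Proof. lie_table_tac. Qed.
Fact lie_table_2_3_18 : lie_table 2 3 table_2_3_18.
Proof. lie_table_tac. Qed.
Fact lie_table_2_3_19 : lie_table 2 3 table_2_3_19.
Proof. lie_table_tac. Qed.
Fact lie_table_2_3_23 : lie_table 2 3 table_2_3_23.
Proof. lie_table_tac. Qed.
Fact lie_table_2_3_24 : lie_table 2 3 table_2_3_24.
Proof. lie_table_tac. Qed.

Definition alg_4_0_2 (F : fieldType) := table_alg F lie_table_4_0_2.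
Definition alg_2_2_1 (F : fieldType) := table_alg F lie_table_2_2_1.
Definition alg_2_2_4 (F : fieldType) := table_alg F lie_table_2_2_4.
Definition alg_2_2_6 (F : fieldType) := table_alg F lie_table_2_2_6.
Definition alg_1_3_1 (F : fieldType) := table_alg F lie_table_1_3_1.
Definition alg_5_0_3 (F : fieldType) := table_alg F lie_table_5_0_3.
Definition alg_5_0_4 (F : fieldType) := table_alg F lie_table_5_0_4.
Definition alg_5_0_5 (F : fieldType) := table_alg F lie_table_5_0_5.
Definition alg_4_1_6 (F : fieldType) := table_alg F lie_table_4_1_6.
Definition alg_1_4_7 (F : fieldType) := table_alg F lie_table_1_4_7.
Definition alg_3_2_13 (F : fieldType) := table_alg F lie_table_3_2_13.
Definition alg_2_3_18 (F : fieldType) := table_alg F lie_table_2_3_18.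
Definition alg_2_3_19 (F : fieldType) := table_alg F lie_table_2_3_19.
Definition alg_2_3_23 (F : fieldType) := table_alg F lie_table_2_3_23.
Definition alg_2_3_24 (F : fieldType) := table_alg F lie_table_2_3_24.

(* Isomorphism with an algebra whose table involves [y_j, y_j] = z needs      *)
(* square roots: if c is not a square, [y_1, y_1] = z, [y_2, y_2] = c z has   *)
(* the same st as H(0,2) without being isomorphic to it.                      *)
Definition square_closed (F : fieldType) : Prop :=
  forall c : F, exists d : F, d ^+ 2 = c.

(* Main.v *)
Require Import Defs.
From mathcomp Require Import all_boot all_order all_algebra.
From mathcomp Require Import zify ring.
From HB Require Import structures.
Set Implicit Arguments.
Unset Strict Implicit.
Unset Printing Implicit Defensive.
Import Order.TTheory GRing.Theory Num.Theory.
Local Open Scope ring_scope.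

(** Write [D = L^2], [Z] for the center, [N = D + Z], and let [d = p + q],
    [r = dim D], [z = dim (D cap Z)]. Everything rests on a dimension count.
    By nilpotency a minimal generating set of [L/Z] lifts to a homogeneous
    basis of a complement of [N] ([min_generator_lift]), so [L/Z] has
    superdimension [(p|q) + sdim D - sdim (D cap Z)], and the two entries of
    [st(L)] add up to [(d - 1)(r - 1) + (z - 1)] as soon as [D] is nonzero.
    One generator of [L/Z] gives [r <= 1], and a nonzero [D] meets the center;
    hence [st(L) = (0, 0)] exactly when [r <= 1], a total of 1 forces
    [(d, r, z) = (2, 2, 1)], and a total of 2 leaves only [(2, 2, 2)],
    [(3, 2, 1)] and [(2, 3, 1)] ([total_cases]).

    If [r <= 1] the bracket is a bilinear form with values in a line spanned by
    a homogeneous central vector; hyperbolic pairs, and orthonormal vectors over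
    a square closed field, turn it into a Heisenberg superalgebra
    ([heisenberg_list]). In the other cases the Jacobi identity and nilpotency
    determine the brackets of two or three generators up to scalars that a
    change of generators normalizes ([derived_dim2] and the lemmas on three
    dimensional [D]). Only the pencil of two quadratic forms given by two odd
    generators with a central [D] needs square roots ([dim22_odd]).

    To conclude that [L] is one of the algebras of the lists it is enough to
    find homogeneous vectors that multiply as its table prescribes, generate [L]
    modulo [N] and are [d + r] in number ([recognize]). Conversely, an isomorphism
    with a listed algebra gives a partial basis of [L] multiplying by the table,
    from which the value of st is computed ([realizes_st]). These values separate
    the lists, so that the partial classification by the total refines to the
    classification by the pair ([classification]). *)

(** * Brackets, gradings and the lower central series *)

Notation "⟦ x , y ⟧" := (bracket _ x y) (at level 0, format "⟦ x ,  y ⟧").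

Lemma subvf_eq (F : fieldType) (V : vectType F) (U : {vspace V}) :
  (fullv <= U)%VS = (U == fullv).
Proof. by rewrite eqEsubv subvf. Qed.

Section Basics.
Variables (F : fieldType) (L : lieSuperalg F).
Implicit Types (x y z : L) (U V W K : {vspace L}).
Local Notation Z := (center L).
Local Notation D := (derived L).
Local Notation lc := (lower_central L).

Lemma brDl x y z : ⟦x + y, z⟧ = ⟦x, z⟧ + ⟦y, z⟧.
Proof. by rewrite linearD add_lfunE. Qed.
Lemma brDr x y z : ⟦x, y + z⟧ = ⟦x, y⟧ + ⟦x, z⟧.
Proof. by rewrite linearD. Qed.
Lemma brNl x y : ⟦- x, y⟧ = - ⟦x, y⟧.
Proof. by rewrite linearN opp_lfunE. Qed.
Lemma brNr x y : ⟦x, - y⟧ = - ⟦x, y⟧.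
Proof. by rewrite linearN. Qed.
Lemma brZl c x y : ⟦c *: x, y⟧ = c *: ⟦x, y⟧.
Proof. by rewrite linearZ scale_lfunE. Qed.
Lemma brZr c x y : ⟦x, c *: y⟧ = c *: ⟦x, y⟧.
Proof. by rewrite linearZ. Qed.
Lemma br0l x : ⟦0 : L, x⟧ = 0.
Proof. by rewrite linear0 zero_lfunE. Qed.
Lemma br0r x : ⟦x, 0⟧ = 0.
Proof. by rewrite linear0. Qed.
Lemma br_suml I (r : seq I) (P : pred I) (E : I -> L) x :
  ⟦\sum_(i <- r | P i) E i, x⟧ = \sum_(i <- r | P i) ⟦E i, x⟧.
Proof. by rewrite linear_sum sum_lfunE. Qed.
Lemma br_sumr I (r : seq I) (P : pred I) (E : I -> L) x :
  ⟦x, \sum_(i <- r | P i) E i⟧ = \sum_(i <- r | P i) ⟦x, E i⟧.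
Proof. by rewrite linear_sum. Qed.
Definition brE := (brDl, brDr, brNl, brNr, brZl, brZr, br0l, br0r).

(** A linear map, so that preimages under it are subspaces. *)
Definition ad_right y x : L := ⟦x, y⟧.
Fact ad_right_linear y : linear (ad_right y).
Proof. by move=> c u v; rewrite /ad_right brDl brZl. Qed.
HB.instance Definition _ y :=
  GRing.isLinear.Build F L L *:%R (ad_right y) (ad_right_linear y).

Lemma mem_adrP y W x : (x \in (linfun (ad_right y) @^-1: W)%VS) = (⟦x, y⟧ \in W).
Proof. by rewrite -memv_preim lfunE. Qed.

Lemma brv_subP U V W :
  (forall u v, u \in U -> v \in V -> ⟦u, v⟧ \in W) -> (brv U V <= W)%VS.
Proof.
move=> H; apply/span_subvP => _ /allpairsP[[u v] [/= uU vV ->]].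
by apply: H; apply: vbasis_mem.
Qed.

(** Brackets of subspaces are spanned by brackets of spanning families. *)
Lemma span_brv X Y W : (forall x y, x \in X -> y \in Y -> ⟦x, y⟧ \in W) ->
  forall x y, x \in <<X>>%VS -> y \in <<Y>>%VS -> ⟦x, y⟧ \in W.
Proof.
move=> H x y xX yY; rewrite -mem_adrP; move: x xX.
apply/subvP/span_subvP => x xX; rewrite mem_adrP (memv_preim (bracket L x)).
move: y yY; apply/subvP/span_subvP => y yY.
by rewrite -memv_preim; apply: H.
Qed.

Lemma gradedP U : (forall x0 x1, x0 \in part L false -> x1 \in part L true ->
  x0 + x1 \in U -> x0 \in U) -> graded U.
Proof.
move=> H; apply/eqP; rewrite eqEsubv subv_add !capvSl; apply/subvP => x xU.
have [x0 [x1 [L0 L1 E]]] := part_decomp x.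
have x0U : x0 \in U by apply: (H x0 x1) => //; rewrite -E.
have x1U : x1 \in U by rewrite -(addKr x0 x1) -E rpredD ?rpredN.
by rewrite E memv_add // memv_cap ?x0U ?x1U.
Qed.

Lemma graded_decomp U x : graded U -> x \in U ->
  exists x0 x1, [/\ x0 \in U, x0 \in part L false, x1 \in U, x1 \in part L true
                  & x = x0 + x1].
Proof.
move=> gU; rewrite -{1}gU => /memv_addP[x0 + [x1 + ->]]; rewrite !memv_cap.
by move=> /andP[? ?] /andP[? ?]; exists x0, x1.
Qed.

Lemma graded_split U x0 x1 : graded U -> x0 \in part L false ->
  x1 \in part L true -> x0 + x1 \in U -> x0 \in U /\ x1 \in U.
Proof.
move=> gU L0 L1 /(graded_decomp gU)[y0 [y1 [U0 M0 U1 M1 E]]].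
have [] // := @part_eq0 _ _ (x0 - y0) (x1 - y1).
- by rewrite rpredB.
- by rewrite rpredB.
- by rewrite addrACA -opprD E subrr.
by move=> /subr0_eq -> /subr0_eq ->.
Qed.

Lemma graded_full : graded (fullv : {vspace L}).
Proof. by apply: gradedP => *; apply: memvf. Qed.

Lemma graded_center : graded Z.
Proof. by apply: gradedP => x0 x1 L0 L1 /(center_hom L0 L1)[]. Qed.

Lemma graded_add U V : graded U -> graded V -> graded (U + V)%VS.
Proof.
move=> gU gV; apply: gradedP => x0 x1 L0 L1 /memv_addP[u uU [v vV E]].
have [u0 [u1 [U0 M0 U1 M1 Eu]]] := graded_decomp gU uU.
have [v0 [v1 [V0 P0 V1 P1 Ev]]] := graded_decomp gV vV.
suff -> : x0 = u0 + v0 by rewrite memv_add.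
have [] // := @part_eq0 _ _ (x0 - (u0 + v0)) (x1 - (u1 + v1)).
- by rewrite rpredB // rpredD.
- by rewrite rpredB // rpredD.
- by rewrite addrACA -opprD E Eu Ev (addrACA u0) subrr.
by move=> /subr0_eq.
Qed.

Lemma graded_cap U V : graded U -> graded V -> graded (U :&: V)%VS.
Proof.
move=> gU gV; apply: gradedP => x0 x1 L0 L1; rewrite !memv_cap => /andP[].
by move=> /(graded_split gU L0 L1)[-> _] /(graded_split gV L0 L1)[-> _].
Qed.

Lemma graded_brv U V : graded U -> graded V -> graded (brv U V).
Proof.
move=> gU gV; apply/eqP; rewrite eqEsubv subv_add !capvSl /=.
apply: brv_subP => u v /(graded_decomp gU)[u0 [u1 [U0 M0 U1 M1 ->]]].
move=> /(graded_decomp gV)[v0 [v1 [V0 P0 V1 P1 ->]]].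
rewrite brDl !brDr; do ![apply: rpredD].
- apply: subvP (addvSl _ _) _ _; rewrite memv_cap brv_mem //.
  exact: (bracket_part M0 P0).
- apply: subvP (addvSr _ _) _ _; rewrite memv_cap brv_mem //.
  exact: (bracket_part M0 P1).
- apply: subvP (addvSr _ _) _ _; rewrite memv_cap brv_mem //.
  exact: (bracket_part M1 P0).
apply: subvP (addvSl _ _) _ _; rewrite memv_cap brv_mem //.
exact: (bracket_part M1 P1).
Qed.

Lemma graded_lc n : graded (lc n).
Proof.
elim: n => [|n IH]; first exact: graded_full.
exact: graded_brv graded_full IH.
Qed.

Lemma graded_dim U : graded U ->
  (\dim (U :&: part L false) + \dim (U :&: part L true))%N = \dim U.
Proof.
move=> gU; rewrite -{3}gU; symmetry; apply: dimv_disjoint_sum.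
apply/eqP; rewrite -subv0; apply/subvP => x.
rewrite !memv_cap => /andP[/andP[_ x0] /andP[_ x1]].
by rewrite memv0 (part_cap0 x0 x1).
Qed.

Lemma graded_add_part U V s : graded U -> graded V ->
  ((U + V) :&: part L s)%VS = (U :&: part L s + V :&: part L s)%VS.
Proof.
move=> gU gV; apply/eqP; rewrite eqEsubv andbC subv_add !capvS ?addvSl ?addvSr //=.
apply/subvP => x; rewrite memv_cap => /andP[/memv_addP[u uU [v vV ->]]] xs.
have [u0 [u1 [U0 M0 U1 M1 Eu]]] := graded_decomp gU uU.
have [v0 [v1 [V0 P0 V1 P1 Ev]]] := graded_decomp gV vV.
case: s xs => xs.
  have E : u + v = u1 + v1.
    rewrite Eu Ev addrACA.
    have [] // := @part_eq0 _ _ (u0 + v0) (u1 + v1 - (u + v)).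
    - by rewrite rpredD.
    - by rewrite rpredB // rpredD.
    - by rewrite addrA Eu Ev addrACA subrr.
    by move=> -> _; rewrite add0r.
  by rewrite E memv_add // memv_cap ?U1 ?V1.
have E : u + v = u0 + v0.
  rewrite Eu Ev addrACA.
  have [] // := @part_eq0 _ _ (u0 + v0 - (u + v)) (u1 + v1).
  - by rewrite rpredB // rpredD.
  - by rewrite rpredD.
  - by rewrite addrAC Eu Ev addrACA subrr.
  by move=> _ ->; rewrite addr0.
by rewrite E memv_add // memv_cap ?U0 ?V0.
Qed.

Lemma lc_br n x y : y \in lc n -> ⟦x, y⟧ \in lc n.+1.
Proof. by move=> yn; rewrite /= brv_mem ?memvf. Qed.

Lemma lc_sub n : (lc n.+1 <= lc n)%VS.
Proof.
elim: n => [|n IH]; first exact: subvf.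
by apply: brv_subP => u v _ /(subvP IH); apply: lc_br.
Qed.

Lemma lc_le m n : (m <= n)%N -> (lc n <= lc m)%VS.
Proof.
move=> /subnK <-; elim: (n - m)%N => //= k IH.
exact: subv_trans (lc_sub _) IH.
Qed.

Lemma lc_swap n x y : x \in lc n -> ⟦x, y⟧ \in lc n.+1.
Proof.
move=> xn; have [x0 [x1 [U0 M0 U1 M1 ->]]] := graded_decomp (graded_lc n) xn.
have [y0 [y1 [P0 P1 ->]]] := part_decomp y; rewrite !brE.
rewrite (bracket_skew M0 P0) (bracket_skew M1 P0).
rewrite (bracket_skew M0 P1) (bracket_skew M1 P1).
by rewrite !rpredD ?rpredN ?rpredZ // lc_br.
Qed.

(** The Jacobi identity moves one bracket from the left factor to the right. *)
Lemma lc1_br n x y : x \in lc 1 -> y \in lc n -> ⟦x, y⟧ \in lc n.+2.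
Proof.
move=> x1 yn; rewrite -mem_adrP; move: x x1; apply/subvP/brv_subP => u v _ _.
rewrite mem_adrP.
have hom a b u' v' : u' \in part L a -> v' \in part L b ->
    ⟦⟦u', v'⟧, y⟧ \in lc n.+2.
  move=> pu pv.
  have -> : ⟦⟦u', v'⟧, y⟧ = ⟦u', ⟦v', y⟧⟧ - (-1) ^+ (a && b) *: ⟦v', ⟦u', y⟧⟧.
    by rewrite (bracket_jacobi y pu pv) addrK.
  by rewrite rpredB ?rpredZ // !lc_br.
have [u0 [u1 [U0 U1 ->]]] := part_decomp u.
have [v0 [v1 [V0 V1 ->]]] := part_decomp v.
by rewrite !brE !rpredD ?(hom _ _ _ _ U0 V0) ?(hom _ _ _ _ U0 V1)
  ?(hom _ _ _ _ U1 V0) ?(hom _ _ _ _ U1 V1).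
Qed.

(** The last nonzero term of the series is central. *)
Lemma lc_center n : lc n.+1 = 0%VS -> (lc n <= Z)%VS.
Proof.
move=> E; apply/subvP => x xn; rewrite memv_ker; apply/eqP/lfunP => y.
by rewrite zero_lfunE; apply/eqP; rewrite -memv0 -E lc_swap.
Qed.

Section Nilpotent.
Hypothesis nilL : nilpotent_lie L.

Lemma lc_stab n : (lc n <= lc n.+1)%VS -> lc n = 0%VS.
Proof.
move=> H; have [m E] := nilL.
have step k : (lc n <= lc (n + k))%VS.
  elim: k => [|k IH]; first by rewrite addn0.
  apply: subv_trans H _; rewrite addnS.
  by apply: brv_subP => u v _ /(subvP IH); apply: lc_br.
apply/eqP; rewrite -subv0 -E; apply: subv_trans (step m) _.
by apply: lc_le; rewrite leq_addl.
Qed.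

(** Two equal consecutive terms would make the series constant from there on. *)
Lemma lc_dim n : (\dim (lc n.+1) <= (\dim (lc n)).-1)%N.
Proof.
have [le eq] := dimv_leqif_sup (lc_sub n).
have := eq; case: (boolP (lc n <= lc n.+1)%VS) => [H|_] E.
  suff -> : lc n.+1 = 0%VS by rewrite dimv0.
  by apply/eqP; rewrite -subv0 -(lc_stab H) lc_sub.
by move: le E; case: ltngtP => //; case: (\dim (lc n)).
Qed.

(** Inner derivations are nilpotent, so that their eigenvalues vanish; the shift
    by a central [c] is absorbed into the eigenvector. *)
Lemma nil_eigen x y a c : ⟦x, y⟧ = a *: y + c -> c \in Z -> a != 0 -> y \in Z.
Proof.
move=> E cZ a0; pose y' := y + a^-1 *: c.
have E' : y' = a^-1 *: ⟦x, y'⟧.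
  rewrite /y' brDr brZr (bracket_center _ cZ) scaler0 addr0 E.
  by rewrite scalerDr scalerA mulVf // scale1r.
have y'n n : y' \in lc n.
  by elim: n => [|n IH]; [rewrite memvf | rewrite E' rpredZ // lc_br].
have [n lcn] := nilL; have := y'n n; rewrite lcn memv0 => /eqP y0.
by rewrite -[y](addrK (a^-1 *: c)) -/y' y0 sub0r rpredN rpredZ.
Qed.

(** A subalgebra [K] with [K + L^2 = L] is everything: by induction every term of
    the series lies in its intersection with [K] plus the next term. *)
Lemma subalg_full K : (forall x y, x \in K -> y \in K -> ⟦x, y⟧ \in K) ->
  (K + D = fullv)%VS -> K = fullv.
Proof.
move=> cK KD.
have step n : (lc n <= K :&: lc n + lc n.+1)%VS.
  elim: n => [|n IH]; first by rewrite capvf /= -/(derived L) KD.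
  apply: brv_subP => u v _ /(subvP IH) /memv_addP[k + [w wn ->]].
  rewrite memv_cap => /andP[kK kn].
  have /memv_addP[k' k'K [d dD ->]] : u \in (K + D)%VS by rewrite KD memvf.
  rewrite brDr brDl -addrA memv_add //.
    by rewrite memv_cap cK // lc_br.
  by apply: rpredD; [apply: lc1_br | apply: lc_br].
have [m E] := nilL.
have all n : (K + lc n = fullv)%VS.
  elim: n => [|n IH]; first by rewrite addvf.
  apply/eqP; rewrite -subvf_eq -IH subv_add addvSl /=.
  by apply: subv_trans (step n) _; rewrite addvS ?capvSl.
by have := all m; rewrite E addv0.
Qed.

End Nilpotent.
End Basics.

(** * Generators and the invariant st *)

(** The preimage of the derived algebra of [L/Z(L)]: generators of [L/Z(L)]
    are counted modulo it. *)
Definition cogen (F : fieldType) (L : lieSuperalg F) : {vspace L} :=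
  (derived L + center L)%VS.

Definition homogeneous (F : fieldType) (L : lieSuperalg F) (x : L) : Prop :=
  exists s, x \in part L s.

(** A family of too small a span modulo [N] has a redundant member. *)
Lemma seq_split_dep (F : fieldType) (V : vectType F) (X : seq V) (N : {vspace V}) :
  (\dim (<<X>> + N) < size X + \dim N)%N ->
  exists X1 x X2, X = X1 ++ x :: X2 /\ x \in (<<X1 ++ X2>> + N)%VS.
Proof.
elim: X => [|x X IH] /=; first by rewrite span_nil add0v add0n ltnn.
have [xX _|xX] := boolP (x \in (<<X>> + N)%VS); first by exists [::], x, X.
rewrite span_cons -addvA dimv_disjoint_sum; last first.
  apply/eqP; rewrite -subv0; apply/subvP => y; rewrite memv_cap.
  case/andP=> /vlineP[k ->]; have [->|k0] := eqVneq k 0.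
    by rewrite scale0r memv0.
  by move=> /(memvZ k^-1); rewrite scalerA mulVf // scale1r (negPf xX).
rewrite dim_vline addSn; have -> : x != 0 by apply: contraNneq xX => ->; rewrite mem0v.
rewrite add1n ltnS => /IH[X1 [y [X2 [-> yX]]]].
exists (x :: X1), y, X2; split=> //=; move: y yX; apply/subvP.
by rewrite addvS // span_cons addvSr.
Qed.

Lemma lift_seq (F : fieldType) (V W : vectType F) (g : 'Hom(V, W)) U (X : seq W) :
  {subset X <= (g @: U)%VS} -> exists2 Y : seq V, {subset Y <= U} & map g Y = X.
Proof.
elim: X => [|x X IH] sX; first by exists [::].
have [|Y YU YX] := IH; first by move=> y yX; apply: sX; rewrite inE yX orbT.
have /memv_imgP[y yU xy] := sX x (mem_head _ _).
exists (y :: Y); last by rewrite /= YX xy.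
by move=> z; rewrite inE => /predU1P[->|/YU].
Qed.

Section Generators.
Variables (F : fieldType) (L : lieSuperalg F).
Hypothesis nilL : nilpotent_lie L.
Implicit Types (x y z : L) (U V W K : {vspace L}).
Local Notation Z := (center L).
Local Notation D := (derived L).
Local Notation N := (cogen L).
Local Notation Q := (central_quotient L).
Local Notation pr := (quo_proj L).
Local Notation lc := (lower_central L).

Lemma graded_derived : graded D.
Proof. exact: graded_lc L 1. Qed.

Lemma graded_cogen : graded N.
Proof. exact: graded_add graded_derived (graded_center L). Qed.

Lemma derived_br x y : ⟦x, y⟧ \in D.
Proof. by rewrite brv_mem ?memvf. Qed.

Lemma graded_span (X Y : seq L) : {subset X <= part L false} ->
  {subset Y <= part L true} -> graded <<X ++ Y>>%VS.
Proof.
move=> /span_subvP/subvP sX /span_subvP/subvP sY; apply: gradedP => x0 x1 L0 L1.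
rewrite span_cat => /memv_addP[x xX [y yY E]].
suff -> : x0 = x by apply: subvP (addvSl _ _) _ _.
have [] // := @part_eq0 _ _ (x0 - x) (x1 - y).
- by rewrite rpredB // sX.
- by rewrite rpredB // sY.
- by rewrite addrACA -opprD E subrr.
by move=> /subr0_eq.
Qed.

Lemma span_part (X Y : seq L) : {subset X <= part L false} ->
    {subset Y <= part L true} ->
  (<<X ++ Y>> :&: part L false = <<X>>)%VS /\
  (<<X ++ Y>> :&: part L true = <<Y>>)%VS.
Proof.
move=> /span_subvP sX /span_subvP sY; have /subvP sX' := sX; have /subvP sY' := sY.
split; apply/eqP; rewrite eqEsubv subv_cap span_cat ?sX ?sY ?addvSl ?addvSr /= ?andbT.
  apply/subvP => x; rewrite memv_cap => /andP[/memv_addP[u uX [v vY ->]] xs].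
  have /part_cap0 : v \in part L false by rewrite -(addKr u v) rpredD // rpredN sX'.
  by move=> /(_ (sY' _ vY)) ->; rewrite addr0.
apply/subvP => x; rewrite memv_cap => /andP[/memv_addP[u uX [v vY ->]] xs].
have /(part_cap0 (sX' _ uX)) : u \in part L true.
  by rewrite -(addrK v u) rpredD // rpredN sY'.
by move=> ->; rewrite add0r.
Qed.

Lemma graded_line U : graded U -> \dim U = 1%N ->
  exists w s, [/\ w \in part L s, w != 0 & U = <[w]>%VS].
Proof.
move=> gU dU; have dg := graded_dim gU; rewrite dU in dg.
have [s ds] : exists s, \dim (U :&: part L s) = 1%N.
  case E0: (\dim _) dg => [|[|n]]; [exists true | exists false | ] => //.
have U0 : (U :&: part L s)%VS != 0%VS by rewrite -dimv_eq0 ds.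
have := memv_pick (U :&: part L s); rewrite -vpick0 in U0.
rewrite memv_cap => /andP[wU ws]; exists (vpick (U :&: part L s)), s; split=> //.
by apply/eqP; rewrite eq_sym eqEdim -memvE wU dU dim_vline U0.
Qed.

Lemma quo_dim s :
  (\dim (part Q s) + \dim (Z :&: part L s) = \dim (part L s))%N.
Proof.
rewrite -[RHS](limg_ker_dim pr) addnC capvC /=; congr (\dim (_ :&: _) + _)%N.
by apply/vspaceP => x; rewrite memv_ker quo_ker.
Qed.

Lemma quo_br (x y : L) : bracket Q (pr x) (pr y) = pr ⟦x, y⟧.
Proof. by rewrite [LHS]bilfunE quo_bracketE. Qed.

Lemma pr_surj (u : Q) : exists x, u = pr x.
Proof. by exists (vsval u); rewrite quo_proj_val. Qed.

(** The image of the span together with that of [L^2] is a graded subalgebra,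
    because it contains all brackets. *)
Lemma generates_span (X Y : seq L) : {subset X <= part L false} ->
    {subset Y <= part L true} -> @generates F Q (map pr (X ++ Y)) ->
  (<<X ++ Y>> + N)%VS = fullv.
Proof.
move=> sX sY /(_ (pr @: (<<X ++ Y>> + N))%VS) H.
set K := (<<X ++ Y>> + N)%VS in H *.
have gK : graded K by apply: graded_add (graded_span sX sY) graded_cogen.
have {}H : (pr @: K)%VS = fullv.
  apply: H => [|_ /mapP[x xX ->]]; last first.
    by rewrite memv_img // (subvP (addvSl _ _)) // memv_span.
  split.
    apply: gradedP => u0 u1 /memv_imgP[x0 L0 ->] /memv_imgP[x1 L1 ->].
    case/memv_imgP=> x xK E.
    have xx : x0 + x1 \in K.
      have -> : x0 + x1 = x + (x0 + x1 - x) by rewrite [RHS]addrC subrK.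
      rewrite rpredD // (subvP (addvSr _ _)) // (subvP (addvSr _ _)) //.
      by rewrite -quo_ker linearB linearD /= -E subrr.
    by have [x0K _] := graded_split gK L0 L1 xx; rewrite memv_img.
  apply: brv_subP => _ _ /memv_imgP[x xK ->] /memv_imgP[y yK ->].
  rewrite quo_br memv_img // (subvP (addvSr _ _)) // (subvP (addvSl _ _)) //.
  exact: derived_br.
apply/eqP; rewrite -subvf_eq; apply/subvP => x _.
have : pr x \in (pr @: K)%VS by rewrite H memvf.
case/memv_imgP=> y yK E; rewrite -[x](subrK y) rpredD //.
by rewrite (subvP (addvSr _ _)) // (subvP (addvSr _ _)) // -quo_ker linearB /= E subrr.
Qed.

(** A subalgebra of the quotient that contains the images of [X] pulls back to a
    subalgebra of [L] covering [L/L^2], to which [subalg_full] applies. *)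
Lemma span_generates (X : seq L) : (<<X>> + N)%VS = fullv ->
  @generates F Q (map pr X).
Proof.
move=> XN K [_ /subvP cK] sXK; pose K' := (pr @^-1: K)%VS.
have ZK : (Z <= K')%VS.
  by apply/subvP => z; rewrite -quo_ker -memv_preim => /eqP ->; rewrite mem0v.
have XK : (<<X>> <= K')%VS.
  by apply/span_subvP => x xX; rewrite -memv_preim sXK // map_f.
have : K' = fullv.
  apply: (subalg_full nilL) => [x y|].
    by rewrite -!memv_preim => xK yK; rewrite -quo_br cK // brv_mem.
  by apply/eqP; rewrite -subvf_eq -XN !subv_add addvSr
    (subv_trans XK (addvSl _ _)) (subv_trans ZK (addvSl _ _)).
move=> E; apply/eqP; rewrite -subvf_eq; apply/subvP => u _.
by have [x ->] := pr_surj u; rewrite memv_preim -/K' E memvf.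
Qed.

Definition gen_pair (X Y : seq L) : Prop :=
  [/\ {subset X <= part L false}, {subset Y <= part L true} &
      (<<X ++ Y>> + N)%VS = fullv].

(** [(p|q)] is the superdimension of [L / (L^2 + Z(L))]. *)
Definition gen_dims p q : Prop :=
  (p + \dim (N :&: part L false) = \dim (part L false))%N /\
  (q + \dim (N :&: part L true) = \dim (part L true))%N.

Lemma part_span_add (X Y : seq L) : gen_pair X Y ->
  (part L false <= <<X>> + N :&: part L false)%VS /\
  (part L true <= <<Y>> + N :&: part L true)%VS.
Proof.
move=> [sX sY full].
have gX : graded <<X ++ Y>>%VS by apply: graded_span.
have P s : part L s = (<<X ++ Y>> :&: part L s + N :&: part L s)%VS.
  by rewrite -graded_add_part ?full ?capfv //; apply: graded_cogen.
have [E0 E1] := span_part sX sY.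
by rewrite {1}(P false) {1}(P true) E0 E1.
Qed.

Lemma dim_parts : (\dim (part L false) + \dim (part L true) = \dim {:L})%N.
Proof. by have := graded_dim (graded_full L); rewrite !capfv. Qed.

(** A minimal homogeneous generating set of [L/Z(L)] lifts to a homogeneous
    basis of a complement of [L^2 + Z(L)]: it generates modulo the Frattini-like
    ideal by nilpotency, and redundancy modulo that ideal would contradict
    minimality. *)
Lemma min_generator_lift p q : min_generator_pair Q p q ->
  exists X Y, [/\ gen_pair X Y, size X = p, size Y = q & gen_dims p q].
Proof.
move=> [X' [Y' [[sX' sY' uXY gXY mXY] <- <-]]].
have [X sX EX] := lift_seq sX'; have [Y sY EY] := lift_seq sY'.
have full : (<<X ++ Y>> + N)%VS = fullv.
  by apply: generates_span => //; rewrite map_cat EX EY.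
exists X, Y; have pXY : gen_pair X Y by [].
have size' : (size X + size Y = size X' + size Y')%N by rewrite -EX -EY !size_map.
have sz : (size X + size Y + \dim N <= \dim {:L})%N.
  rewrite leqNgt -full -size_cat; apply/negP => /seq_split_dep[X1 [x [X2 [E xX]]]].
  have full' : (<<X1 ++ X2>> + N)%VS = fullv.
    apply/eqP; rewrite -subvf_eq -full E subv_add addvSr andbT.
    apply/span_subvP => y; rewrite mem_cat inE orbCA => /predU1P[-> //|yX].
    by rewrite (subvP (addvSl _ _)) // memv_span // mem_cat.
  have EE : X' ++ Y' = map pr X1 ++ pr x :: map pr X2.
    by rewrite -EX -EY -map_cat E map_cat.
  have := mXY (map pr (X1 ++ X2)); rewrite EE => mXY'.
  have /(_ (pr x)) : {subset map pr X1 ++ pr x :: map pr X2 <= map pr (X1 ++ X2)}.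
    apply: mXY' (span_generates full') => y.
    by rewrite map_cat !mem_cat inE => /orP[->|->]; rewrite ?orbT.
  rewrite mem_cat mem_head orbT => /(_ isT).
  move: uXY; rewrite EE -cat1s uniq_catCA /= map_cat.
  by case/andP=> /negPf ->.
have [s0 s1] := part_span_add pXY.
have d0 : (\dim (part L false) <= size X + \dim (N :&: part L false))%N.
  apply: leq_trans (dimvS s0) _; apply: leq_trans (dimv_add_leqif _ _) _.
  by rewrite leq_add2r dim_span.
have d1 : (\dim (part L true) <= size Y + \dim (N :&: part L true))%N.
  apply: leq_trans (dimvS s1) _; apply: leq_trans (dimv_add_leqif _ _) _.
  by rewrite leq_add2r dim_span.
have gN := graded_dim graded_cogen; have gL := dim_parts.
have sizeX : size X' = size X by rewrite -EX size_map.
have sizeY : size Y' = size Y by rewrite -EY size_map.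
by rewrite sizeX sizeY; split=> //; split; lia.
Qed.

Definition derived_dim s := \dim (D :&: part L s).
Definition meet_dim s := \dim (D :&: Z :&: part L s).

Lemma meet_dim_le s : (meet_dim s <= derived_dim s)%N.
Proof. by rewrite dimvS // capvS // capvSl. Qed.

Lemma derived_dim_sum : (derived_dim false + derived_dim true = \dim D)%N.
Proof. exact: graded_dim graded_derived. Qed.

Lemma meet_dim_sum : (meet_dim false + meet_dim true = \dim (D :&: Z))%N.
Proof. exact: graded_dim (graded_cap graded_derived (graded_center L)). Qed.

Lemma cogen_dim s :
  (\dim (N :&: part L s) + meet_dim s = derived_dim s + \dim (Z :&: part L s))%N.
Proof.
rewrite (graded_add_part _ graded_derived (graded_center L)).
rewrite -[RHS]dimv_sum_cap; congr (_ + \dim _)%N.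
by apply/vspaceP => x; rewrite !memv_cap andbACA andbb.
Qed.

Lemma quo_sdim p q : gen_dims p q ->
  (\dim (part Q false) + meet_dim false = p + derived_dim false)%N /\
  (\dim (part Q true) + meet_dim true = q + derived_dim true)%N.
Proof.
move=> [H0 H1]; have c0 := cogen_dim false; have c1 := cogen_dim true.
have q0 := quo_dim false; have q1 := quo_dim true.
by split; lia.
Qed.

(** The definition of st with [sdim L/Z(L)] eliminated by [quo_sdim]; subtractions
    are moved across to stay among natural numbers. *)
Lemma st_dims p q (a b : int) : gen_dims p q -> st L p q = (a, b) <->
  (p * derived_dim false + q * derived_dim true + meet_dim false)%:Z = a + (p + derived_dim false)%:Z /\
  (q * derived_dim false + p * derived_dim true + meet_dim true)%:Z = b + (q + derived_dim true)%:Z.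
Proof.
move=> /quo_sdim[]; rewrite /st /lambda /sdim /sub_sdim -/(derived_dim false) -/(derived_dim true).
rewrite [X in (X%:Z - _, _)]/= [X in (_, X%:Z - _)]/=.
rewrite [X in (_ - X%:Z, _)]/= [X in (_, _ - X%:Z)]/=.
set s0 := \dim (part Q false); set s1 := \dim (part Q true) => H0 H1.
set A := (p * derived_dim false + q * derived_dim true)%N; set B := (q * derived_dim false + p * derived_dim true)%N.
split=> [[<- <-]|[E0 E1]]; first by split; lia.
by congr (_, _); lia.
Qed.

End Generators.

(** * Realizations of a multiplication table *)

(** The labels of a table, indexed by the type of coordinates of its algebra. *)
Definition olab a b (i : 'I_a + 'I_b) : label :=
  match i with inl k => elabel k.+1 | inr k => flabel k.+1 end.

Lemma olab_inj a b : injective (@olab a b).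
Proof. by move=> [i|i] [j|j] //= [E]; congr (_ _); apply: val_inj. Qed.

Lemma olab_mem a b (i : 'I_a + 'I_b) : olab i \in labels a b.
Proof. exact: lab_mem. Qed.

Lemma labelsP a b l : reflect (exists i : 'I_a + 'I_b, l = olab i) (l \in labels a b).
Proof.
apply: (iffP idP) => [|[i ->]]; last exact: olab_mem.
rewrite mem_cat => /orP[] /mapP[i]; rewrite mem_iota /= => hi ->.
  by exists (inl (Ordinal hi)).
by exists (inr (Ordinal hi)).
Qed.

Lemma size_labels a b : size (labels a b) = (a + b)%N.
Proof. by rewrite size_cat !size_map !size_iota. Qed.

Lemma sum_labels (V : zmodType) a b (g : label -> V) :
  \sum_(m <- labels a b) g m = \sum_(i : 'I_a + 'I_b) g (olab i).
Proof.
rewrite /labels big_cat !big_map big_sumType /= -[X in iota 0 X]subn0.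
rewrite big_mkord; congr (_ + _); rewrite -[X in iota 0 X]subn0.
by rewrite big_mkord.
Qed.

Section Combinations.
Variables (F : fieldType) (V : vectType F) (a b : nat) (x : label -> V).

Definition comb (u : {ffun 'I_a + 'I_b -> F^o}) : V := \sum_i u i *: x (olab i).
Fact comb_linear : linear comb.
Proof.
move=> c u v; rewrite /comb scaler_sumr -big_split; apply: eq_bigr => i _ /=.
by rewrite !ffunE scalerDl scalerA.
Qed.
HB.instance Definition _ := GRing.isLinear.Build F _ V *:%R comb comb_linear.
End Combinations.

Section Delta.
Variables (F : fieldType) (a b : nat).

Definition delta (l : label) : {ffun 'I_a + 'I_b -> F^o} :=
  [ffun i => (olab i == l)%:R].

Lemma sum_delta (V : lmodType F) (g : 'I_a + 'I_b -> V) i :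
  \sum_j delta (olab i) j *: g j = g i.
Proof.
rewrite (bigD1 i) //= ffunE eqxx scale1r big1 ?addr0 // => j ji.
by rewrite ffunE (inj_eq (@olab_inj _ _)) (negPf ji) scale0r.
Qed.

Lemma comb_delta (V : vectType F) (x : label -> V) l : l \in labels a b ->
  comb x (delta l) = x l.
Proof. by case/labelsP => i ->; apply: sum_delta. Qed.

End Delta.

Section TableDelta.
Variables (F : fieldType) (a b : nat) (t : table) (lt : lie_table a b t).
Local Notation M := (table_alg F lt).

Lemma table_delta (l1 l2 : label) : l1 \in labels a b -> l2 \in labels a b ->
  bracket M (delta F a b l1) (delta F a b l2) =
    \sum_(k <- labels a b) (coef t l1 l2 k)%:~R *: (delta F a b k : M).
Proof.
move=> /labelsP[i ->] /labelsP[j ->]; rewrite [LHS]bilfunE sum_labels.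
apply/ffunP => k; rewrite ffunE sum_ffunE [RHS](bigD1 k) //= [X in _ = _ + X]big1.
  rewrite [RHS]addr0 [RHS]ffunE [in RHS]ffunE eqxx /GRing.scale /= mulr1.
  rewrite (bigD1 i) //= [X in _ + X]big1 ?addr0 => [|i' ii'].
    rewrite (bigD1 j) //= big1 ?addr0 => [|j' jj'].
      by rewrite !ffunE !eqxx !mul1r.
    by rewrite !ffunE !(inj_eq (@olab_inj _ _)) (negPf jj') mulr0 mul0r.
  rewrite big1 // => j' _.
  by rewrite !ffunE !(inj_eq (@olab_inj _ _)) (negPf ii') !mul0r.
move=> m mk; rewrite !ffunE !(inj_eq (@olab_inj _ _)) eq_sym (negPf mk).
by rewrite scaler0.
Qed.

Lemma delta_part l : (delta F a b l : M) \in part M (parity l).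
Proof.
apply/table_partP => i pi; rewrite ffunE; case: eqP => // E.
by rewrite -E in pi; case: i pi {E}.
Qed.
End TableDelta.

Lemma abelian_br (F : fieldType) a b (u v : abelian_alg F a b) : ⟦u, v⟧ = 0.
Proof.
rewrite [LHS]bilfunE; apply/ffunP => k; rewrite !ffunE big1 // => i _.
by rewrite big1 // => j _; rewrite /coef big_nil mulr0.
Qed.

Lemma lie_iso_sym (F : fieldType) (L M : lieSuperalg F) : lie_iso L M -> lie_iso M L.
Proof.
case=> h [[hp hb] /eqP h0 h1].
have hK : cancel h h^-1%VF := lker0_lfunK h0.
have hVK x : h (h^-1%VF x) = x by apply: limg_lfunVK; rewrite h1 memvf.
exists h^-1%VF; split; last 2 first.
- by apply/eqP/lker0P => x y E; rewrite -(hVK x) E hVK.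
- by apply/eqP; rewrite -subvf_eq; apply/subvP => x _; rewrite -(hK x) memv_img ?memvf.
split=> [s|x y]; last by apply: (can_inj hK); rewrite hb !hVK.
apply/subvP => _ /memv_imgP[x xs ->].
have [m0 [m1 [M0 M1 E]]] := part_decomp (h^-1%VF x).
have h_p r u : u \in part L r -> h u \in part M r.
  by move=> ur; apply: (subvP (hp r)); apply: memv_img.
have {}E' : x = h m0 + h m1 by rewrite -[LHS]hVK E linearD.
have hi u : h u = 0 -> u = 0 by move/eqP; rewrite -memv_ker (eqP h0) memv0 => /eqP.
case: s xs => xs; rewrite E.
  have [] // := @part_eq0 _ _ (h m0) (h m1 - x).
  - exact: h_p.
  - by rewrite rpredB // h_p.
  - by rewrite addrA -E' subrr.
  by move=> /hi -> _; rewrite add0r.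
have [] // := @part_eq0 _ _ (h m0 - x) (h m1).
- by rewrite rpredB // h_p.
- exact: h_p.
- by rewrite addrAC -E' subrr.
by move=> _ /hi ->; rewrite addr0.
Qed.

Section Realization.
Variables (F : fieldType) (L : lieSuperalg F).
Local Notation Z := (center L).
Local Notation D := (derived L).
Local Notation N := (cogen L).

Definition table_rel a b t (x : label -> L) : Prop :=
  {in labels a b &, forall i j,
    ⟦x i, x j⟧ = \sum_(k <- labels a b) (coef t i j k)%:~R *: x k}.

Lemma comb_bracket a b t (lt : lie_table a b t) (x : label -> L)
    (u v : table_alg F lt) : table_rel a b t x ->
  comb x ⟦u, v⟧ = ⟦comb x u, comb x v⟧.
Proof.
move=> xb; rewrite [⟦u, v⟧]bilfunE /comb br_suml.
under eq_bigr => k _ do rewrite ffunE scaler_suml.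
rewrite exchange_big; apply: eq_bigr => i _ /=; rewrite br_sumr.
under eq_bigr => k _ do rewrite scaler_suml.
rewrite exchange_big; apply: eq_bigr => j _ /=; rewrite !brE.
rewrite xb ?olab_mem // sum_labels !scaler_sumr; apply: eq_bigr => k _.
by rewrite !scalerA.
Qed.

(** A homogeneous basis of a complement of a central ideal, multiplying
    according to the table: the internal form of an isomorphism with the direct
    sum of the table algebra and an abelian one. *)
Definition realizes a b t (x : label -> L) : Prop :=
  [/\ {in labels a b, forall i, x i \in part L (parity i)},
      table_rel a b t x, free [seq x i | i <- labels a b] &
      (<<[seq x i | i <- labels a b]>> + Z)%VS = fullv].

Lemma map_labels_cat a b (x : label -> L) : [seq x i | i <- labels a b] =
  [seq x (elabel i.+1) | i <- iota 0 a] ++ [seq x (flabel j.+1) | j <- iota 0 b].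
Proof. by rewrite map_cat -!map_comp. Qed.

(** A complement [A s] of the part of the family of parity [s] is chosen inside
    the center; bases of the two [A s] are the image of the abelian summand. *)
Lemma realizes_iso a b t (lt : lie_table a b t) k l x : sdim L = (k, l) ->
  realizes a b t x -> [/\ (a <= k)%N, (b <= l)%N &
    lie_iso L (lie_sum (table_alg F lt) (abelian_alg F (k - a) (l - b)))].
Proof.
move=> [Ek El] [xp xb xf xZ]; set X := [seq x i | i <- labels a b] in xf xZ.
set X0 := [seq x (elabel i.+1) | i <- iota 0 a].
set X1 := [seq x (flabel j.+1) | j <- iota 0 b].
have EX : X = X0 ++ X1 by apply: map_labels_cat.
have s0 : {subset X0 <= part L false}.
  move=> _ /mapP[i ia ->]; apply: (xp (elabel i.+1)).
  by rewrite mem_cat (map_f (fun i => elabel i.+1)).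
have s1 : {subset X1 <= part L true}.
  move=> _ /mapP[i ia ->]; apply: (xp (flabel i.+1)).
  by rewrite mem_cat (map_f (fun i => flabel i.+1)) ?orbT.
have [f0 f1] : \dim <<X0>> = a /\ \dim <<X1>> = b.
  move: xf; rewrite EX => xf; have := catl_free xf; have := catr_free xf.
  by rewrite /free => /eqP -> /eqP ->; rewrite !size_map !size_iota.
pose U s := if s then <<X1>>%VS else <<X0>>%VS.
have Us s : (U s <= part L s)%VS by case: s; apply/span_subvP.
have gX : graded <<X>>%VS by rewrite EX; apply: graded_span.
have XU s : (<<X>> :&: part L s)%VS = U s.
  by have [E0 E1] := span_part s0 s1; rewrite EX; case: s.
pose A s := ((Z :&: part L s) :\: U s)%VS.
have AZ s : (A s <= Z)%VS by apply: subv_trans (diffvSl _ _) (capvSl _ _).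
have As s : (A s <= part L s)%VS by apply: subv_trans (diffvSl _ _) (capvSr _ _).
have AU s : (A s + U s = part L s)%VS.
  rewrite addv_diff addvC -XU -graded_add_part // ?xZ ?capfv //.
  exact: graded_center.
have dAU s : (\dim (A s) + \dim (U s) = \dim (part L s))%N.
  by rewrite -AU dimv_disjoint_sum // capv_diff.
have E0 : \dim (A false) = (k - a)%N by have := dAU false; rewrite f0; lia.
have E1 : \dim (A true) = (l - b)%N by have := dAU true; rewrite f1; lia.
have ak : (a <= k)%N by have := dAU false; rewrite f0; lia.
have bl : (b <= l)%N by have := dAU true; rewrite f1; lia.
split=> //; apply: lie_iso_sym.
set M := lie_sum _ _.
pose y (l : label) : L := match l with
  inl i => (vbasis (A false))`_i.-1 | inr i => (vbasis (A true))`_i.-1 end.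
have yA j : j \in labels (k - a) (l - b) -> y j \in A (parity j).
  case/labelsP => -[i|i] -> /=; apply: vbasis_mem; apply: mem_nth;
    by rewrite size_tuple ?E0 ?E1.
pose h (m : M) : L := comb x m.1 + comb y m.2.
have hl : linear h.
  by move=> c u v; rewrite /h !linearP /= scalerDr addrACA.
pose hh : {linear M -> L} := HB.pack h (GRing.isLinear.Build F M L *:%R h hl).
have hE m : linfun hh m = h m by rewrite lfunE.
have lim : limg (linfun hh) = fullv.
  have xh : (<<X>> <= limg (linfun hh))%VS.
    apply/span_subvP => _ /mapP[i iab ->]; apply/memv_imgP.
    exists (delta F a b i, 0); rewrite ?memvf // hE /h /= linear0 addr0.
    by rewrite comb_delta.
  have yh s : (A s <= limg (linfun hh))%VS.
    rewrite -(span_basis (vbasisP (A s))); apply/span_subvP => z zA.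
    have : exists2 j, j \in labels (k - a) (l - b) & z = y j.
      have iA : (index z (vbasis (A s)) < \dim (A s))%N.
        by rewrite -{2}(size_tuple (vbasis (A s))) index_mem.
      case: s zA iA => zA iA.
        exists (flabel (index z (vbasis (A true))).+1); last by rewrite /y /= nth_index.
        by apply/labelsP; exists (inr (Ordinal (leq_trans iA (eq_leq E1)))).
      exists (elabel (index z (vbasis (A false))).+1); last by rewrite /y /= nth_index.
      by apply/labelsP; exists (inl (Ordinal (leq_trans iA (eq_leq E0)))).
    case=> j jl ->; apply/memv_imgP; exists (0, delta F (k - a) (l - b) j).
      exact: memvf.
    by rewrite hE /h /= linear0 add0r comb_delta.
  apply/eqP; rewrite -subvf_eq -part_sum -(AU false) -(AU true) !subv_add !yh /=.
  by rewrite /U !(subv_trans _ xh) // EX span_cat ?addvSl ?addvSr.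
exists (linfun hh); split=> //; last first.
  apply/eqP; rewrite -dimv_eq0 -(eqn_add2r (\dim (limg (linfun hh)))) add0n.
  rewrite -{1}(capfv (lker _)) limg_ker_dim lim !dimvf /=.
  rewrite -[X in _ == X]dimvf -dim_parts Ek El.
  have -> : dim (sum_carrier (table_alg F lt) (abelian_alg F (k - a) (l - b))) =
    (#|{: 'I_a + 'I_b}| * 1 + #|{: 'I_(k - a) + 'I_(l - b)}| * 1)%N by [].
  rewrite !card_sum !card_ord; apply/eqP; lia.
split=> [s|u v].
  apply/subvP => _ /memv_imgP[[u v] + ->]; rewrite sum_partE hE /h /=.
  case/andP=> /table_partP us /table_partP vs; rewrite rpredD //; apply: memv_suml => i _.
    have [pi|/us->] := eqVneq (parity (olab i)) s; last by rewrite scale0r mem0v.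
    by rewrite memvZ // -pi xp // olab_mem.
  have [pi|/vs->] := eqVneq (parity (olab i)) s; last by rewrite scale0r mem0v.
  rewrite memvZ // -pi; apply: subvP (As _) _ _; apply: yA; exact: olab_mem.
have cy (w : {ffun 'I_(k - a) + 'I_(l - b) -> F^o}) : comb y w \in Z.
  apply: memv_suml => i _; rewrite memvZ //; apply: subvP (AZ _) _ _.
  by apply: yA; apply: olab_mem.
rewrite !hE /h !brDl !brDr !(center_bracket _ (cy _)) !(bracket_center _ (cy _)) !addr0.
rewrite [⟦u, v⟧]bilfunE /= abelian_br linear0 addr0.
exact: comb_bracket.
Qed.

End Realization.

Section Converse.
Variables (F : fieldType) (L : lieSuperalg F).
Local Notation Z := (center L).
Local Notation D := (derived L).
Local Notation N := (cogen L).

Lemma delta_full a b : <<[seq delta F a b l | l <- labels a b]>>%VS = fullv.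
Proof.
apply/eqP; rewrite -subvf_eq; apply/subvP => u _.
have -> : u = \sum_i u i *: delta F a b (olab i).
  apply/ffunP => j; rewrite sum_ffunE (bigD1 j) //= [X in _ + X]big1 => [|i ij].
    by rewrite !ffunE eqxx addr0 /GRing.scale /= mulr1.
  by rewrite !ffunE (inj_eq (@olab_inj _ _)) eq_sym (negPf ij) scaler0.
by apply: memv_suml => i _; rewrite memvZ // memv_span // map_f // olab_mem.
Qed.

(** The images of the basis of the first summand. *)
Lemma iso_realizes a b t (lt : lie_table a b t) a' b' :
  lie_iso L (lie_sum (table_alg F lt) (abelian_alg F a' b')) ->
  exists x : label -> L, realizes a b t x.
Proof.
move=> /lie_iso_sym[h [[hp hb] h0 h1]].
set M := lie_sum _ _ in h hp hb h0 h1.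
have hI u : h u = 0 -> u = 0 by move/eqP; rewrite -memv_ker h0 memv0 => /eqP.
pose g (u : table_alg F lt) : L := h (u, 0).
have gl : linear g.
  move=> c u v; rewrite /g -linearP; congr (h _).
  by congr (_, _); rewrite /= scaler0 addr0.
pose gg : {linear table_alg F lt -> L} :=
  HB.pack g (GRing.isLinear.Build F (table_alg F lt) L *:%R g gl).
have gE u : linfun gg u = g u by rewrite lfunE.
pose x l := g (delta F a b l).
have EX : [seq x i | i <- labels a b] =
    [seq linfun gg i | i <- [seq delta F a b l | l <- labels a b]].
  by rewrite -map_comp; apply: eq_map => l /=; rewrite gE.
exists x; split.
- move=> l ll; apply: (subvP (hp (parity l))); apply: memv_img.
  by rewrite sum_partE delta_part mem0v.
- move=> i j il jl; rewrite /x /g -hb [⟦_, _⟧]bilfunE /sum_bracket /= abelian_br.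
  rewrite table_delta // -/(g _) -[g]/(gg : _ -> _) linear_sum.
  by apply: eq_bigr => k _; rewrite linearZ.
- rewrite EX /free -limg_span limg_dim_eq; last first.
    apply/eqP; rewrite -subv0; apply/subvP => u; rewrite memv_cap memv_ker gE.
    by case/andP=> _ /eqP/hI[->]; rewrite mem0v.
  rewrite delta_full dimvf !size_map size_labels.
  have -> : dim (table_alg F lt) = (#|{: 'I_a + 'I_b}| * 1)%N by [].
  by rewrite card_sum !card_ord muln1.
apply/eqP; rewrite -subvf_eq -h1; apply/subvP => _ /memv_imgP[[u v] _ ->].
have -> : (u, v) = (u, 0) + (0, v) :> M by congr (_, _); rewrite /= ?addr0 ?add0r.
rewrite linearD /= memv_add //.
  have -> : h (u, 0) = linfun gg u by rewrite gE.
  by rewrite EX -limg_span delta_full memv_img ?memvf.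
rewrite memv_ker; apply/eqP/lfunP => y; rewrite zero_lfunE.
have /memv_imgP[[u' v'] _ ->] : y \in limg h by rewrite h1 memvf.
by rewrite -hb [⟦_, _⟧]bilfunE /sum_bracket /= abelian_br (br0l (u' : table_alg F lt)) linear0.
Qed.

Section Closed.
Variables (a b : nat) (t : table) (x : label -> L).
Hypothesis nilL : nilpotent_lie L.
Hypothesis xp : {in labels a b, forall i, x i \in part L (parity i)}.
Hypothesis xb : table_rel a b t x.
Local Notation X := [seq x i | i <- labels a b].

Lemma rel_closed u v : u \in <<X>>%VS -> v \in <<X>>%VS -> ⟦u, v⟧ \in <<X>>%VS.
Proof.
apply: span_brv => _ _ /mapP[i ii ->] /mapP[j jj ->]; rewrite xb // big_seq.
by apply: memv_suml => k kk; rewrite memvZ // memv_span // map_f.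
Qed.

Hypothesis XN : (<<X>> + N)%VS = fullv.

Lemma rel_full : (<<X>> + Z)%VS = fullv.
Proof.
apply: (subalg_full nilL); last by rewrite -addvA [(Z + D)%VS]addvC.
move=> _ _ /memv_addP[u uX [z zZ ->]] /memv_addP[v vX [w wZ ->]].
rewrite brDl !brDr !(center_bracket _ zZ) !(bracket_center _ wZ) !addr0.
by rewrite (subvP (addvSl _ _)) // rel_closed.
Qed.

Lemma rel_derived : (D <= <<X>>)%VS.
Proof.
apply: brv_subP => u v; rewrite -rel_full => /memv_addP[u' uX [z zZ ->]] .
move=> /memv_addP[v' vX [w wZ ->]].
rewrite brDl !brDr !(center_bracket _ zZ) !(bracket_center _ wZ) !addr0.
exact: rel_closed.
Qed.

(** Freeness follows by counting: the span already contains [L^2] and covers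
    [L/Z(L)], so it has at least as many dimensions as there are labels. *)
Lemma realizes_of_dim p q : gen_dims L p q -> (a + b = p + q + \dim D)%N ->
  realizes a b t x.
Proof.
move=> [p0 q1] ab; split=> //; last exact: rel_full.
have sX : size X = (p + q + \dim D)%N by rewrite size_map size_labels.
rewrite /free eqn_leq dim_span sX /=.
have E := dimv_sum_cap <<X>> Z; rewrite rel_full in E.
have H : (\dim (D :&: Z) <= \dim (<<X>> :&: Z))%N.
  by rewrite dimvS // capvS // rel_derived.
have gN := graded_dim (graded_cogen L); have gL := dim_parts L.
have EN : (\dim (cogen L) + _ = _)%N := dimv_sum_cap D Z.
by set S := <<X>>%VS in E H *; lia.
Qed.
End Closed.

End Converse.

(** * The invariant st of a table *)

Section TableInvariants.
Variables (a b : nat) (t : table).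

(** [coef] without the locked big operator, for computation on explicit tables. *)
Definition cf (x y z : label) : int :=
  foldr (fun r s => row_coef r x y z + s) 0 t.

Lemma cfE x y z : coef t x y z = cf x y z.
Proof. by rewrite /coef unlock. Qed.

(** For the tables certified below, the vectors with these labels span a
    complement of the center. *)
Definition noncentral_labels : seq label :=
  [seq i <- labels a b |
    has (fun j => has (fun k => cf i j k != 0) (labels a b)) (labels a b)].

Definition derived_labels : seq label :=
  [seq k <- labels a b |
    has (fun i => has (fun j => cf i j k != 0) (labels a b)) (labels a b)].

(** Nonzero in any characteristic other than 2. *)
Definition good_coef (c : int) : bool := (`|c| == 1)%N || (`|c| == 2)%N.

(** One round of elimination: the coordinate [i] of a central element vanishes
    if, in some coordinate [k] of the bracket with some [j], it occurs alone
    among the coordinates not yet known to vanish. *)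
Definition eliminate (K : seq label) : seq label :=
  [seq i <- noncentral_labels | has (fun j => has (fun k => good_coef (cf i j k) &&
     all (fun i' => [|| i' == i, i' \in K | cf i' j k == 0]) noncentral_labels)
   (labels a b)) (labels a b)].

Definition elimination_ok : bool :=
  all (mem (iter (a + b) eliminate [::])) noncentral_labels.

Definition derived_ok : bool :=
  all (fun k => has (fun i => has (fun j => good_coef (cf i j k) &&
     all (fun k' => (k' == k) || (cf i j k' == 0)) (labels a b))
   (labels a b)) (labels a b)) derived_labels.

Definition gen_labels : seq label :=
  [seq i <- noncentral_labels | i \notin derived_labels].

Definition pcount s (l : seq label) : nat := count (fun i => parity i == s) l.

Definition table_st : int * int :=
  let p := pcount false gen_labels in let q := pcount true gen_labels in
  let d0 := pcount false derived_labels in let d1 := pcount true derived_labels in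
  ((p * d0 + q * d1)%N%:Z - (pcount false noncentral_labels)%:Z,
   (q * d0 + p * d1)%N%:Z - (pcount true noncentral_labels)%:Z).
End TableInvariants.

Lemma uniq_labels a b : uniq (labels a b).
Proof.
rewrite /labels cat_uniq !map_inj_uniq ?iota_uniq ?andbT => [|i j [] //|i j [] //].
by apply/hasPn => _ /mapP[i _ ->]; apply/mapP => -[].
Qed.

Section Realized.
Variables (F : fieldType) (L : lieSuperalg F) (a b : nat) (t : table).
Variable x : label -> L.
Hypothesis nz2 : (2%:R : F) != 0.
Hypothesis xR : realizes a b t x.
Local Notation Z := (center L).
Local Notation D := (derived L).
Local Notation N := (cogen L).
Local Notation NC := (noncentral_labels a b t).
Local Notation DL := (derived_labels a b t).

Lemma good_coef_neq0 c : good_coef c -> (c%:~R : F) != 0.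
Proof.
case: c => n; rewrite /good_coef /= => /orP[/eqP E|/eqP E].
- by move: E => /= ->; rewrite oner_eq0.
- by move: E => /= ->.
- by rewrite NegzE; move: E => /= [->]; rewrite rmorphN oppr_eq0 oner_eq0.
by rewrite NegzE; move: E => /= [->]; rewrite rmorphN oppr_eq0.
Qed.

Lemma span_mapP (S : seq label) v : uniq S -> v \in <<map x S>>%VS ->
  exists c : label -> F, v = \sum_(i <- S) c i *: x i.
Proof.
elim: S v => [|i S IH] v /=.
  by rewrite span_nil memv0 => _ /eqP ->; exists (fun _ => 0); rewrite big_nil.
case/andP=> iS uS; rewrite span_cons => /memv_addP[_ /vlineP[k ->] [w wS ->]].
have [c ->] := IH w uS wS.
exists (fun j => if j == i then k else c j); rewrite big_cons eqxx; congr (_ + _).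
apply: eq_big_seq => j jS; case: eqP => // ji.
by move: iS; rewrite -ji jS.
Qed.

Lemma free_coef (c : label -> F) : \sum_(i <- labels a b) c i *: x i = 0 ->
  {in labels a b, forall i, c i = 0}.
Proof.
have [_ _ xf _] := xR; elim: (labels a b) xf => [|i S IH] //=.
rewrite free_cons big_cons => /andP[xi fS] E.
have ci : c i = 0.
  apply: contraNeq xi => ci; rewrite -[x i](scalerK ci) memvZ //.
  rewrite -[c i *: x i]opprK (addr0_eq E) memvN.
  by rewrite big_seq memv_suml // => j jS; rewrite memvZ // memv_span // map_f.
move: E; rewrite ci scale0r add0r => /(IH fS) H j.
by rewrite inE => /predU1P[->|/H].
Qed.

Lemma br_coef (S : seq label) (c : label -> F) j : {subset S <= labels a b} ->
    j \in labels a b -> ⟦\sum_(i <- S) c i *: x i, x j⟧ = 0 ->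
  {in labels a b, forall k, \sum_(i <- S) c i * (cf t i j k)%:~R = 0}.
Proof.
move=> sS jl E; apply: free_coef; rewrite -[RHS]E br_suml.
under eq_bigr do rewrite scaler_suml.
rewrite exchange_big; apply: eq_big_seq => i /sS il /=.
have [_ xb _ _] := xR; rewrite brZl xb // scaler_sumr.
by apply: eq_bigr => k _; rewrite scalerA cfE.
Qed.

Lemma NC_labels : {subset NC <= labels a b}.
Proof. by move=> i; rewrite mem_filter => /andP[]. Qed.

Lemma DL_labels : {subset DL <= labels a b}.
Proof. by move=> i; rewrite mem_filter => /andP[]. Qed.

Lemma central_label i : i \in labels a b -> i \notin NC -> x i \in Z.
Proof.
move=> il; rewrite mem_filter il andbT => /hasPn H.
have [_ xb _ xZ] := xR.
have H0 j k : j \in labels a b -> k \in labels a b -> cf t i j k = 0.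
  by move=> /H/hasPn h /h /negPn/eqP.
rewrite memv_ker; apply/eqP/lfunP => y; rewrite zero_lfunE.
have : y \in (<<map x (labels a b)>> + Z)%VS by rewrite xZ memvf.
case/memv_addP=> u uX [z zZ ->]; rewrite brDr (bracket_center _ zZ) addr0.
apply/eqP; rewrite -memv0; apply: span_brv (memv_span1 (x i)) uX => y1 y2.
rewrite inE => /eqP -> /mapP[j jl ->]; rewrite memv0 xb // big_seq big1 // => k kl.
by rewrite cfE H0 // scale0r.
Qed.

Lemma noncentral_free (c : label -> F) : elimination_ok a b t ->
  \sum_(i <- NC) c i *: x i \in Z -> {in NC, forall i, c i = 0}.
Proof.
move=> /allP ok E.
suff H n : {in iter n (eliminate a b t) [::], forall i, c i = 0}.
  by move=> i /ok; apply: H.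
elim: n => [|n IH] i //=; rewrite mem_filter => /andP[] /hasP[j jl] /hasP[k kl].
move=> /andP[g /allP H] iNC.
have := br_coef NC_labels jl (center_bracket _ E) kl.
rewrite (bigD1_seq i) ?filter_uniq ?uniq_labels //= big1_seq => [|i' /andP[ii' i'N]].
  by rewrite addr0 => /eqP; rewrite mulf_eq0 (negPf (good_coef_neq0 g)) orbF => /eqP.
have := H i' i'N; rewrite (negPf ii') /= => /orP[/IH ->|/eqP ->].
  by rewrite mul0r.
by rewrite mulr0.
Qed.

Lemma derived_labelsE : derived_ok a b t -> D = <<map x DL>>%VS.
Proof.
have [_ xb _ xZ] := xR => /allP ok; apply/eqP; rewrite eqEsubv; apply/andP; split.
  apply: brv_subP => u v; rewrite -xZ => /memv_addP[u' uX [z zZ ->]].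
  move=> /memv_addP[v' vX [w wZ ->]].
  rewrite brDl !brDr !(center_bracket _ zZ) !(bracket_center _ wZ) !addr0.
  apply: span_brv uX vX => _ _ /mapP[i il ->] /mapP[j jl ->].
  rewrite xb // big_seq memv_suml // => k kl; rewrite cfE.
  have [->|n0] := eqVneq (cf t i j k) 0; first by rewrite scale0r mem0v.
  rewrite memvZ // memv_span // map_f // mem_filter kl andbT.
  by apply/hasP; exists i => //; apply/hasP; exists j.
apply/span_subvP => _ /mapP[k kD ->]; have kl := DL_labels kD.
have /hasP[i il /hasP[j jl /andP[g /allP H]]] := ok k kD.
have := derived_br (x i) (x j); rewrite xb // (bigD1_seq k) ?uniq_labels //=.
rewrite big1_seq ?addr0 => [|k' /andP[kk' k'l]].
  by rewrite cfE => /(memvZ (cf t i j k)%:~R^-1); rewrite scalerA mulVf ?scale1r // good_coef_neq0.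
by have := H k' k'l; rewrite (negPf kk') cfE /= => /eqP ->; rewrite scale0r.
Qed.

Definition pfilter s (S : seq label) := [seq i <- S | parity i == s].

Lemma span_pfilter (S : seq label) : {subset S <= labels a b} ->
  graded <<map x S>>%VS /\
  forall s, (<<map x S>> :&: part L s)%VS = <<map x (pfilter s S)>>%VS.
Proof.
move=> sS; have [xp _ _ _] := xR.
have ES : <<map x S>>%VS = <<map x (pfilter false S) ++ map x (pfilter true S)>>%VS.
  apply: eq_span => y; rewrite -map_cat; apply/mapP/mapP => -[i iS ->]; exists i => //.
    by rewrite mem_cat !mem_filter iS; case: (parity i).
  by move: iS; rewrite mem_cat !mem_filter => /orP[] /andP[].
have s0 : {subset map x (pfilter false S) <= part L false}.
  by move=> _ /mapP[i + ->]; rewrite mem_filter => /andP[/eqP <- /sS]; apply: xp.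
have s1 : {subset map x (pfilter true S) <= part L true}.
  by move=> _ /mapP[i + ->]; rewrite mem_filter => /andP[/eqP <- /sS]; apply: xp.
have [E0 E1] := span_part s0 s1; rewrite ES; split; first exact: graded_span.
by case; rewrite ?E0 ?E1.
Qed.

Lemma dim_span_labels (S : seq label) : subseq S (labels a b) ->
  \dim <<map x S>> = size S.
Proof.
move=> sS; have [_ _ xf _] := xR.
have : subseq (map x S) (map x (labels a b)) by apply: map_subseq.
case/subseqP=> m _ Em.
have fS : free (map x S).
  have := xf; rewrite (perm_free (Y := map x S ++ [seq x i | i <- labels a b & i \notin S])).
    exact: catl_free.
  rewrite -map_cat; apply: perm_map; apply: uniq_perm.
  - exact: uniq_labels.
  - rewrite cat_uniq (subseq_uniq sS) ?filter_uniq ?uniq_labels // andbT.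
    by apply/hasPn => i; rewrite mem_filter => /andP[].
  by move=> i; rewrite mem_cat mem_filter; case: (boolP (i \in S)) => //= /(mem_subseq sS) ->.
by move: fS; rewrite /free => /eqP ->; rewrite size_map.
Qed.

(** The vectors with noncentral labels are independent modulo the center. *)
Lemma dim_mod_center (P : pred label) s (S := [seq i <- NC | P i]) :
    elimination_ok a b t ->
  \dim ((<<map x S>> + Z) :&: part L s) =
    (pcount s S + \dim (Z :&: part L s))%N.
Proof.
move=> ok; have sS : {subset S <= labels a b}.
  by move=> i; rewrite mem_filter => /andP[_] /NC_labels.
have [gS ES] := span_pfilter sS.
rewrite graded_add_part //; last exact: graded_center.
rewrite dimv_disjoint_sum ES; last first.
  apply/eqP; rewrite -subv0; apply/subvP => v; rewrite !memv_cap => /and3P[vS vZ _].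
  have uS : uniq (pfilter s S) by rewrite !filter_uniq // uniq_labels.
  have [c E] := span_mapP uS vS.
  have : \sum_(i <- NC) (if P i && (parity i == s) then c i else 0) *: x i \in Z.
    move: vZ; rewrite E /pfilter big_filter big_filter_cond big_mkcond /=.
    by under [X in _ -> is_true (X \in _)]eq_bigr do rewrite fun_if if_arg scale0r.
  move=> /(noncentral_free ok) H; rewrite memv0 E big_seq big1 // => i.
  rewrite !mem_filter => /and3P[ps Pi /andP[iN il]].
  by have := H i; rewrite mem_filter iN il Pi ps => /(_ isT) /= ->; rewrite scale0r.
rewrite dim_span_labels ?size_filter //.
by rewrite !(subseq_trans (filter_subseq _ _)).
Qed.

(** The certificate [elimination_ok], [derived_ok] makes the center and the
    derived algebra coordinate subspaces, so that their dimensions are counts. *)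
Lemma realizes_st p q : gen_dims L p q ->
  elimination_ok a b t -> derived_ok a b t -> st L p q = table_st a b t.
Proof.
move=> [g0 g1] ok1 ok2; have [_ _ _ xZ] := xR.
have ED := derived_labelsE ok2.
have ENC s : \dim (part L s) = (pcount s NC + \dim (Z :&: part L s))%N.
  rewrite -[X in pcount s X](filter_predT) -dim_mod_center // filter_predT.
  suff -> : (<<map x NC>> + Z)%VS = fullv by rewrite capfv.
  apply/eqP; rewrite -subvf_eq -xZ subv_add addvSr andbT.
  apply/span_subvP => _ /mapP[i il ->].
  have [iN|iN] := boolP (i \in NC).
    by rewrite (subvP (addvSl _ _)) // memv_span // map_f.
  by rewrite (subvP (addvSr _ _)) // central_label.
have EN s : \dim (N :&: part L s) =
    (pcount s [seq i <- NC | i \in DL] + \dim (Z :&: part L s))%N.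
  rewrite -dim_mod_center //; congr (\dim (_ :&: _)).
  apply/eqP; rewrite eqEsubv /cogen ED !subv_add !addvSr !andbT.
  apply/andP; split; apply/span_subvP => _ /mapP[i il ->].
    have [iN|iN] := boolP (i \in NC).
      by rewrite (subvP (addvSl _ _)) // memv_span // map_f // mem_filter il.
    by rewrite (subvP (addvSr _ _)) // central_label // DL_labels.
  rewrite (subvP (addvSl _ _)) // memv_span // map_f //.
  by move: il; rewrite mem_filter => /andP[].
have Ederived s : derived_dim L s = pcount s DL.
  have [_ E] := span_pfilter DL_labels.
  rewrite /derived_dim ED E dim_span_labels ?size_filter //.
  by rewrite !(subseq_trans (filter_subseq _ _)).
have sp s : (pcount s (gen_labels a b t) + pcount s [seq i <- NC | i \in DL] = pcount s NC)%N.
  rewrite /pcount -[RHS]size_filter.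
  rewrite -(count_predC (fun i => i \in DL) [seq i <- NC | parity i == s]).
  rewrite !count_filter addnC; congr (_ + _)%N; apply: eq_count => i /=;
    by rewrite [X in X && _]andbC.
apply/(st_dims _ _ (conj g0 g1)); rewrite /table_st /= !Ederived.
have Ez s : (meet_dim L s + pcount s [seq i <- NC | i \in DL] = pcount s DL)%N.
  by have := cogen_dim L s; rewrite EN Ederived; lia.
have z0 := Ez false; have z1 := Ez true; have s0 := sp false; have s1 := sp true.
have -> : p = pcount false (gen_labels a b t).
  by move: g0; rewrite EN ENC; lia.
have -> : q = pcount true (gen_labels a b t).
  by move: g1; rewrite EN ENC; lia.
by split; lia.
Qed.

End Realized.

(** * Recognizing an algebra from a few brackets *)

(** What a row contributes to the bracket of [i] and [j], as a coefficient and a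
    label. *)
Definition row_out (i j : label) (r : label * label * int * label) :=
  let: (x0, y0, c, z) := r in
  if (i == x0) && (j == y0) then Some (c, z)
  else if (i == y0) && (j == x0) then Some (- ((-1) ^+ (parity i && parity j) * c), z)
  else None.

Definition label_pairs a b : seq (label * label) :=
  let e := [seq elabel i.+1 | i <- iota 0 a] in
  let f := [seq flabel j.+1 | j <- iota 0 b] in
  [seq (elabel i.+1, elabel j.+1) | i <- iota 0 a, j <- iota i.+1 (a - i.+1)] ++
  [seq (i, j) | i <- e, j <- f] ++
  [seq (flabel i.+1, flabel j.+1) | i <- iota 0 b, j <- iota i (b - i)].

(** The brackets prescribed by a table, one for each unordered pair of basis
    vectors; the square of an even vector is left out, being zero. *)
Definition table_spec a b t : seq (label * label * seq (int * label)) :=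
  [seq (ij.1, ij.2, pmap (row_out ij.1 ij.2) t) | ij <- label_pairs a b].

Definition values_ok a b (t : table) : bool := all (fun r => r.2 \in labels a b) t.

Lemma label_pairsP a b i j : i \in labels a b -> j \in labels a b ->
  [\/ (i, j) \in label_pairs a b, (j, i) \in label_pairs a b |
      i = j /\ parity i = false].
Proof.
case/labelsP=> -[i' ->|i' ->] /labelsP[] [j' ->|j' ->]; rewrite !mem_cat.
- have ai := ltn_ord i'; have aj := ltn_ord j'.
  case: (ltngtP i' j') => [ij|ji|/val_inj ->]; last by apply: Or33.
    apply: Or31; apply/orP; left; apply/allpairsPdep.
    by exists (i' : nat), (j' : nat); rewrite !mem_iota; split=> //; lia.
  apply: Or32; apply/orP; left; apply/allpairsPdep.
  by exists (j' : nat), (i' : nat); rewrite !mem_iota; split=> //; lia.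
- apply: Or31; apply/orP; right; apply/orP; left; apply/allpairsP.
  exists (olab (inl i' : 'I_a + 'I_b), olab (inr j' : 'I_a + 'I_b)) => /=; split=> //.
    by rewrite (map_f (fun i => elabel i.+1)) // mem_iota ltn_ord.
  by rewrite (map_f (fun i => flabel i.+1)) // mem_iota ltn_ord.
- apply: Or32; apply/orP; right; apply/orP; left; apply/allpairsP.
  exists (olab (inl j' : 'I_a + 'I_b), olab (inr i' : 'I_a + 'I_b)) => /=; split=> //.
    by rewrite (map_f (fun i => elabel i.+1)) // mem_iota ltn_ord.
  by rewrite (map_f (fun i => flabel i.+1)) // mem_iota ltn_ord.
have bi := ltn_ord i'; have bj := ltn_ord j'.
case: (leqP i' j') => [ij|ji].
  apply: Or31; do ![apply/orP; right]; apply/allpairsPdep.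
  by exists (i' : nat), (j' : nat); rewrite !mem_iota; split=> //; lia.
apply: Or32; do ![apply/orP; right]; apply/allpairsPdep.
by exists (j' : nat), (i' : nat); rewrite !mem_iota; split=> //; lia.
Qed.

Lemma mem_label_pairs a b ij : ij \in label_pairs a b ->
  [\/ exists i j, [/\ (i < j)%N, (j < a)%N & ij = (elabel i.+1, elabel j.+1)],
      exists i j, [/\ (i < a)%N, (j < b)%N & ij = (elabel i.+1, flabel j.+1)] |
      exists i j, [/\ (i <= j)%N, (j < b)%N & ij = (flabel i.+1, flabel j.+1)]].
Proof.
rewrite !mem_cat => /or3P[].
- case/allpairsPdep=> i [j []]; rewrite !mem_iota => ia ja ->.
  by apply: Or31; exists i, j; split=> //; lia.
- case/allpairsP=> -[i' j'] [/= /mapP[i ia ->] /mapP[j jb ->] ->].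
  by apply: Or32; exists i, j; split=> //; move: ia jb; rewrite !mem_iota; lia.
case/allpairsPdep=> i [j []]; rewrite !mem_iota => ia ja ->.
by apply: Or33; exists i, j; split=> //; lia.
Qed.

Section Recognize.
Variables (F : fieldType) (L : lieSuperalg F).
Hypothesis nz2 : (2%:R : F) != 0.
Implicit Types (x y z : L).
Local Notation Z := (center L).
Local Notation D := (derived L).
Local Notation N := (cogen L).

Lemma self_opp_eq0 (V : lmodType F) (v : V) : v = - v -> v = 0.
Proof.
move/eqP; rewrite -addr_eq0 -mulr2n -scaler_nat scaler_eq0 (negPf nz2).
by move/eqP.
Qed.

Lemma br_even_self x : x \in part L false -> ⟦x, x⟧ = 0.
Proof. by move=> x0; apply: self_opp_eq0; rewrite {1}(bracket_skew x0 x0) scale1r. Qed.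

Lemma brC x y s s' : x \in part L s -> y \in part L s' -> s && s' = false ->
  ⟦y, x⟧ = - ⟦x, y⟧.
Proof. by move=> xs ys E; rewrite (bracket_skew ys xs) andbC E scale1r. Qed.

Lemma brC_odd x y : x \in part L true -> y \in part L true -> ⟦y, x⟧ = ⟦x, y⟧.
Proof. by move=> xs ys; rewrite (bracket_skew ys xs) scaleN1r opprK. Qed.

Definition basis_val (es fs : seq L) (l : label) : L :=
  match l with inl i => es`_i.-1 | inr j => fs`_j.-1 end.

Definition out_val (x : label -> L) (s : seq (int * label)) : L :=
  foldr (fun cz v => cz.1%:~R *: x cz.2 + v) 0 s.

Definition spec_holds (x : label -> L) (s : seq (label * label * seq (int * label))) :=
  foldr (fun ijs P => ⟦x ijs.1.1, x ijs.1.2⟧ = out_val x ijs.2 /\ P) True s.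

Lemma spec_holdsP (x : label -> L) s : spec_holds x s ->
  forall i j u, (i, j, u) \in s -> ⟦x i, x j⟧ = out_val x u.
Proof.
elim: s => //= -[[i0 j0] u0] s IH [E H] i j u; rewrite inE.
by case/predU1P=> [[-> -> ->]|/(IH H)].
Qed.

Lemma out_valE a b t (x : label -> L) i j : values_ok a b t ->
  \sum_(k <- labels a b) (coef t i j k)%:~R *: x k = out_val x (pmap (row_out i j) t).
Proof.
rewrite /coef; elim: t => [|r t IH].
  by move=> _; rewrite big1 // => k _; rewrite big_nil scale0r.
case/andP=> rl /IH {}IH.
have -> : out_val x (pmap (row_out i j) (r :: t)) =
    (if row_out i j r is Some cz then cz.1%:~R *: x cz.2 else 0) +
      out_val x (pmap (row_out i j) t).
  by rewrite /=; case: (row_out i j r) => //=; rewrite add0r.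
rewrite -IH; under eq_bigr do rewrite big_cons rmorphD scalerDl.
rewrite big_split /=; congr (_ + _); case: r rl => [[[x0 y0] c] z] /= zl.
have pick (d : int) : \sum_(k <- labels a b)
    (if k != z then 0 else d)%:~R *: x k = d%:~R *: x z.
  rewrite (bigD1_seq z) ?uniq_labels //= eqxx big1 ?addr0 // => k kz.
  by rewrite kz scale0r.
case: ifP => _; first by rewrite pick.
by case: ifP => _; rewrite pick // scale0r.
Qed.

(** By super-skew-symmetry a table need only be checked on unordered pairs. *)
Lemma pairs_rel a b t (lt : lie_table a b t) (x : label -> L) :
    {in labels a b, forall i, x i \in part L (parity i)} ->
    {in label_pairs a b, forall ij, ⟦x ij.1, x ij.2⟧ =
      \sum_(k <- labels a b) (coef t ij.1 ij.2 k)%:~R *: x k} ->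
  table_rel a b t x.
Proof.
have [gt _] := andP lt; move=> xp ok i j il jl.
case: (label_pairsP il jl) => [/ok //|/ok /= E|[<- pi]].
  rewrite (bracket_skew (xp _ il) (xp _ jl)) E scaler_sumr -sumrN.
  apply: eq_bigr => k _; rewrite (coef_skew i j _ gt) scalerA -scaleNr.
  by rewrite rmorphN rmorphM /= rmorph_sign.
rewrite br_even_self ?big1 //; last by rewrite -pi; apply: xp.
move=> k _; suff -> : coef t i i k = 0 by rewrite scale0r.
by have := coef_skew i i k gt; rewrite pi mul1r; lia.
Qed.

Lemma spec_rel a b t (lt : lie_table a b t) (x : label -> L) :
    {in labels a b, forall i, x i \in part L (parity i)} ->
    values_ok a b t -> spec_holds x (table_spec a b t) -> table_rel a b t x.
Proof.
move=> xp vt /spec_holdsP sp; apply: (pairs_rel lt xp) => -[i j] ij.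
by rewrite out_valE //; apply: sp; apply/mapP; exists (i, j).
Qed.

(** The recognition principle used for every algebra on the lists: vectors that
    multiply as prescribed and generate [L] modulo [L^2 + Z(L)] form a basis of
    a direct factor with central complement as soon as their number is right. *)
Lemma recognize (nilL : nilpotent_lie L) a b t (lt : lie_table a b t) k l p q
    (es fs : seq L) :
    sdim L = (k, l) -> gen_dims L p q -> (a + b = p + q + \dim D)%N ->
    size es = a -> size fs = b ->
    {subset es <= part L false} -> {subset fs <= part L true} ->
    (<<es ++ fs>> + N)%VS = fullv -> values_ok a b t ->
    spec_holds (basis_val es fs) (table_spec a b t) ->
  [/\ (a <= k)%N, (b <= l)%N &
    lie_iso L (lie_sum (table_alg F lt) (abelian_alg F (k - a) (l - b)))].
Proof.
move=> sL gd ab se sf ep fp full vt sp.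
have xp : {in labels a b, forall i, basis_val es fs i \in part L (parity i)}.
  move=> i /labelsP[[j|j] ->] /=; [apply: ep | apply: fp]; rewrite mem_nth //.
    by rewrite se.
  by rewrite sf.
apply: realizes_iso (sL) _.
apply: (realizes_of_dim nilL xp (spec_rel lt xp vt sp) _ gd ab).
rewrite -full map_labels_cat; congr (<<_ ++ _>> + _)%VS.
  rewrite -[RHS](mkseq_nth 0) /mkseq se; exact: eq_map.
rewrite -[RHS](mkseq_nth 0) /mkseq sf; exact: eq_map.
Qed.

End Recognize.

(** * Consequences of the Jacobi identity and of nilpotency *)

Section Brackets.
Variables (F : fieldType) (L : lieSuperalg F).
Hypothesis nz2 : (2%:R : F) != 0.
Hypothesis nz3 : (3%:R : F) != 0.
Hypothesis nilL : nilpotent_lie L.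
Implicit Types (x y z : L).
Local Notation Z := (center L).
Local Notation D := (derived L).
Local Notation N := (cogen L).
Local Notation lc := (lower_central L).

(** The Jacobi identity for [f, f, f] says that three times this bracket is 0. *)
Lemma br_odd3 f : f \in part L true -> ⟦f, ⟦f, f⟧⟧ = 0.
Proof.
move=> f1; have E := bracket_jacobi f f1 f1.
have ff0 : ⟦f, f⟧ \in part L false by have := bracket_part f1 f1.
rewrite (brC f1 ff0) // scaleN1r in E.
have : 3%:R *: ⟦f, ⟦f, f⟧⟧ = 0.
  by rewrite scaler_nat mulrS mulr2n {1}E -opprD addNr.
by move/eqP; rewrite scaler_eq0 (negPf nz3) => /eqP.
Qed.

Lemma br_even_sq e f : e \in part L false -> f \in part L true ->
  ⟦e, ⟦f, f⟧⟧ = 2%:R *: ⟦f, ⟦e, f⟧⟧.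
Proof.
move=> e0 f1; rewrite (bracket_jacobi f e0 f1) scale1r.
have ef : ⟦e, f⟧ \in part L true by have := bracket_part e0 f1.
by rewrite (brC_odd f1 ef) scaler_nat mulr2n.
Qed.

Lemma br_odd_sq f g : f \in part L true -> g \in part L true ->
  ⟦g, ⟦f, f⟧⟧ = - (2%:R *: ⟦f, ⟦f, g⟧⟧).
Proof.
move=> f1 g1; rewrite (bracket_jacobi f g1 f1) scaleN1r.
have ef : ⟦g, f⟧ \in part L false by have := bracket_part g1 f1.
by rewrite (brC f1 ef) // (brC_odd f1 g1) -opprD scaler_nat mulr2n.
Qed.

Section Gens.
Variables (G : seq L).
Hypothesis full : (<<G>> + N)%VS = fullv.

Lemma full_decomp x : exists g d z, [/\ g \in <<G>>%VS, d \in D, z \in Z & x = g + d + z].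
Proof.
have : x \in (<<G>> + N)%VS by rewrite full memvf.
case/memv_addP=> g gG [n /memv_addP[d dD [z zZ ->]] ->].
by exists g, d, z; rewrite addrA.
Qed.

(** Modulo the next term, a term of the lower central series is spanned by the
    brackets of the generators with a spanning family of the previous term; here
    and in [lcS_gen], [W] is a subspace to be shown to contain such a term. *)
Lemma lc1_gen (W : {vspace L}) : (lc 2 <= W)%VS ->
  (forall g g', g \in G -> g' \in G -> ⟦g, g'⟧ \in W) -> (lc 1 <= W)%VS.
Proof.
move=> /subvP s2 H; apply: brv_subP => u v _ _.
have [g [d [z [gG dD zZ ->]]]] := full_decomp u.
have [g' [d' [z' [gG' dD' zZ' ->]]]] := full_decomp v.
rewrite (brDl _ z) (center_bracket _ zZ) addr0 (brDr _ _ z') (bracket_center _ zZ') addr0.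
rewrite brDl brDr -addrA; apply: rpredD; first exact: span_brv gG gG'.
apply: s2; apply: rpredD; first exact: lc_br.
exact: lc_swap.
Qed.

Lemma lcS_gen n (S : seq L) (W : {vspace L}) : {subset S <= lc n.+1} ->
    (lc n.+1 <= <<S>> + lc n.+2)%VS -> (lc n.+3 <= W)%VS ->
    (forall g s, g \in G -> s \in S -> ⟦g, s⟧ \in W) -> (lc n.+2 <= W)%VS.
Proof.
move=> /span_subvP/subvP Sn /subvP sS /subvP s2 H; apply: brv_subP => u v _ /sS.
case/memv_addP=> s sS' [v' vn ->].
have [g [d [z [gG dD zZ ->]]]] := full_decomp u.
rewrite brDl (center_bracket _ zZ) addr0 brDl brDr -addrA.
apply: rpredD; first exact: span_brv gG sS'.
apply: s2; apply: rpredD; first exact: lc_br.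
apply: lc1_br => //; apply: rpredD; first exact: Sn.
by apply: (subvP (lc_sub _ _)).
Qed.

(** The centralizer of a homogeneous element is a graded subalgebra containing the
    center, so that it is everything once it contains the generators. *)
Lemma centralizer_gen s x : x \in part L s ->
  (forall g, g \in G -> ⟦g, x⟧ = 0) -> x \in Z.
Proof.
move=> xs H; pose K := lker (linfun (ad_right x)).
have KE y : (y \in K) = (⟦y, x⟧ == 0) by rewrite memv_ker lfunE.
have gK : graded K.
  apply: gradedP => x0 x1 L0 L1; rewrite !KE brDl => /eqP E.
  have := bracket_part L0 xs; have := bracket_part L1 xs.
  case: s {xs} => /= h1 h0; last by have [-> _] := part_eq0 h0 h1 E.
  by have [|_ ->] := part_eq0 h1 h0; rewrite // addrC.
suff E : K = fullv.
  rewrite memv_ker; apply/eqP/lfunP => y; rewrite zero_lfunE.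
  have [y0 [y1 [L0 L1 ->]]] := part_decomp y; rewrite brDr.
  have h y' : ⟦y', x⟧ = 0 by apply/eqP; rewrite -KE E memvf.
  by rewrite (bracket_skew xs L0) (bracket_skew xs L1) !h !scaler0 !oppr0 addr0.
apply: (subalg_full nilL).
  have hom r r' y y' : y \in part L r -> y' \in part L r' -> y \in K -> y' \in K ->
      ⟦y, y'⟧ \in K.
    rewrite !KE => yr yr' /eqP yx /eqP yx'; have := bracket_jacobi x yr yr'.
    by rewrite yx yx' !br0r scaler0 addr0 => <-.
  move=> y y' /(graded_decomp gK)[y0 [y1 [k0 l0 k1 l1 ->]]].
  move=> /(graded_decomp gK)[y2 [y3 [k2 l2 k3 l3 ->]]].
  by rewrite brDl !brDr !rpredD // (hom _ _ _ _ l0 l2, hom _ _ _ _ l0 l3,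
    hom _ _ _ _ l1 l2, hom _ _ _ _ l1 l3).
apply/eqP; rewrite -subvf_eq -full !subv_add addvSr andTb; apply/andP; split.
  by apply: subv_trans (addvSl _ _); apply/span_subvP => g gG; rewrite KE H.
apply: subv_trans (addvSl _ _); apply/subvP => z zZ.
by rewrite KE center_bracket.
Qed.

End Gens.
End Brackets.

(** * Few generators, or a derived algebra of dimension two *)

Lemma seq_choice (T : eqType) (P : T -> T -> Prop) (s : seq T) :
  (forall x, x \in s -> exists y, P x y) ->
  exists f : T -> T, forall x, x \in s -> P x (f x).
Proof.
elim: s => [|x s IH] H; first by exists id.
have [|f Hf] := IH; first by move=> y ys; apply: H; rewrite inE ys orbT.
have [y Hy] := H x (mem_head _ _).
exists (fun z => if z == x then y else f z) => z; rewrite inE.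
by case: eqP => [-> //|_] /= /Hf.
Qed.

Section Spans.
Variables (F : fieldType) (L : lieSuperalg F).
Implicit Types (x y z : L) (G S : seq L).
Local Notation Z := (center L).
Local Notation D := (derived L).
Local Notation N := (cogen L).
Local Notation lc := (lower_central L).
Local Notation spans G := ((<<G>> + N)%VS = fullv).

Lemma spansW G S : spans G -> (forall g, g \in G -> g \in (<<S>> + N)%VS) -> spans S.
Proof.
move=> full H; apply/eqP; rewrite -subvf_eq -full subv_add addvSr andbT.
exact/span_subvP.
Qed.

Lemma mem_spans S x : x \in S -> x \in (<<S>> + N)%VS.
Proof. by move=> xS; rewrite (subvP (addvSl _ _)) // memv_span. Qed.

Lemma center_spans S x : x \in Z -> x \in (<<S>> + N)%VS.
Proof. by move=> xZ; rewrite !(subvP (addvSr _ _)). Qed.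

Lemma derived_spans S x : x \in D -> x \in (<<S>> + N)%VS.
Proof. by move=> xD; rewrite (subvP (addvSr _ _)) // (subvP (addvSl _ _)). Qed.

Lemma min_size p q S : gen_dims L p q -> spans S -> (p + q <= size S)%N.
Proof.
move=> [g0 g1] full; have gN := graded_dim (graded_cogen L).
have gL := dim_parts L; have [+ _] := dimv_add_leqif <<S>> N.
by rewrite full; have := dim_span S; lia.
Qed.

Lemma span2P (u w x : L) : x \in <<[:: u; w]>>%VS -> exists c d, x = c *: u + d *: w.
Proof.
rewrite span_cons span_seq1 => /memv_addP[_ /vlineP[c ->] [_ /vlineP[d ->] ->]].
by exists c, d.
Qed.

Lemma hom_br x y : homogeneous x -> homogeneous y -> homogeneous ⟦x, y⟧.
Proof. by move=> [s xs] [s' ys]; exists (s (+) s'); apply: bracket_part. Qed.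

Lemma hom_uniq x s s' : x != 0 -> x \in part L s -> x \in part L s' -> s = s'.
Proof.
by move=> x0; case: s; case: s' => // a b; move: x0;
  rewrite ?(part_cap0 a b) ?(part_cap0 b a) eqxx.
Qed.

Lemma br0C x y : homogeneous x -> homogeneous y -> ⟦x, y⟧ = 0 -> ⟦y, x⟧ = 0.
Proof.
by move=> [s xs] [s' ys] E; rewrite (bracket_skew ys xs) E scaler0 oppr0.
Qed.

End Spans.

Section Few.
Variables (F : fieldType) (L : lieSuperalg F).
Hypothesis nz2 : (2%:R : F) != 0.
Hypothesis nz3 : (3%:R : F) != 0.
Hypothesis nilL : nilpotent_lie L.
Implicit Types (x y z : L) (G S : seq L).
Local Notation Z := (center L).
Local Notation D := (derived L).
Local Notation N := (cogen L).
Local Notation lc := (lower_central L).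
Local Notation spans G := ((<<G>> + N)%VS = fullv).

Lemma derived_0gen : spans [::] -> \dim D = 0%N.
Proof.
move=> full; have := lc_stab nilL (lc1_gen full (W := lc 2) (subvv _) _).
by rewrite -[D]/(lc 1) => -> //; rewrite dimv0.
Qed.

(** A single generator [f] gives at most [[f, f]], since [[f, [f, f]] = 0]. *)
Lemma derived_1gen g s : g \in part L s -> spans [:: g] -> (\dim D <= 1)%N.
Proof.
move=> gs full; rewrite -[D]/(lc 1); case: s gs => gs; last first.
  have -> : lc 1 = 0%VS; last by rewrite dimv0.
  apply: (lc_stab nilL); apply: (lc1_gen full) (subvv _) _ => x y.
  by rewrite !inE => /eqP -> /eqP ->; rewrite br_even_self // mem0v.
have D1 : (lc 1 <= <<[:: ⟦g, g⟧]>> + lc 2)%VS.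
  apply: (lc1_gen full); first exact: addvSr.
  move=> x y; rewrite !inE => /eqP -> /eqP ->.
  by rewrite (subvP (addvSl _ _)) // memv_span1.
have lc2 : lc 2 = 0%VS.
  apply: (lc_stab nilL); apply: (lcS_gen full _ D1 (subvv _)) => [x|x y].
    by rewrite inE => /eqP ->; apply: derived_br.
  by rewrite !inE => /eqP -> /eqP ->; rewrite br_odd3 // mem0v.
by rewrite lc2 addv0 in D1; apply: leq_trans (dimvS D1) (dim_span _).
Qed.

(** The normal form of the generators when [L^2] is two-dimensional with a
    one-dimensional central part: [L^2] is spanned by [[e, g]] and
    [[e, [e, g]]] for an even [e]. An odd element [f] with
    [[f, [e, g]]] nonzero cannot occur: the Jacobi identity would push all
    brackets into the center. *)
Lemma derived_dim2 G p q : gen_dims L p q -> (forall g, g \in G -> homogeneous g) ->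
    spans G -> \dim D = 2%N -> \dim (D :&: Z) = 1%N ->
  exists e g (xs : seq L) s, [/\ [/\ e \in part L false, g \in part L s,
      forall x, x \in xs -> homogeneous x, size G = (size xs).+2 &
      spans [:: e, g & xs]],
    [/\ D = <<[:: ⟦e, g⟧; ⟦e, ⟦e, g⟧⟧]>>%VS, (D :&: Z = <<[:: ⟦e, ⟦e, g⟧⟧]>>)%VS
      & ⟦g, ⟦e, g⟧⟧ = 0] & 
    forall x, x \in xs -> ⟦e, x⟧ = 0 /\ ⟦x, ⟦e, g⟧⟧ = 0].
Proof.
move=> gd homG full dD dDZ.
have l2 : (\dim (lc 2) <= 1)%N by have := lc_dim nilL 1; rewrite -[lc 1]/D dD.
have l3 : lc 3 = 0%VS.
  by apply/eqP; rewrite -dimv_eq0; have := lc_dim nilL 2; lia.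
have l2Z : (lc 2 <= D :&: Z)%VS by rewrite subv_cap (lc_sub L 1) lc_center.
have nDZ : ~~ (D <= D :&: Z)%VS.
  by apply/negP => /dimvS; rewrite dD dDZ.
have [g1 [g2 [G1 G2 uZ]]] : exists g1 g2, [/\ g1 \in G, g2 \in G & ⟦g1, g2⟧ \notin Z].
  have : ~~ all (fun g1 => all (fun g2 => ⟦g1, g2⟧ \in Z) G) G.
    apply: contra nDZ => /allP H; apply: (lc1_gen full l2Z) => g1 g2 G1 G2.
    by rewrite memv_cap derived_br (allP (H g1 G1)).
  by move=> /allPn[g1 G1] /allPn[g2 G2 uZ]; exists g1, g2.
set u := ⟦g1, g2⟧ in uZ.
have [su us] : homogeneous u by apply: hom_br; apply: homG.
have [f0 Gf0 f0u] : exists2 f0, f0 \in G & ⟦f0, u⟧ != 0.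
  apply/hasP; apply: contraNT uZ => /hasPn H; apply: (centralizer_gen nilL full us).
  by move=> g /H; rewrite negbK => /eqP.
set w := ⟦f0, u⟧ in f0u.
have uD : u \in D by apply: derived_br.
have w2 : w \in lc 2 by apply: lc_br.
have wDZ := subvP l2Z _ w2; have wZ : w \in Z by have := wDZ; rewrite memv_cap => /andP[].
have EDZ : (D :&: Z = <<[:: w]>>)%VS.
  apply/eqP; rewrite eq_sym eqEdim dDZ span_seq1 -memvE wDZ /= dim_vline.
  by rewrite f0u.
have ED : D = <<[:: u; w]>>%VS.
  apply/eqP; rewrite eq_sym eqEdim dD; apply/andP; split.
    apply/span_subvP => y; rewrite !inE => /orP[] /eqP -> //.
    by have := wDZ; rewrite memv_cap => /andP[].
  rewrite span_cons dimv_disjoint_sum; last first.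
    apply/eqP; rewrite -subv0; apply/subvP => y; rewrite memv_cap -EDZ.
    case/andP=> /vlineP[c ->]; rewrite memv_cap memv0.
    have [->|c0] := eqVneq c 0; first by rewrite scale0r eqxx.
    by case/andP=> _ /(memvZ c^-1); rewrite scalerA mulVf // scale1r (negPf uZ).
  rewrite -EDZ dDZ dim_vline; have -> // : u != 0.
  by apply: contraNneq uZ => ->; rewrite mem0v.
have [s0 f0s] := homG f0 Gf0.
have [f Hf] : exists f : L -> L, forall y, y \in rem f0 G ->
    [/\ homogeneous (f y), ⟦f y, u⟧ = 0 & y - f y \in <[f0]>%VS].
  apply: (@seq_choice _ (fun y y' => [/\ homogeneous y', ⟦y', u⟧ = 0 & y - y' \in <[f0]>%VS])).
  move=> y /mem_rem yG; have [sy ys] := homG y yG.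
  have [yu|yu] := eqVneq ⟦y, u⟧ 0.
    by exists y; split; [exists sy | | rewrite subrr mem0v].
  have : ⟦y, u⟧ \in (D :&: Z)%VS by apply: (subvP l2Z); apply: lc_br.
  rewrite EDZ span_seq1 => /vlineP[c E].
  have c0 : c != 0 by apply: contraNneq yu => c0; rewrite E c0 scale0r.
  have ss : sy = s0.
    apply: (@addIb su); apply: (hom_uniq yu); first exact: bracket_part ys us.
    by rewrite E rpredZ //; apply: bracket_part f0s us.
  (* remove the component along f0, which has the same parity as y *)
  exists (y - c *: f0); split.
  - by exists s0; rewrite rpredB ?rpredZ // -ss.
  - by rewrite brE brNl brZl E subrr.
  by rewrite opprB addrC subrK memvZ // memv_line.
set ys := [seq f y | y <- rem f0 G].
have ysH y : y \in ys -> homogeneous y /\ ⟦y, u⟧ = 0.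
  by case/mapP=> y' /Hf[h h' _] ->.
have full' : spans (f0 :: ys).
  apply: (spansW full) => y yG; have [->|yf] := eqVneq y f0.
    by apply: mem_spans; apply: mem_head.
  have yr : y \in rem f0 G by move: yG; rewrite (perm_mem (perm_to_rem Gf0)) inE (negPf yf).
  have [_ _ yl] := Hf y yr; rewrite -(subrK (f y) y); apply: rpredD.
    apply: (subvP _ _ yl); rewrite -memvE; apply: mem_spans; exact: mem_head.
  by apply: mem_spans; rewrite inE map_f ?orbT.
have DP x : x \in D -> exists c d, x = c *: u + d *: w by rewrite ED => /span2P.
(* the coefficient of u is detected by ad f0 *)
have coefu x : x \in D -> ⟦f0, x⟧ = 0 -> x \in Z.
  move=> /DP[c [d ->]]; rewrite !brE (bracket_center _ wZ) scaler0 addr0 -/w.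
  by move=> /eqP; rewrite scaler_eq0 (negPf f0u) orbF => /eqP ->; rewrite scale0r add0r memvZ.
have lcH : ~ (forall x y, x \in f0 :: ys -> y \in f0 :: ys -> ⟦x, y⟧ \in Z).
  move=> H; move/negP: nDZ; apply; apply: (lc1_gen full' l2Z) => x y xG yG.
  by rewrite memv_cap derived_br H.
have ysD y d : y \in ys -> d \in D -> ⟦y, d⟧ = 0.
  move=> /ysH[_ yu] /DP[c [d' ->]].
  by rewrite !brE yu (bracket_center _ wZ) !scaler0 addr0.
have Dys y d : y \in ys -> d \in D -> ⟦d, y⟧ = 0.
  move=> yY dD'; have := ysD y d yY dD'; have [[sy ysy] _] := ysH y yY.
  have [d0 [d1 [D0 L0 D1 L1 ->]]] := graded_decomp (graded_derived L) dD'.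
  rewrite brDl => _.
  by rewrite !(br0C _ _ (ysD _ _ yY _)) ?addr0 //; exists false + exists true + exists sy.
have inner y z : y \in ys -> z \in ys -> ⟦y, z⟧ \in Z.
  move=> yY zY; apply: coefu; first exact: derived_br.
  have [[sy ysy] _] := ysH y yY; rewrite (bracket_jacobi z f0s ysy).
  by rewrite (Dys z) ?(ysD y) ?derived_br // scaler0 addr0.
case: s0 f0s => f0s.
  case: lcH; have f0f0 : ⟦f0, f0⟧ \in Z by apply: coefu; rewrite ?derived_br ?br_odd3.
  have f0y y : y \in ys -> ⟦f0, y⟧ \in Z.
    move=> yY; apply: coefu; first exact: derived_br.
    apply: (self_opp_eq0 nz2); rewrite {1}(bracket_jacobi y f0s f0s).
    by rewrite (center_bracket _ f0f0) add0r scaleN1r.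
  move=> x y; rewrite !inE => /predU1P[->|xY] /predU1P[->|yY] //; first exact: f0y.
    have [[sx xs] _] := ysH x xY; rewrite (bracket_skew xs f0s).
    by rewrite memvN memvZ // f0y.
  exact: inner.
have [g gY gZ] : exists2 g, g \in ys & ⟦f0, g⟧ \notin Z.
  apply/hasP; apply: contraPT lcH => /hasPn H.
  have f0y y : y \in ys -> ⟦f0, y⟧ \in Z by move=> /H; rewrite negbK.
  apply; move=> x y; rewrite !inE => /predU1P[->|xY] /predU1P[->|yY] //.
  - by rewrite br_even_self // mem0v.
  - exact: f0y.
  - have [[sx xs] _] := ysH x xY; rewrite (bracket_skew xs f0s).
    by rewrite memvN memvZ // f0y.
  exact: inner.
have [[s gs] gu] := ysH g gY.
set v := ⟦f0, g⟧ in gZ.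
have vD : v \in D by apply: derived_br.
have vs : v \in part L s by have := bracket_part f0s gs.
have [b [d Ev]] := DP v vD.
have b0 : b != 0.
  by apply: contraNneq gZ => b0; rewrite Ev b0 scale0r add0r memvZ.
have Ew : ⟦f0, v⟧ = b *: w by rewrite Ev !brE (bracket_center _ wZ) scaler0 addr0.
have vws : ⟦f0, v⟧ \in part L s by have := bracket_part f0s vs.
have EDZ' : (D :&: Z = <<[:: ⟦f0, v⟧]>>)%VS.
  apply/eqP; rewrite EDZ !span_seq1 Ew eqEdim !dim_vline scaler_eq0 (negPf b0) f0u andbT.
  by rewrite -memvE -{1}[w](scalerK b0) memvZ // memv_line.
have ED' : D = <<[:: v; ⟦f0, v⟧]>>%VS.
  apply/eqP; rewrite eqEsubv; apply/andP; split; last first.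
    by apply/span_subvP => y; rewrite !inE => /orP[] /eqP -> //; apply: derived_br.
  have ww : w \in <<[:: v; ⟦f0, v⟧]>>%VS.
    by rewrite -[w](scalerK b0) memvZ // -Ew memv_span // !inE eqxx orbT.
  rewrite {1}ED; apply/span_subvP => y; rewrite !inE => /orP[] /eqP -> //.
  rewrite -[u](scalerK b0) memvZ // -[b *: u](addrK (d *: w)) -Ev.
  by rewrite memvB ?memvZ // memv_span // mem_head.
have Ds : (D <= part L s)%VS.
  by rewrite ED'; apply/span_subvP => y; rewrite !inE => /orP[] /eqP ->.
have [h Hh] : exists h : L -> L, forall x, x \in rem g ys ->
    [/\ homogeneous (h x), ⟦f0, h x⟧ = 0, ⟦h x, v⟧ = 0 & x - h x \in (<[g]> + N)%VS].
  apply: (@seq_choice _ (fun x x' => [/\ homogeneous x', ⟦f0, x'⟧ = 0, ⟦x', v⟧ = 0 &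
    x - x' \in (<[g]> + N)%VS])).
  move=> x /mem_rem xY; have [[sx xs] _] := ysH x xY.
  have [E|n0] := eqVneq ⟦f0, x⟧ 0.
    exists x; split=> //; [by exists sx | exact: ysD | by rewrite subrr mem0v].
  have ss : sx = s.
    apply: (hom_uniq n0); first by have := bracket_part f0s xs.
    by apply: (subvP Ds); apply: derived_br.
  have := derived_br f0 x; rewrite ED' => /span2P[c [c' E]].
  (* [f0, x] = c v + c' [f0, v] is cancelled by [f0, c g + c' v] *)
  exists (x - c *: g - c' *: v); split.
  - by exists s; rewrite !rpredB ?rpredZ // -ss.
  - by rewrite !brE E -/v addrAC addrK subrr.
  - rewrite !brE (ysD x) // (ysD g) // !scaler0 oppr0 !addr0 sub0r.
    apply/eqP; rewrite oppr_eq0 scaler_eq0; apply/orP; right; apply/eqP.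
    by apply/eqP; rewrite -memv0 -l3; apply: lc1_br.
  rewrite -addrA -opprD opprB addrC subrK memv_add ?memvZ ?memv_line //.
  by rewrite (subvP (addvSl _ _)).
have pY := perm_to_rem gY.
exists f0, g, [seq h x | x <- rem g ys], s; split; first split=> //.
- by move=> _ /mapP[x /Hh[hx _ _ _] ->].
- rewrite size_map -[(_).+2]/((size (g :: rem g ys)).+1) -(perm_size pY).
  by rewrite /ys size_map -[(_).+1]/(size (f0 :: rem f0 G)) -(perm_size (perm_to_rem Gf0)).
- apply: (spansW full') => y; rewrite inE => /predU1P[->|yY].
    by apply: mem_spans; apply: mem_head.
  have [->|yg] := eqVneq y g; first by apply: mem_spans; rewrite !inE eqxx orbT.
  have yr : y \in rem g ys by move: yY; rewrite (perm_mem pY) inE (negPf yg).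
  have [_ _ _ yl] := Hh y yr; rewrite -(subrK (h y) y); apply: rpredD.
    apply: (subvP _ _ yl); rewrite addvS // -memvE memv_span //.
    by rewrite !inE eqxx orbT.
  by apply: mem_spans; rewrite !inE map_f ?orbT.
- by split=> //; apply: ysD.
by move=> _ /mapP[x /Hh[_ ? ? _] ->].
Qed.

End Few.

(** * The algebras with a derived algebra of dimension two *)

(** [L] is the direct sum of the table algebra and an abelian one. *)
Definition factor (F : fieldType) a b t (lt : lie_table a b t) k l
    (L : lieSuperalg F) : Prop :=
  [/\ (a <= k)%N, (b <= l)%N &
    lie_iso L (lie_sum (table_alg F lt) (abelian_alg F (k - a) (l - b)))].

(** Replaces the list of prescribed brackets by its value. *)
Ltac compute_spec :=
  match goal with |- context [table_spec ?a ?b ?t] =>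
    let s := eval vm_compute in (table_spec a b t) in
    have -> : table_spec a b t = s by vm_compute; reflexivity
  end.

Ltac conj_tac := repeat match goal with |- _ /\ _ => split end; try done.

Ltac subset_tac := let x := fresh "x" in
  move=> x; rewrite ?inE //; repeat case/orP; move/eqP => -> //.

(** Applies [recognize], leaving the count, the parities of the vectors that are not
    hypotheses, the generation and the brackets. *)
Ltac recognize_by nz2 nilL lt E F sL gd :=
  apply: (@recognize _ _ nz2 nilL _ _ _ lt _ _ _ _ E F sL gd);
  [ | reflexivity | reflexivity | subset_tac | subset_tac | | reflexivity | compute_spec; rewrite /= ].

Lemma intrN1 (F : fieldType) : (Negz 0)%:~R = -1 :> F.
Proof. by []. Qed.
Lemma intr2 (F : fieldType) : (Posz 2)%:~R = 2%:R :> F.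
Proof. by []. Qed.

Lemma lc_vanish (F : fieldType) (L : lieSuperalg F) (nilL : nilpotent_lie L) m :
  (\dim (derived L) <= m)%N -> lower_central L m.+1 = 0%VS.
Proof.
move=> dD; suff H i : (\dim (lower_central L i.+1) <= m - i)%N.
  by apply/eqP; rewrite -dimv_eq0; have := H m; lia.
elim: i => [|i IH]; first by rewrite subn0.
by have := lc_dim nilL i.+1; lia.
Qed.

Lemma homogeneous_eq0 (F : fieldType) (L : lieSuperalg F) (U : {vspace L}) x s : (U <= part L s)%VS ->
  x \in U -> x \in part L (~~ s) -> x = 0.
Proof.
move=> /subvP Us /Us xs; case: s xs {Us} => xs xs'; last exact: part_cap0 xs xs'.
exact: part_cap0 xs' xs.
Qed.

Section TwoDim.
Variables (F : fieldType) (L : lieSuperalg F).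
Hypothesis nz2 : (2%:R : F) != 0.
Hypothesis nz3 : (3%:R : F) != 0.
Hypothesis nilL : nilpotent_lie L.
Implicit Types (x y z : L) (G S : seq L).
Local Notation Z := (center L).
Local Notation D := (derived L).
Local Notation N := (cogen L).
Local Notation lc := (lower_central L).
Local Notation spans G := ((<<G>> + N)%VS = fullv).
Variables (k l p q : nat).
Hypothesis sL : sdim L = (k, l).
Hypothesis gd : gen_dims L p q.

(** No fewer than [p + q] elements generate. *)
Lemma spans_size G : spans G -> (size G < p + q)%N -> False.
Proof. by move=> /(min_size gd); rewrite leqNgt => /negPf ->. Qed.

Lemma dim2_gen2 G : (forall g, g \in G -> homogeneous g) -> spans G ->
    size G = 2%N -> (p + q = 2)%N -> \dim D = 2%N -> \dim (D :&: Z) = 1%N ->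
  factor lie_table_4_0_2 k l L \/ factor lie_table_1_3_1 k l L.
Proof.
move=> homG full sG pq dD dDZ.
have [e [g [xs [s []]]]] := derived_dim2 nz2 nz3 nilL gd homG full dD dDZ.
rewrite sG => -[e0 gs _ /esym [/size0nil -> {xs}] full'] [ED EDZ gu] _.
set u := ⟦e, g⟧ in ED EDZ gu; set w := ⟦e, u⟧ in ED EDZ.
have lc3 : lc 3 = 0%VS by apply: (lc_vanish nilL); rewrite dD.
have DD x y : x \in D -> y \in D -> ⟦x, y⟧ = 0.
  by move=> xD yD; apply/eqP; rewrite -memv0 -lc3; apply: lc1_br.
have uD : u \in D := derived_br _ _; have wD : w \in D := derived_br _ _.
have wZ : w \in Z by have := memv_span1 w; rewrite -EDZ memv_cap => /andP[].
have us : u \in part L s by have := bracket_part e0 gs.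
have ws : w \in part L s by have := bracket_part e0 us.
have uu := DD u u uD uD; have wl := center_bracket _ wZ; have wr := bracket_center _ wZ.
have Ds : (D <= part L s)%VS by rewrite ED; apply/span_subvP; subset_tac.
have full2 S : {subset [:: e; g] <= S} -> spans S.
  by move=> sS; apply: (spansW full') => x /sS; apply: mem_spans.
case: s gs us ws Ds => gs us ws Ds; [right | left].
  have ug : ⟦u, g⟧ = 0 by rewrite (brC_odd gs us).
  have gg : ⟦g, g⟧ = 0.
    by apply: (homogeneous_eq0 Ds); [exact: derived_br | have := bracket_part gs gs].
  recognize_by nz2 nilL lie_table_1_3_1 [:: e] [:: w; u; g] sL gd.
  - by rewrite pq dD.
  - by apply: full2 => x; rewrite /= !inE => /orP[] ->; rewrite ?orbT.
  by rewrite ?(wl, wr, ug, gg, uu, mulr1z, scale1r, addr0).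
recognize_by nz2 nilL lie_table_4_0_2 [:: e; g; u; w] (Nil L) sL gd.
- by rewrite pq dD.
- by apply: full2 => x; rewrite /= !inE => /orP[] ->; rewrite ?orbT.
by rewrite ?(wl, wr, gu, mulr1z, scale1r, addr0).
Qed.

(** The third generator [x] commutes with [e] and [u = [e, g]]; not being central
    it has a nonzero bracket with [g] or with itself, a multiple of [w = [e, u]]
    because [ad e] kills it. The parities of [g] and [x] decide which. *)
Lemma dim2_gen3 G : (forall g, g \in G -> homogeneous g) -> spans G ->
    size G = 3%N -> (p + q = 3)%N -> \dim D = 2%N -> \dim (D :&: Z) = 1%N ->
  [\/ factor lie_table_5_0_5 k l L, factor lie_table_4_1_6 k l L |
      factor lie_table_2_3_24 k l L].
Proof.
move=> homG full sG pq dD dDZ.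
have [e [g [xs [s []]]]] := derived_dim2 nz2 nz3 nilL gd homG full dD dDZ.
rewrite sG => -[e0 gs + + full'] [ED EDZ gu].
case: xs full' => [|x [|//]] full' homx // _ Hx.
set u := ⟦e, g⟧ in ED EDZ gu Hx; set w := ⟦e, u⟧ in ED EDZ.
have [ex xu] := Hx _ (mem_head _ _); have [sx xs] := homx _ (mem_head _ _).
have lc3 : lc 3 = 0%VS by apply: (lc_vanish nilL); rewrite dD.
have DD y z : y \in D -> z \in D -> ⟦y, z⟧ = 0.
  by move=> yD zD; apply/eqP; rewrite -memv0 -lc3; apply: lc1_br.
have uD : u \in D := derived_br _ _; have wD : w \in D := derived_br _ _.
have wZ : w \in Z by have := memv_span1 w; rewrite -EDZ memv_cap => /andP[].
have us : u \in part L s by have := bracket_part e0 gs.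
have ws : w \in part L s by have := bracket_part e0 us.
have w0 : w != 0.
  by apply: contra_eqN dDZ => /eqP E; rewrite EDZ E span_seq1 dim_vline eqxx.
have uu := DD u u uD uD; have wl := center_bracket _ wZ; have wr := bracket_center _ wZ.
have Ds : (D <= part L s)%VS by rewrite ED; apply/span_subvP; subset_tac.
have ux : ⟦u, x⟧ = 0 by apply: br0C xu; [exists sx | exists s].
have ug : ⟦u, g⟧ = 0 by apply: br0C gu; exists s.
have xe : ⟦x, e⟧ = 0 by apply: br0C ex; [exists false | exists sx].
(* a bracket killed by ad e is a multiple of w *)
have kill y : y \in D -> ⟦e, y⟧ = 0 -> exists c, y = c *: w.
  rewrite ED => /span2P[c [d ->]]; rewrite !brE wr scaler0 addr0 -/w => /eqP.
  rewrite scaler_eq0 (negPf w0) orbF => /eqP ->.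
  by exists d; rewrite scale0r add0r.
have [c Ec] : exists c, ⟦g, x⟧ = c *: w.
  apply: kill (derived_br _ _) _; rewrite (bracket_jacobi _ e0 gs) -/u ux ex.
  by rewrite br0r scaler0 addr0.
have [d Ed] : exists d, ⟦x, x⟧ = d *: w.
  apply: kill (derived_br _ _) _; rewrite (bracket_jacobi _ e0 xs) ex.
  by rewrite br0l br0r scaler0 addr0.
have cd : (c != 0) || (d != 0).
  apply/negPn/negP; rewrite negb_or !negbK => /andP[/eqP c0 /eqP d0].
  rewrite c0 scale0r in Ec; rewrite d0 scale0r in Ed.
  have xZ : x \in Z.
    apply: (centralizer_gen nilL full' xs) => y; rewrite !inE.
    by case/or3P=> /eqP ->.
  apply: (@spans_size [:: e; g]); last by rewrite pq.
  apply: (spansW full') => y; rewrite !inE => /or3P[] /eqP ->.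
  - by apply: mem_spans; rewrite /= !inE eqxx.
  - by apply: mem_spans; rewrite /= !inE eqxx orbT.
  exact: center_spans.
have c0N : c != 0 -> (c^-1 != 0) by rewrite invr_eq0.
have full3 r S : r != 0 -> {subset [:: e; g; r *: x] <= S} -> spans S.
  move=> r0 sS; apply: (spansW full') => y; rewrite !inE => /or3P[] /eqP ->.
  - by apply: mem_spans; apply: sS; rewrite !inE eqxx.
  - by apply: mem_spans; apply: sS; rewrite !inE eqxx orbT.
  rewrite -[x](scalerK r0) memvZ //; apply: mem_spans; apply: sS.
  by rewrite /= !inE eqxx ?orbT.
case: s gs us ws Ds => gs us ws Ds.
  have gg : ⟦g, g⟧ = 0.
    by apply: (homogeneous_eq0 Ds); [exact: derived_br | have := bracket_part gs gs].
  have xx : ⟦x, x⟧ = 0.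
    apply: (homogeneous_eq0 Ds); first exact: derived_br.
    by have := bracket_part xs xs; rewrite addbb.
  have d0 : d = 0 by move: Ed; rewrite xx => /esym/eqP; rewrite scaler_eq0 (negPf w0) orbF => /eqP.
  rewrite d0 eqxx orbF in cd.
  have gx0 : ⟦g, x⟧ != 0 by rewrite Ec scaler_eq0 negb_or cd.
  have x0 : x \in part L false.
    case: sx xs => // xs; case/negP: gx0; apply/eqP; apply: (homogeneous_eq0 Ds).
      exact: derived_br.
    by have := bracket_part gs xs.
  apply: Or33; set r := - c^-1; have r0 : r != 0 by rewrite oppr_eq0 c0N.
  have xg : ⟦x, g⟧ = - (c *: w) by rewrite (brC gs x0) // Ec.
  recognize_by nz2 nilL lie_table_2_3_24 [:: e; r *: x] [:: w; u; g] sL gd.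
  - by rewrite pq dD.
  - by rewrite memvZ.
  - apply: (full3 r) => // y; rewrite /= !inE.
    by case/or3P=> ->; rewrite ?orbT.
  rewrite ?(brE, wl, wr, ex, ug, gg, xg, xu, uu, mulr1z, scale1r, scaler0, addr0) //.
  by rewrite scalerN scaleNr opprK scalerA mulVf // scale1r.
have gg : ⟦g, g⟧ = 0 by apply: br_even_self.
case: sx xs => xs.
  have gx : ⟦g, x⟧ = 0.
    by apply: (homogeneous_eq0 Ds); [exact: derived_br | have := bracket_part gs xs].
  have c0 : c = 0 by move: Ec; rewrite gx => /esym/eqP; rewrite scaler_eq0 (negPf w0) orbF => /eqP.
  rewrite c0 eqxx /= in cd.
  apply: Or32.
  recognize_by nz2 nilL lie_table_4_1_6 [:: e; d *: g; d *: u; d *: w] [:: x] sL gd.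
  - by rewrite pq dD.
  - by rewrite memvZ.
  - by rewrite memvZ.
  - by rewrite memvZ.
  - apply: (spansW full') => y; rewrite !inE => /or3P[] /eqP ->.
    + by apply: mem_spans; rewrite /= !inE eqxx.
    + rewrite -{1}[g](scalerK cd) memvZ //; apply: mem_spans.
      by rewrite /= !inE eqxx ?orbT.
    by apply: mem_spans; rewrite /= !inE eqxx !orbT.
  by rewrite ?(brE, wl, wr, ex, gu, ux, gx, Ed, mulr1z, scale1r, scaler0, addr0).
have xx : ⟦x, x⟧ = 0 by apply: br_even_self.
have d0 : d = 0 by move: Ed; rewrite xx => /esym/eqP; rewrite scaler_eq0 (negPf w0) orbF => /eqP.
rewrite d0 eqxx orbF in cd.
apply: Or31; set r := - c^-1; have r0 : r != 0 by rewrite oppr_eq0 c0N.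
have ge : ⟦g, e⟧ = - u by rewrite (brC e0 gs).
recognize_by nz2 nilL lie_table_5_0_5 [:: g; e; - u; r *: x; - w] (Nil L) sL gd.
- by rewrite pq dD.
- by rewrite memvN.
- by rewrite memvZ.
- by rewrite memvN.
- apply: (full3 r) => // y; rewrite /= !inE.
  by case/or3P=> ->; rewrite ?orbT.
rewrite ?(brE, wl, wr, ge, ex, gu, ux, Ec, mulr1z, scale1r, scaler0, addr0, oppr0) //.
by rewrite scaleNr scalerA mulVf // scale1r.
Qed.

(** ** Two generators and a central derived algebra *)

Hypothesis dD : \dim D = 2%N.
Hypothesis dDZ : \dim (D :&: Z) = 2%N.
Hypothesis pq : (p + q = 2)%N.

Lemma central_derived : (D <= Z)%VS.
Proof. by apply/capv_idPl/eqP; rewrite eqEdim capvSl dDZ dD. Qed.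

Lemma central_lc2 : lc 2 = 0%VS.
Proof.
apply/eqP; rewrite -subv0; apply: brv_subP => u v _ vD.
by rewrite bracket_center ?mem0v // (subvP central_derived).
Qed.

Lemma dim22_even e e' : e \in part L false -> e' \in part L false ->
  spans [:: e; e'] -> False.
Proof.
move=> e0 e0' full; suff : (\dim D <= 1)%N by rewrite dD.
apply: leq_trans (dim_span [:: ⟦e, e'⟧]); apply: dimvS.
apply: (lc1_gen full); first by rewrite central_lc2 sub0v.
move=> x y; rewrite !inE => /orP[] /eqP -> /orP[] /eqP ->.
- by rewrite br_even_self // mem0v.
- exact: memv_span1.
- by rewrite (brC e0 e0') // memvN memv_span1.
by rewrite br_even_self // mem0v.
Qed.

Lemma dim22_mixed e f : e \in part L false -> f \in part L true ->
  spans [:: e; f] -> factor lie_table_2_2_6 k l L.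
Proof.
move=> e0 f1 full; have /subvP DZ := central_derived.
have hZ := DZ _ (derived_br f f); have sZ := DZ _ (derived_br e f).
have ff0 : ⟦f, f⟧ \in part L false by have := bracket_part f1 f1.
have ef1 : ⟦e, f⟧ \in part L true by have := bracket_part e0 f1.
recognize_by nz2 nilL lie_table_2_2_6 [:: ⟦f, f⟧; e] [:: ⟦e, f⟧; f] sL gd.
- by rewrite pq dD.
- apply: (spansW full) => x; rewrite !inE => /orP[] /eqP -> ; apply: mem_spans;
    by rewrite /= !inE eqxx ?orbT.
rewrite ?(center_bracket _ hZ, center_bracket _ sZ) ?(bracket_center _ hZ, bracket_center _ sZ).
by rewrite ?(mulr1z, scale1r, addr0).
Qed.

Lemma dim22_square f g : f \in part L true -> g \in part L true ->
  spans [:: f; g] -> ⟦f, f⟧ = 0 -> factor lie_table_2_2_4 k l L.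
Proof.
move=> f1 g1 full ff; have /subvP DZ := central_derived.
have hZ := DZ _ (derived_br f g); have sZ := DZ _ (derived_br g g).
have h0 : ⟦f, g⟧ \in part L false by have := bracket_part f1 g1.
have s0 : ⟦g, g⟧ \in part L false by have := bracket_part g1 g1.
recognize_by nz2 nilL lie_table_2_2_4 [:: ⟦f, g⟧; ⟦g, g⟧] [:: f; g] sL gd.
- by rewrite pq dD.
- apply: (spansW full) => x; rewrite !inE => /orP[] /eqP -> ; apply: mem_spans;
    by rewrite /= !inE eqxx ?orbT.
rewrite ?(center_bracket _ hZ, center_bracket _ sZ) ?(bracket_center _ hZ, bracket_center _ sZ).
by rewrite ?(ff, mulr1z, scale1r, addr0).
Qed.

Lemma dim22_orth f g : f \in part L true -> g \in part L true ->
  spans [:: f; g] -> ⟦f, g⟧ = 0 -> factor lie_table_2_2_1 k l L.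
Proof.
move=> f1 g1 full fg; have /subvP DZ := central_derived.
have hZ := DZ _ (derived_br f f); have sZ := DZ _ (derived_br g g).
have h0 : ⟦f, f⟧ \in part L false by have := bracket_part f1 f1.
have s0 : ⟦g, g⟧ \in part L false by have := bracket_part g1 g1.
recognize_by nz2 nilL lie_table_2_2_1 [:: ⟦f, f⟧; ⟦g, g⟧] [:: f; g] sL gd.
- by rewrite pq dD.
- apply: (spansW full) => x; rewrite !inE => /orP[] /eqP -> ; apply: mem_spans;
    by rewrite /= !inE eqxx ?orbT.
rewrite ?(center_bracket _ hZ, center_bracket _ sZ) ?(bracket_center _ hZ, bracket_center _ sZ).
by rewrite ?(fg, mulr1z, scale1r, addr0).
Qed.

(** The three brackets of the two odd generators satisfy one linear relation,
    which is a binary quadratic form in the generators. Over a square closed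
    field it factors as [[f', g'] = 0]; the two cases are whether the factors
    are proportional. *)
Lemma dim22_odd f g : square_closed F -> f \in part L true -> g \in part L true ->
  spans [:: f; g] ->
  factor lie_table_2_2_1 k l L \/ factor lie_table_2_2_4 k l L.
Proof.
move=> sq f1 g1 full.
have full' : spans [:: g; f].
  by apply: (spansW full) => x; rewrite !inE => /orP[] /eqP ->; apply: mem_spans;
    rewrite /= !inE eqxx ?orbT.
have fullr r : spans [:: f - r *: g; g].
  apply: (spansW full) => x; rewrite !inE => /orP[] /eqP ->; last first.
    by apply: mem_spans; rewrite /= !inE eqxx orbT.
  rewrite -{1}[f](subrK (r *: g)); apply: rpredD; last apply: rpredZ.
    by apply: mem_spans; rewrite /= !inE eqxx.
  by apply: mem_spans; rewrite /= !inE eqxx orbT.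
have fr1 r : f - r *: g \in part L true by rewrite rpredB ?rpredZ.
have nf : ~~ free [:: ⟦f, f⟧; ⟦f, g⟧; ⟦g, g⟧].
  suff H : (\dim <<[:: ⟦f, f⟧; ⟦f, g⟧; ⟦g, g⟧]>> <= 2)%N by rewrite /free neq_ltn ltnS H.
  rewrite -dD; apply: dimvS; apply/span_subvP => x; rewrite !inE.
  by case/or3P=> /eqP ->; apply: derived_br.
move: nf; rewrite !free_cons nil_free andbT !negb_and !negbK => /or3P[].
- case/span2P=> b [c E].
  have [d Ed] := sq (b ^+ 2 + 4%:R * c).
  pose r1 := (b + d) / 2%:R; pose r2 := (b - d) / 2%:R.
  have Eb : r1 + r2 = b by rewrite /r1 /r2; field.
  have nz4 : (4%:R : F) != 0 by rewrite -[4%N]/(2 * 2)%N natrM mulf_neq0.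
  have Ec : r1 * r2 = - c.
    have -> : r1 * r2 = (b ^+ 2 - d ^+ 2) / 4%:R.
      by rewrite /r1 /r2; field; rewrite nz4 nz2.
    by rewrite Ed; field.
  have E' : ⟦f - r1 *: g, f - r2 *: g⟧ = 0.
    rewrite !brE (brC_odd f1 g1) E -Eb scalerDl -[c]opprK -Ec.
    rewrite opprK scalerA scaleNr [X in X + _]addrAC addrK [X in _ + X]addrC -opprB.
    exact: addNr.
  have [r12|r12] := eqVneq r1 r2.
    by right; rewrite -r12 in E'; apply: dim22_square (fullr r1) E'.
  left; apply: dim22_orth E' => //.
  apply: (spansW (fullr r1)) => x; rewrite !inE => /orP[] /eqP ->.
    by apply: mem_spans; rewrite /= !inE eqxx.
  have r0 : r2 - r1 != 0 by rewrite subr_eq0 eq_sym.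
  rewrite -{1}[g](scalerK r0) memvZ //.
  have -> : (r2 - r1) *: g = (f - r1 *: g) - (f - r2 *: g).
    by rewrite opprB [RHS]addrC addrA subrK scalerBl.
  by rewrite rpredB //; apply: mem_spans; rewrite !inE eqxx ?orbT.
- rewrite span_seq1 => /vlineP[c E]; left.
  apply: (dim22_orth (fr1 c) g1 (fullr c)).
  by rewrite brE brNl brZl E subrr.
rewrite span_nil memv0 => /eqP E; right.
exact: dim22_square full' E.
Qed.

End TwoDim.

(** * Two generators and a derived algebra of dimension three *)

Section ThreeDim.
Variables (F : fieldType) (L : lieSuperalg F).
Hypothesis nz2 : (2%:R : F) != 0.
Hypothesis nz3 : (3%:R : F) != 0.
Hypothesis nilL : nilpotent_lie L.
Implicit Types (x y z : L) (G S : seq L).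
Local Notation Z := (center L).
Local Notation D := (derived L).
Local Notation N := (cogen L).
Local Notation lc := (lower_central L).
Local Notation spans G := ((<<G>> + N)%VS = fullv).
Variables (k l p q : nat).
Hypothesis sL : sdim L = (k, l).
Hypothesis gd : gen_dims L p q.
Hypothesis pq : (p + q = 2)%N.
Hypothesis dD : \dim D = 3%N.
Hypothesis dDZ : \dim (D :&: Z) = 1%N.

Lemma lc4 : lc 4 = 0%VS.
Proof. by apply: (lc_vanish nilL); rewrite dD. Qed.

Lemma lc2_dim : (\dim (lc 2) <= 2)%N.
Proof. by have := lc_dim nilL 1; rewrite -[lc 1]/D dD. Qed.

Lemma lc3Z : (lc 3 <= D :&: Z)%VS.
Proof.
rewrite subv_cap (lc_center lc4) andbT.
exact: subv_trans (lc_sub L 2) (lc_sub L 1).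
Qed.

Lemma D_lc2 x y : x \in D -> y \in lc 2 -> ⟦x, y⟧ = 0.
Proof. by move=> xD y2; apply/eqP; rewrite -memv0 -lc4; apply: (lc1_br xD). Qed.

Lemma lc2_D x y : x \in lc 2 -> y \in D -> ⟦x, y⟧ = 0.
Proof.
move=> x2 yD; have [x0 [x1 [X0 P0 X1 P1 ->]]] := graded_decomp (graded_lc L 2) x2.
have [y0 [y1 [Y0 Q0 Y1 Q1 ->]]] := graded_decomp (graded_derived L) yD.
by rewrite !brE (br0C _ _ (D_lc2 Y0 X0)) ?(br0C _ _ (D_lc2 Y0 X1))
  ?(br0C _ _ (D_lc2 Y1 X0)) ?(br0C _ _ (D_lc2 Y1 X1)) ?addr0 //;
  by [exists true | exists false].
Qed.

Lemma notDZ : ~~ (D <= Z)%VS.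
Proof.
apply/negP => /capv_idPl E.
by have := dDZ; rewrite E dD.
Qed.

Lemma lc2_neq0 : lc 2 <> 0%VS.
Proof. by move=> E; have := lc_center E; apply/negP/notDZ. Qed.

Lemma center_line : exists w s, [/\ w \in part L s, w != 0 & (D :&: Z = <[w]>)%VS].
Proof.
exact: graded_line (graded_cap (graded_derived L) (graded_center L)) dDZ.
Qed.

Lemma notspan2 (a b : L) : ~~ (D <= <<[:: a; b]>>)%VS.
Proof. by apply/negP => /dimvS; rewrite dD => /leq_trans/(_ (dim_span _)). Qed.

Lemma spans_pair (a b c d : L) : spans [:: a; b] ->
  a \in (<<[:: c; d]>> + N)%VS -> b \in (<<[:: c; d]>> + N)%VS -> spans [:: c; d].
Proof.
by move=> full ac bc; apply: (spansW full) => x; rewrite !inE => /orP[] /eqP ->.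
Qed.

(** ** Two even generators *)

(** [L^2] has the basis [u, v, w] with [w] spanning the last term of the lower
    central series. Subtracting a multiple of [e1] from [e2] brings [[e2, u]] into
    the line of [w], and whether it vanishes separates the two algebras. *)
Lemma dim3_even_core e1 e2 : e1 \in part L false -> e2 \in part L false ->
    spans [:: e1; e2] -> ⟦e1, ⟦e1, e2⟧⟧ \notin Z ->
  factor lie_table_5_0_3 k l L \/ factor lie_table_5_0_4 k l L.
Proof.
move=> e10 e20 full; set u := ⟦e1, e2⟧; set v := ⟦e1, u⟧ => vZ.
have uD : u \in D := derived_br _ _; have v2 : v \in lc 2 by apply: lc_br.
have u0 : u \in part L false by have := bracket_part e10 e20.
have v0 : v \in part L false by have := bracket_part e10 u0.
have [w [s [ws w0 EW]]] := center_line.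
have wZ : w \in Z by have := memv_line w; rewrite -EW memv_cap => /andP[].
have E3 : lc 3 = <[w]>%VS.
  apply/eqP; rewrite -EW eqEdim lc3Z dDZ lt0n dimv_eq0.
  by apply: contraNneq vZ => /lc_center/subvP; apply.
have w2 : w \in lc 2 by apply: (subvP (lc_sub L 2)); rewrite E3 memv_line.
have E2 : lc 2 = <<[:: v; w]>>%VS.
  apply/eqP; rewrite eq_sym eqEdim; apply/andP; split.
    by apply/span_subvP => x; rewrite !inE => /orP[] /eqP ->.
  have /eqP -> : free [:: v; w]; last exact: lc2_dim.
  rewrite free_cons span_seq1 seq1_free w0 andbT.
  by apply: contra vZ => /vlineP[c ->]; rewrite memvZ.
have [a [b Eb]] : exists a b, ⟦e2, u⟧ = a *: v + b *: w.
  by apply: span2P; rewrite -E2; apply: lc_br.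
have [c Ec] : exists c, ⟦e1, v⟧ = c *: w by apply/vlineP; rewrite -E3; apply: lc_br.
pose e2' := e2 - a *: e1.
have e2'0 : e2' \in part L false by rewrite rpredB ?rpredZ.
have full' r : r != 0 -> spans [:: e1; r *: e2'].
  move=> r0; apply: (spans_pair full); first by apply: mem_spans; rewrite !inE eqxx.
  have -> : e2 = r^-1 *: (r *: e2') + a *: e1 by rewrite scalerK // subrK.
  by rewrite rpredD // rpredZ //; apply: mem_spans; rewrite !inE eqxx ?orbT.
have full1 : spans [:: e1; e2'] by have := full' 1 (oner_neq0 _); rewrite scale1r.
have e12 : ⟦e1, e2'⟧ = u by rewrite !brE (br_even_self nz2 e10) scaler0 subr0.
have e2u : ⟦e2', u⟧ = b *: w by rewrite brE brNl brZl Eb addrAC subrr add0r.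
have e2v : ⟦e2', v⟧ = 0.
  rewrite (bracket_jacobi u e2'0 e10) (brC e10 e2'0) // e12 e2u !brE.
  by rewrite (br_even_self nz2 u0) (bracket_center _ wZ) !scaler0 oppr0 addr0.
have c0 : c != 0.
  apply: contraNneq vZ => c0; apply: (centralizer_gen nilL full1 v0) => g.
  by rewrite !inE => /orP[] /eqP -> //; rewrite Ec c0 scale0r.
have uv : ⟦u, v⟧ = 0 by apply: D_lc2.
have w00 : w \in part L false.
  by rewrite -[w](scalerK c0) -Ec rpredZ //; have := bracket_part e10 v0.
have wl := center_bracket _ wZ; have wr := bracket_center _ wZ.
have spansW2 S r : r != 0 -> {subset [:: e1; r *: e2'] <= S} -> spans S.
  by move=> r0 sS; apply: (spansW (full' r r0)) => x /sS; apply: mem_spans.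
have [b0|b0] := eqVneq b 0.
  right; rewrite b0 scale0r in e2u.
  recognize_by nz2 nilL lie_table_5_0_4 [:: e1; e2'; u; v; c *: w] (Nil L) sL gd.
  - by rewrite pq dD.
  - by rewrite rpredZ.
  - apply: (spansW full1) => x; rewrite !inE => /orP[] /eqP ->; apply: mem_spans;
      by rewrite /= !inE eqxx ?orbT.
  by rewrite ?(brZl, brZr, wl, wr, e12, e2u, e2v, Ec, uv, mulr1z, scale1r, scaler0, addr0).
(* scaling e2 by r scales [e2, u] by r^2 and w by r, hence r b = c *)
left; pose r := c / b; have r0 : r != 0 by rewrite mulf_neq0 ?invr_eq0.
recognize_by nz2 nilL lie_table_5_0_3 [:: e1; r *: e2'; r *: u; r *: v; r *: (c *: w)]
  (Nil L) sL gd.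
- by rewrite pq dD.
- by rewrite rpredZ.
- by rewrite rpredZ.
- by rewrite rpredZ.
- by rewrite !rpredZ.
- apply: (spansW (full' r r0)) => x; rewrite !inE => /orP[] /eqP ->; apply: mem_spans;
    by rewrite /= !inE eqxx ?orbT.
rewrite ?(brZl, brZr, wl, wr, e12, e2u, e2v, Ec, uv, mulr1z, scale1r, scaler0, addr0).
conj_tac; rewrite -/v ?Ec ?addr0 //.
by rewrite !scalerA /r; congr (_ *: _); field.
Qed.

Lemma dim3_even e1 e2 : e1 \in part L false -> e2 \in part L false ->
    spans [:: e1; e2] ->
  factor lie_table_5_0_3 k l L \/ factor lie_table_5_0_4 k l L.
Proof.
move=> e10 e20 full.
have full' : spans [:: e2; e1].
  by apply: (spans_pair full); apply: mem_spans; rewrite !inE eqxx ?orbT.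
have [v1|/(dim3_even_core e10 e20 full) //] := boolP (⟦e1, ⟦e1, e2⟧⟧ \in Z).
have [v2|/(dim3_even_core e20 e10 full') //] := boolP (⟦e2, ⟦e2, e1⟧⟧ \in Z).
have [w [s [ws w0 EW]]] := center_line; set u := ⟦e1, e2⟧ in v1.
have E1 : (lc 1 <= <<[:: u]>> + lc 2)%VS.
  apply: (lc1_gen full); first exact: addvSr.
  move=> x y; rewrite !inE => /orP[] /eqP -> /orP[] /eqP ->; rewrite ?br_even_self ?mem0v //.
    by rewrite (subvP (addvSl _ _)) // memv_span1.
  by rewrite (brC e10 e20) // memvN (subvP (addvSl _ _)) // memv_span1.
have : (lc 2 <= D :&: Z)%VS.
  apply: (lcS_gen full _ E1 lc3Z) => [x|x y].
    by rewrite inE => /eqP ->; apply: derived_br.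
  rewrite !inE => /orP[] /eqP -> /eqP ->; rewrite memv_cap derived_br //.
  by move: v2; rewrite (brC e10 e20) // brNr memvN.
rewrite EW => l2; case/negP: (notspan2 u w).
by apply: subv_trans E1 _; rewrite span_cons !span_seq1 addvS.
Qed.

(** ** One even and one odd generator *)

Section Mixed.
Variables (e f : L).
Hypothesis e0 : e \in part L false.
Hypothesis f1 : f \in part L true.
Hypothesis full : spans [:: e; f].
Let s := ⟦e, f⟧.
Let h := ⟦f, f⟧.
Let s1 : s \in part L true. Proof. by have := bracket_part e0 f1. Qed.
Let h0 : h \in part L false. Proof. by have := bracket_part f1 f1. Qed.
Let sD : s \in D. Proof. exact: derived_br. Qed.
Let hD : h \in D. Proof. exact: derived_br. Qed.
Let fh : ⟦f, h⟧ = 0. Proof. exact: br_odd3. Qed.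
Let eh : ⟦e, h⟧ = 2%:R *: ⟦f, s⟧. Proof. exact: br_even_sq. Qed.

Lemma mixed_lc1 : (lc 1 <= <<[:: s; h]>> + lc 2)%VS.
Proof.
have sS : s \in (<<[:: s; h]>> + lc 2)%VS.
  by rewrite (subvP (addvSl _ _)) // memv_span // mem_head.
apply: (lc1_gen full); first exact: addvSr.
move=> x y; rewrite !inE => /orP[] /eqP -> /orP[] /eqP -> //.
- by rewrite br_even_self ?mem0v.
- by rewrite (brC e0 f1) // memvN.
by rewrite (subvP (addvSl _ _)) // memv_span // !inE eqxx orbT.
Qed.

Lemma mixed_lc2 : (lc 2 <= <<[:: ⟦e, s⟧; ⟦f, s⟧]>> + lc 3)%VS.
Proof.
have fs : ⟦f, s⟧ \in (<<[:: ⟦e, s⟧; ⟦f, s⟧]>> + lc 3)%VS.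
  by rewrite (subvP (addvSl _ _)) // memv_span // !inE eqxx orbT.
apply: (lcS_gen full _ mixed_lc1 (addvSr _ _)) => [x|x y].
  by rewrite !inE => /orP[] /eqP ->.
rewrite !inE => /orP[] /eqP -> /orP[] /eqP -> //.
- by rewrite (subvP (addvSl _ _)) // memv_span // mem_head.
- by rewrite eh memvZ.
by rewrite fh mem0v.
Qed.

(** Otherwise [[e, s]] and [[f, s]] vanish, and the series stops after [L^2]. *)
Lemma mixed_sZ : s \notin Z.
Proof.
apply/negP => sZ; apply: lc2_neq0; apply: (lc_stab nilL).
apply: subv_trans mixed_lc2 _; rewrite subv_add subvv andbT.
apply/span_subvP => x; rewrite !inE => /orP[] /eqP ->;
  by rewrite bracket_center ?mem0v.
Qed.

(** With [[f, f]] central, [L^2] is the chain [s = [e, f]], [v = [e, s]] and one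
    central vector, which is [[e, v]] if odd and [[s, s] = - [f, v]] if even. *)
Lemma mixed_chain : h \in Z ->
  factor lie_table_1_4_7 k l L \/ factor lie_table_2_3_23 k l L.
Proof.
move=> hZ; have [w [sw [ws w0 EW]]] := center_line.
have wZ : w \in Z by have := memv_line w; rewrite -EW memv_cap => /andP[].
have fs : ⟦f, s⟧ = 0.
  have /esym/eqP := eh; rewrite (bracket_center _ hZ) scaler_eq0 (negPf nz2).
  by move/eqP.
set v := ⟦e, s⟧; have v2 : v \in lc 2 by apply: lc_br.
have v1 : v \in part L true by have := bracket_part e0 s1.
have vD : v \in D by apply: derived_br.
have hW : h \in <[w]>%VS by rewrite -EW memv_cap hD.
have evW : ⟦e, v⟧ \in <[w]>%VS by rewrite -EW; apply: (subvP lc3Z); apply: lc_br.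
have ssW : ⟦s, s⟧ \in <[w]>%VS by rewrite -EW; apply: (subvP lc3Z); apply: lc1_br.
have fv : ⟦f, v⟧ = - ⟦s, s⟧.
  by rewrite (bracket_jacobi s f1 e0) fs br0r scaler0 addr0 (brC e0 f1) // brNl.
have sv : ⟦s, v⟧ = 0 by apply: D_lc2.
have vs : ⟦v, s⟧ = 0 by apply: lc2_D.
have vv : ⟦v, v⟧ = 0 by apply: D_lc2.
have vZ : v \notin Z.
  apply/negP => vZ; case/negP: (notspan2 s w).
  apply: subv_trans mixed_lc1 _; rewrite subv_add; apply/andP; split.
    apply/span_subvP => x; rewrite !inE => /orP[] /eqP ->.
      by rewrite memv_span // mem_head.
    by rewrite span_cons span_seq1 (subvP (addvSr _ _)).
  apply: subv_trans mixed_lc2 _; rewrite subv_add; apply/andP; split.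
    apply/span_subvP => x; rewrite !inE => /orP[] /eqP ->; last by rewrite fs mem0v.
    by rewrite span_cons span_seq1 (subvP (addvSr _ _)) // -EW memv_cap vD.
  by apply: subv_trans lc3Z _; rewrite EW span_cons span_seq1 addvSr.
have some : (⟦e, v⟧ != 0) || (⟦s, s⟧ != 0).
  apply/negPn/negP; rewrite negb_or !negbK => /andP[/eqP ev /eqP ss].
  case/negP: vZ; apply: (centralizer_gen nilL full v1) => x.
  by rewrite !inE => /orP[] /eqP -> //; rewrite fv ss oppr0.
have ev1 : ⟦e, v⟧ \in part L true by have := bracket_part e0 v1.
have ss0 : ⟦s, s⟧ \in part L false by have := bracket_part s1 s1.
have Wz x : x \in <[w]>%VS -> x \in part L (~~ sw) -> x = 0.
  by apply: homogeneous_eq0; rewrite -memvE.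
have ev2Z : ⟦e, v⟧ \in Z by case/vlineP: evW => c ->; rewrite memvZ.
have ss2Z : ⟦s, s⟧ \in Z by case/vlineP: ssW => c ->; rewrite memvZ.
case: sw ws Wz => ws Wz.
  have ss := Wz _ ssW ss0; have ff : h = 0 := Wz _ hW h0.
  rewrite ss oppr0 in fv; left.
  recognize_by nz2 nilL lie_table_1_4_7 [:: e] [:: ⟦e, v⟧; v; s; f] sL gd.
  - by rewrite pq dD.
  - apply: (spansW full) => x; rewrite !inE => /orP[] /eqP ->; apply: mem_spans;
      by rewrite /= !inE eqxx ?orbT.
  rewrite (brC_odd f1 s1) (brC_odd f1 v1) -/h -/s -/v.
  by rewrite ?(center_bracket _ ev2Z, bracket_center _ ev2Z, fs, fv, sv, vs, vv, ss, ff,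
    mulr1z, scale1r, addr0).
have ev := Wz _ evW ev1; rewrite ev eqxx /= in some.
have [c Ec] : exists c, h = c *: ⟦s, s⟧.
  case/vlineP: hW => c ->; case/vlineP: ssW some => d ->.
  rewrite scaler_eq0 negb_or => /andP[d0 _].
  by exists (c / d); rewrite scalerA divfK.
(* [f + r v, f + r v] = (c - 2 r) [s, s] *)
right; pose r := c / 2%:R; pose f' := f + r *: v.
have f'1 : f' \in part L true by rewrite rpredD ?rpredZ.
have ef' : ⟦e, f'⟧ = s by rewrite !brE ev scaler0 addr0.
have f'f' : ⟦f', f'⟧ = 0.
  rewrite !brE (brC_odd f1 v1) fv vv !scaler0 addr0 -/h Ec.
  rewrite !scalerN -!scaleNr -addrA -!scalerDl.
  suff -> : c + (- r + - r) = 0 by rewrite scale0r.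
  by rewrite /r; field.
have f's : ⟦s, f'⟧ = 0 by rewrite !brE (brC_odd f1 s1) fs sv scaler0 addr0.
have vf' : ⟦v, f'⟧ = - ⟦s, s⟧ by rewrite !brE (brC_odd f1 v1) fv vv scaler0 addr0.
recognize_by nz2 nilL lie_table_2_3_23 [:: e; ⟦s, s⟧] [:: v; s; f'] sL gd.
- by rewrite pq dD.
- apply: (spansW full) => x; rewrite !inE => /orP[] /eqP ->.
    by apply: mem_spans; rewrite /= !inE eqxx ?orbT.
  rewrite -[f](addrK (r *: v)) rpredB //; first by apply: mem_spans; rewrite /= !inE eqxx ?orbT.
  by rewrite rpredZ //; apply: derived_spans.
rewrite ?(center_bracket _ ss2Z, bracket_center _ ss2Z, ev, ef', f'f', f's, vf', vs, vv,
    mulr1z, scale1r, addr0).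
by conj_tac; rewrite intrN1 scaleN1r.
Qed.

(** [L^2] has the basis [s], [h] and a central [w]. As [ad e] is nilpotent, it maps
    [h] into the center and kills [s] if [w] is even; if [w] is odd, it kills [h],
    which would be central. *)
Lemma mixed_pair : h \notin Z -> factor lie_table_3_2_13 k l L.
Proof.
move=> hZ; have [w [sw [ws w0 EW]]] := center_line.
have wZ : w \in Z by have := memv_line w; rewrite -EW memv_cap => /andP[].
have wD : w \in D by have := memv_line w; rewrite -EW memv_cap => /andP[].
have h00 : h != 0 by apply: contraNneq hZ => ->; rewrite mem0v.
have s00 : s != 0 by apply: contraNneq mixed_sZ => ->; rewrite mem0v.
have free2 x : x \notin Z -> \dim <<[:: x; w]>> = 2%N.
  move=> xZ; have /eqP -> // : free [:: x; w].
  rewrite free_cons span_seq1 seq1_free w0 andbT.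
  by apply: contra xZ => /vlineP[c ->]; rewrite memvZ.
have dDs : (\dim (D :&: part L false) + \dim (D :&: part L true) = 3)%N.
  by rewrite -dD; apply: graded_dim (graded_derived L).
have ehD : ⟦e, h⟧ \in (D :&: part L false)%VS.
  by rewrite memv_cap derived_br; have := bracket_part e0 h0.
have nocenter : ⟦e, h⟧ = 0 -> False.
  move=> E; case/negP: hZ; apply: (centralizer_gen nilL full h0) => x.
  by rewrite !inE => /orP[] /eqP ->.
case: sw ws => ws.
  have sw : (<<[:: s; w]>> <= D :&: part L true)%VS.
    apply/span_subvP => x; rewrite !inE memv_cap => /orP[] /eqP ->.
      by rewrite sD s1.
    by rewrite wD ws.
  have := dimvS sw; rewrite free2 ?mixed_sZ // => d1.
  have E0 : (D :&: part L false = <[h]>)%VS.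
    apply/eqP; rewrite eq_sym eqEdim -memvE memv_cap hD h0 dim_vline h00.
    by clear -dDs d1; lia.
  have := ehD; rewrite E0 => /vlineP[c Ec]; case: nocenter.
  have [c0|c0] := eqVneq c 0; first by rewrite Ec c0 scale0r.
  have := @nil_eigen _ _ nilL e h c 0; rewrite addr0 => /(_ Ec (mem0v _) c0).
  by rewrite (negPf hZ).
have hw : (<<[:: h; w]>> <= D :&: part L false)%VS.
  apply/span_subvP => x; rewrite !inE memv_cap => /orP[] /eqP ->.
    by rewrite hD h0.
  by rewrite wD ws.
have := dimvS hw; rewrite free2 // => d0.
have sE : s \in (D :&: part L true)%VS by rewrite memv_cap sD s1.
have d1 : (0 < \dim (D :&: part L true))%N.
  by rewrite lt0n dimv_eq0; apply: contraNneq s00 => E; move: sE; rewrite E memv0.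
have E0 : (D :&: part L false = <<[:: h; w]>>)%VS.
  by apply/eqP; rewrite eq_sym eqEdim hw free2 //; clear -dDs d1; lia.
have E1 : (D :&: part L true = <[s]>)%VS.
  apply/eqP; rewrite eq_sym eqEdim -memvE sE dim_vline s00.
  by clear -dDs d0; lia.
have es : ⟦e, s⟧ = 0.
  have : ⟦e, s⟧ \in (D :&: part L true)%VS.
    by rewrite memv_cap derived_br; have := bracket_part e0 s1.
  rewrite E1 => /vlineP[c Ec]; have [c0|c0] := eqVneq c 0; first by rewrite Ec c0 scale0r.
  have := @nil_eigen _ _ nilL e s c 0; rewrite addr0 => /(_ Ec (mem0v _) c0).
  by rewrite (negPf mixed_sZ).
have [c Ec] : exists c, ⟦e, h⟧ = c *: w.
  have := ehD; rewrite E0 => /span2P[c [d Ecd]]; exists d.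
  have [c0|c0] := eqVneq c 0; first by rewrite Ecd c0 scale0r add0r.
  have := nil_eigen nilL Ecd (memvZ d wZ) c0; by rewrite (negPf hZ).
have fsE : ⟦f, s⟧ = 2%:R^-1 *: ⟦e, h⟧ by rewrite eh scalerK.
have fsZ : ⟦f, s⟧ \in Z by rewrite fsE Ec !memvZ.
have fs0 : ⟦f, s⟧ \in part L false by have := bracket_part f1 s1.
have ss : ⟦s, s⟧ = 0.
  rewrite {2}/s (bracket_jacobi f s1 e0) (brC e0 s1) // es oppr0 br0l add0r.
  by rewrite (brC_odd f1 s1) (bracket_center _ fsZ) scaler0.
have hs : ⟦h, s⟧ = 0.
  have : ⟦h, s⟧ \in (D :&: Z)%VS by apply: (subvP lc3Z); apply: lc1_br.
  rewrite EW => hsW; have := bracket_part h0 s1 => /= hs1.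
  case/vlineP: hsW hs1 => d -> hs1.
  by apply: part_cap0 hs1; rewrite rpredZ.
have hf : ⟦h, f⟧ = 0 by rewrite (brC f1 h0) // fh oppr0.
recognize_by nz2 nilL lie_table_3_2_13 [:: e; 2%:R^-1 *: h; ⟦f, s⟧] [:: s; f] sL gd.
- by rewrite pq dD.
- by rewrite rpredZ.
- apply: (spansW full) => x; rewrite !inE => /orP[] /eqP ->; apply: mem_spans;
    by rewrite /= !inE eqxx ?orbT.
rewrite (brC_odd f1 s1) ?(brZl, brZr) -/h -/s.
rewrite ?(center_bracket _ fsZ, bracket_center _ fsZ, es, ss, hs, hf, eh,
    mulr1z, scale1r, scaler0, addr0).
conj_tac; first by rewrite scalerK.
by rewrite intr2 scalerA mulfV // scale1r.
Qed.

Lemma dim3_mixed : [\/ factor lie_table_1_4_7 k l L, factor lie_table_2_3_23 k l L |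
  factor lie_table_3_2_13 k l L].
Proof.
have [/mixed_chain[]|/mixed_pair] := boolP (h \in Z).
- by apply: Or31.
- by apply: Or32.
by apply: Or33.
Qed.
End Mixed.

(** ** Two odd generators *)

Lemma dim3_odd_core f g : f \in part L true -> g \in part L true ->
    spans [:: f; g] -> lc 3 = 0%VS -> ⟦f, f⟧ = 0 -> factor lie_table_2_3_18 k l L.
Proof.
move=> f1 g1 full lc3 ff; have /subvP l2Z := lc_center lc3.
have DD x y : x \in D -> y \in D -> ⟦x, y⟧ = 0.
  by move=> xD yD; apply/eqP; rewrite -memv0 -lc3; apply: lc1_br.
have fg0 : ⟦f, g⟧ \in part L false by have := bracket_part f1 g1.
have gg0 : ⟦g, g⟧ \in part L false by have := bracket_part g1 g1.
set A := ⟦g, ⟦f, g⟧⟧; have AZ : A \in Z by apply: l2Z; apply: lc_br; apply: derived_br.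
have A1 : A \in part L true by have := bracket_part g1 fg0.
have ffg : ⟦⟦f, g⟧, f⟧ = 0.
  have := br_odd_sq f1 g1; rewrite ff br0r => /esym/eqP.
  rewrite oppr_eq0 scaler_eq0 (negPf nz2) /= => /eqP E.
  by rewrite (brC f1 fg0) // E oppr0.
have gfg : ⟦⟦f, g⟧, g⟧ = - A by rewrite (brC g1 fg0).
have ggg : ⟦⟦g, g⟧, g⟧ = 0 by rewrite (brC g1 gg0) // br_odd3 // oppr0.
have ggf : ⟦⟦g, g⟧, f⟧ = 2%:R *: A.
  by rewrite (brC f1 gg0) // (br_odd_sq g1 f1) opprK (brC_odd f1 g1).
have gf : ⟦g, f⟧ = ⟦f, g⟧ by rewrite (brC_odd f1 g1).
have ggfg : ⟦⟦g, g⟧, ⟦f, g⟧⟧ = 0 by apply: DD; apply: derived_br.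
recognize_by nz2 nilL lie_table_2_3_18 [:: 2%:R^-1 *: ⟦g, g⟧; - ⟦f, g⟧] [:: A; g; f] sL gd.
- by rewrite pq dD.
- by rewrite rpredZ.
- by rewrite rpredN.
- apply: (spansW full) => x; rewrite !inE => /orP[] /eqP ->; apply: mem_spans;
    by rewrite /= !inE eqxx ?orbT.
rewrite ?(center_bracket _ AZ, bracket_center _ AZ, brNl, brNr, brZl, brZr, ffg, gfg, ggg,
  ggf, gf, ff, ggfg, mulr1z, scale1r, scaler0, addr0, oppr0, opprK).
conj_tac; rewrite ?intr2 ?intrN1.
- by rewrite scalerK.
- by rewrite scalerA mulfV // scale1r.
by rewrite scaleN1r opprK.
Qed.

Lemma odd_lc2 f g : f \in part L true -> g \in part L true -> spans [:: f; g] ->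
  (lc 2 <= <<[:: ⟦g, ⟦f, g⟧⟧; ⟦f, ⟦f, g⟧⟧]>> + lc 3)%VS.
Proof.
move=> f1 g1 full; have gf := brC_odd f1 g1.
have E1 : (lc 1 <= <<[:: ⟦f, f⟧; ⟦f, g⟧; ⟦g, g⟧]>> + lc 2)%VS.
  apply: (lc1_gen full); first exact: addvSr.
  move=> x y; rewrite !inE => /orP[] /eqP -> /orP[] /eqP ->; rewrite ?gf;
    by rewrite (subvP (addvSl _ _)) // memv_span // !inE eqxx ?orbT.
apply: (lcS_gen full _ E1 (addvSr _ _)) => [x|x y].
  by rewrite !inE => /or3P[] /eqP ->; apply: derived_br.
have gfg : ⟦g, ⟦f, g⟧⟧ \in (<<[:: ⟦g, ⟦f, g⟧⟧; ⟦f, ⟦f, g⟧⟧]>> + lc 3)%VS.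
  by rewrite (subvP (addvSl _ _)) // memv_span // mem_head.
have ffg : ⟦f, ⟦f, g⟧⟧ \in (<<[:: ⟦g, ⟦f, g⟧⟧; ⟦f, ⟦f, g⟧⟧]>> + lc 3)%VS.
  by rewrite (subvP (addvSl _ _)) // memv_span // !inE eqxx orbT.
rewrite !inE => /orP[] /eqP -> /or3P[] /eqP -> //.
- by rewrite br_odd3 ?mem0v.
- by rewrite (br_odd_sq g1 f1) gf memvN memvZ.
- by rewrite (br_odd_sq f1 g1) memvN memvZ.
by rewrite br_odd3 ?mem0v.
Qed.

(** The trilinear map [[x, [y, z]]] on the odd generators is symmetric in [y], [z]
    with zero cyclic sum, so that it comes from a linear form; [f'] below spans the
    kernel of that form, and [[f', f']] is central, hence zero for odd [w]. *)
Lemma dim3_odd f g : f \in part L true -> g \in part L true -> spans [:: f; g] ->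
  factor lie_table_2_3_18 k l L.
Proof.
move=> f1 g1 full; have l2 := odd_lc2 f1 g1 full; have gf := brC_odd f1 g1.
have full' : spans [:: g; f].
  by apply: (spans_pair full); apply: mem_spans; rewrite !inE eqxx ?orbT.
have fg0 : ⟦f, g⟧ \in part L false by have := bracket_part f1 g1.
have [w [sw [ws w0 EW]]] := center_line.
have wZ : w \in Z by have := memv_line w; rewrite -EW memv_cap => /andP[].
have wD : w \in D by have := memv_line w; rewrite -EW memv_cap => /andP[].
set A := ⟦g, ⟦f, g⟧⟧ in l2; set B := ⟦f, ⟦f, g⟧⟧ in l2.
have A1 : A \in part L true by have := bracket_part g1 fg0.
have B1 : B \in part L true by have := bracket_part f1 fg0.
have AB : A = 0 -> B = 0 -> False.
  move=> A0 B0; apply: lc2_neq0; apply: (lc_stab nilL); apply: subv_trans l2 _.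
  rewrite A0 B0 subv_add subvv andbT; apply/span_subvP => x.
  by rewrite !inE orbb => /eqP ->; rewrite mem0v.
have gff : ⟦g, ⟦f, f⟧⟧ = - (2%:R *: B) by apply: br_odd_sq.
have fgg : ⟦f, ⟦g, g⟧⟧ = - (2%:R *: A) by rewrite (br_odd_sq g1 f1) gf.
have half x : - (2%:R *: x) = 0 :> L -> x = 0.
  by move/eqP; rewrite oppr_eq0 scaler_eq0 (negPf nz2) => /eqP.
case: sw ws => ws.
  have lc3 : lc 3 = 0%VS.
    apply/eqP; rewrite -subv0.
    apply: (lcS_gen full _ l2) => [x| |x y].
    - by rewrite !inE => /orP[] /eqP ->; apply: lc_br; apply: derived_br.
    - by rewrite lc4 sub0v.
    move=> xG yS; have x1 : x \in part L true by move: xG; rewrite !inE => /orP[] /eqP ->.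
    have [y1 y2] : y \in part L true /\ y \in lc 2.
      by move: yS; rewrite !inE => /orP[] /eqP ->; split=> //; apply: lc_br; apply: derived_br.
    have : ⟦x, y⟧ \in (D :&: Z)%VS by apply: (subvP lc3Z); apply: lc_br.
    rewrite EW memv0 => /vlineP[c E]; have := bracket_part x1 y1 => /= xy0.
    by apply/eqP; apply: (part_cap0 xy0); rewrite E rpredZ.
  have /subvP l2Z := lc_center lc3.
  have inW x : x \in lc 2 -> exists c, x = c *: w.
    move=> x2; apply/vlineP; rewrite -EW memv_cap l2Z // andbT.
    exact: (subvP (lc_sub L 1)).
  have [a Ea] : exists a, A = a *: w by apply: inW; apply: lc_br; apply: derived_br.
  have [b Eb] : exists b, B = b *: w by apply: inW; apply: lc_br; apply: derived_br.
  (* with A = a w and B = b w, both ad f and ad g kill [f', f'] *)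
  pose f' := a *: f + b *: g.
  have f'1 : f' \in part L true by rewrite rpredD ?rpredZ.
  have f'f' : ⟦f', f'⟧ = 0.
    have E : ⟦f', f'⟧ = a ^+ 2 *: ⟦f, f⟧ + (2%:R * a * b) *: ⟦f, g⟧ + b ^+ 2 *: ⟦g, g⟧.
      rewrite !brE gf !scalerDr !scalerA -!expr2 [b * a]mulrC addrA; congr (_ + _).
      by rewrite -addrA -scalerDl; congr (_ + _ *: _); ring.
    have ff0 : ⟦f', f'⟧ \in part L false by have := bracket_part f'1 f'1.
    have ffZ : ⟦f', f'⟧ \in Z.
      apply: (centralizer_gen nilL full ff0) => x; rewrite !inE E => /orP[] /eqP ->.
        rewrite !brE (br_odd3 nz3 f1) fgg -/B Ea Eb scaler0 add0r -scaleNr !scalerA -scalerDl.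
        by rewrite (_ : _ + _ = 0) ?scale0r //; ring.
      rewrite !brE (br_odd3 nz3 g1) gff -/A Ea Eb scaler0 addr0 -scaleNr !scalerA -scalerDl.
      by rewrite (_ : _ + _ = 0) ?scale0r //; ring.
    have : ⟦f', f'⟧ \in (D :&: Z)%VS by rewrite memv_cap derived_br.
    by rewrite EW => /vlineP[c Ec]; apply: (part_cap0 ff0); rewrite Ec rpredZ.
  have [a0|a0] := eqVneq a 0.
    have b0 : b != 0.
      apply/eqP => b0; apply: AB; first by rewrite Ea a0 scale0r.
      by rewrite Eb b0 scale0r.
    apply: (dim3_odd_core f'1 f1 _ lc3 f'f').
    apply: (spans_pair full); first by apply: mem_spans; rewrite !inE eqxx ?orbT.
    have -> : g = b^-1 *: f' by rewrite /f' a0 scale0r add0r scalerK.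
    by rewrite rpredZ //; apply: mem_spans; rewrite !inE eqxx.
  apply: (dim3_odd_core f'1 g1 _ lc3 f'f').
  apply: (spans_pair full); last by apply: mem_spans; rewrite !inE eqxx ?orbT.
  have -> : f = a^-1 *: (f' - b *: g) by rewrite /f' addrK scalerK.
  by rewrite rpredZ // rpredB // ?rpredZ //; apply: mem_spans; rewrite !inE eqxx ?orbT.
(* an even center of L^2 leaves room for one even bracket only *)
exfalso.
have dDs : (\dim (D :&: part L false) + \dim (D :&: part L true) = 3)%N.
  by rewrite -dD; apply: graded_dim (graded_derived L).
have d1 : (0 < \dim (D :&: part L true))%N.
  rewrite lt0n dimv_eq0; apply/eqP => E.
  have in0 x : x \in D -> x \in part L true -> x = 0.
    by move=> xD x1; apply/eqP; rewrite -memv0 -E memv_cap xD.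
  by apply: AB; apply: in0 => //; apply: derived_br.
have sq x y : x \in part L true -> y \in part L true -> spans [:: x; y] ->
    ⟦x, x⟧ \notin Z -> False.
  move=> x1 y1 fullxy xxZ.
  have xx0 : ⟦x, x⟧ \in part L false by have := bracket_part x1 x1.
  have xy0 : ⟦x, y⟧ \in part L false by have := bracket_part x1 y1.
  have xw : (<<[:: ⟦x, x⟧; w]>> <= D :&: part L false)%VS.
    apply/span_subvP => z; rewrite !inE memv_cap => /orP[] /eqP ->.
      by rewrite derived_br xx0.
    by rewrite wD ws.
  have f2 : \dim <<[:: ⟦x, x⟧; w]>> = 2%N.
    have /eqP -> // : free [:: ⟦x, x⟧; w].
    rewrite free_cons span_seq1 seq1_free w0 andbT.
    by apply: contra xxZ => /vlineP[c ->]; rewrite memvZ.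
  have E0 : (D :&: part L false = <<[:: ⟦x, x⟧; w]>>)%VS.
    by apply/eqP; rewrite eq_sym eqEdim xw f2; clear -dDs d1; lia.
  have : ⟦x, y⟧ \in (D :&: part L false)%VS by rewrite memv_cap derived_br.
  rewrite E0 => /span2P[c [d E]]; case/negP: xxZ.
  apply: (centralizer_gen nilL fullxy xx0) => z; rewrite !inE => /orP[] /eqP ->.
    exact: br_odd3.
  rewrite (br_odd_sq x1 y1) E !brE (br_odd3 nz3 x1) (bracket_center _ wZ).
  by rewrite !scaler0 addr0 scaler0 oppr0.
have [ffZ|/(sq _ _ f1 g1 full) //] := boolP (⟦f, f⟧ \in Z).
have [ggZ|/(sq _ _ g1 f1 full') //] := boolP (⟦g, g⟧ \in Z).
apply: AB; apply: half; first by rewrite -fgg bracket_center.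
by rewrite -gff bracket_center.
Qed.

End ThreeDim.

(** * Heisenberg superalgebras *)

Lemma free_labels (F : fieldType) (L : lieSuperalg F) (x : label -> L) (S : seq label) :
    uniq S -> (forall c : label -> F, \sum_(i <- S) c i *: x i = 0 ->
      forall i, i \in S -> c i = 0) ->
  free [seq x i | i <- S].
Proof.
elim: S => [|i S IH] /=; first by rewrite nil_free.
case/andP=> iS uS H; rewrite free_cons; apply/andP; split.
  apply/negP => /(span_mapP uS)[c E].
  have := H (fun j => if j == i then -1 else c j); rewrite big_cons eqxx.
  have -> : \sum_(j <- S) (if j == i then -1 else c j) *: x j = x i.
    rewrite E; apply: eq_big_seq => j jS; case: eqP => // ji.
    by move: iS; rewrite -ji jS.
  rewrite scaleN1r addNr => /(_ erefl i (mem_head _ _)); rewrite eqxx => /eqP.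
  by rewrite oppr_eq0 oner_eq0.
apply: (IH uS) => c E j jS.
have := H (fun j => if j == i then 0 else c j); rewrite big_cons eqxx scale0r add0r.
have -> : \sum_(j <- S) (if j == i then 0 else c j) *: x j = 0.
  rewrite -[RHS]E; apply: eq_big_seq => j' jS'; case: eqP => // ji.
  by move: iS; rewrite -ji jS'.
move=> /(_ erefl j); rewrite inE jS orbT => /(_ isT).
by case: eqP => // ji; move: iS; rewrite -ji jS.
Qed.

Section Heisenberg.
Variables (F : fieldType) (L : lieSuperalg F).
Hypothesis nz2 : (2%:R : F) != 0.
Implicit Types (x y z : L).
Local Notation Z := (center L).
Local Notation D := (derived L).
Variables (w : L) (s : bool).
Hypothesis ws : w \in part L s.
Hypothesis w0 : w != 0.
Hypothesis wZ : w \in Z.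
Hypothesis Dw : (D <= <[w]>)%VS.

(** The bracket as a bilinear form with values in the line of [w]. *)
Definition brform x y : F := coord [tuple w] ord0 ⟦x, y⟧.

Lemma brformE x y : ⟦x, y⟧ = brform x y *: w.
Proof.
have : ⟦x, y⟧ \in <<[tuple w]>>%VS by rewrite span_seq1 (subvP Dw) // derived_br.
by move/coord_span; rewrite big_ord1.
Qed.

Lemma brformDl x y z : brform (x + y) z = brform x z + brform y z.
Proof. by rewrite /brform brDl linearD. Qed.
Lemma brformDr x y z : brform z (x + y) = brform z x + brform z y.
Proof. by rewrite /brform brDr linearD. Qed.
Lemma brformNl x z : brform (- x) z = - brform x z.
Proof. by rewrite /brform brNl linearN. Qed.
Lemma brformZl c x z : brform (c *: x) z = c * brform x z.
Proof. by rewrite /brform brZl linearZ. Qed.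
Lemma brformZr c x z : brform z (c *: x) = c * brform z x.
Proof. by rewrite /brform brZr linearZ. Qed.
Lemma brform_suml m (E : 'I_m -> L) z : brform (\sum_i E i) z = \sum_i brform (E i) z.
Proof. by rewrite /brform br_suml linear_sum. Qed.
Lemma brform_eq0 x y : ⟦x, y⟧ = 0 -> brform x y = 0.
Proof. by rewrite /brform => ->; rewrite linear0. Qed.

Lemma brform_parity a b x y : x \in part L a -> y \in part L b -> a (+) b != s ->
  brform x y = 0.
Proof.
move=> xa yb ab; apply: brform_eq0; have := bracket_part xa yb.
have : ⟦x, y⟧ \in part L s by rewrite brformE memvZ.
move: ab; case: (a (+) b); case: (s) => // _ H1 H2; first exact: part_cap0 H1 H2.
exact: part_cap0 H2 H1.
Qed.

Lemma brform_skew a x y : x \in part L false -> y \in part L a -> brform y x = - brform x y.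
Proof. by move=> xs ya; rewrite /brform (brC xs ya) // linearN. Qed.

Lemma brform_odd x y : x \in part L true -> y \in part L true -> brform y x = brform x y.
Proof. by move=> xs ya; rewrite /brform (brC_odd xs ya). Qed.

Lemma brform_center a x : x \in part L a ->
  (forall b y, y \in part L b -> a (+) b = s -> brform x y = 0) -> x \in Z.
Proof.
move=> xa H; rewrite memv_ker; apply/eqP/lfunP => y; rewrite zero_lfunE.
have [y0 [y1 [L0 L1 ->]]] := part_decomp y; rewrite brDr.
have h b z : z \in part L b -> ⟦x, z⟧ = 0.
  move=> zb; rewrite brformE; have [E|ab] := eqVneq (a (+) b) s.
    by rewrite (H b) // scale0r.
  by rewrite (brform_parity xa zb ab) scale0r.
by rewrite (h _ _ L0) (h _ _ L1) addr0.
Qed.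

(** Dual systems: even vectors [X i] paired with vectors [Y i] of the parity of
    [w]. For even [w] these are hyperbolic pairs of the alternating form on the
    even part, for odd [w] dual vectors of the two parts. *)
Definition dual_system m (X Y : nat -> L) : Prop :=
  [/\ forall i, (i < m)%N -> X i \in part L false,
      forall i, (i < m)%N -> Y i \in part L s &
      forall i j, (i < m)%N -> (j < m)%N ->
        [/\ brform (X i) (Y j) = (i == j)%:R, brform (X i) (X j) = 0 & brform (Y i) (Y j) = 0]].

(** The projection to the orthogonal complement; the second sum has the opposite
    sign because [Y i] and [X i] pair to [-1] in this order. *)
Definition project m (X Y : nat -> L) x : L :=
  x - \sum_(i < m) brform x (Y i) *: X i + \sum_(i < m) brform x (X i) *: Y i.

Fact project_linear m X Y : linear (project m X Y).
Proof.
move=> c x y; rewrite /project scalerDr scalerBr !scaler_sumr.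
have E1 (U V : nat -> L) : \sum_(i < m) brform (c *: x + y) (U i) *: V i =
    \sum_(i < m) c *: (brform x (U i) *: V i) + \sum_(i < m) brform y (U i) *: V i.
  rewrite -big_split; apply: eq_bigr => i _.
  by rewrite brformDl brformZl scalerDl scalerA.
by rewrite !E1 opprD [X in X + _ = _]addrACA [LHS]addrACA.
Qed.
HB.instance Definition _ m X Y :=
  GRing.isLinear.Build F L L *:%R (project m X Y) (project_linear m X Y).

Section System.
Variables (m : nat) (X Y : nat -> L).
Hypothesis dXY : dual_system m X Y.

Lemma dual_YX i j : (i < m)%N -> (j < m)%N -> brform (Y i) (X j) = - (i == j)%:R.
Proof.
move=> im jm; have [X0 Ys B] := dXY.
by rewrite (brform_skew (X0 j jm) (Ys i im)); have [-> _ _] := B j i jm im; rewrite eq_sym.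
Qed.

Lemma project_Y x j : (j < m)%N -> brform (project m X Y x) (Y j) = 0.
Proof.
have [X0 Ys B] := dXY; move=> jm; rewrite brformDl brformDl brformNl !brform_suml.
rewrite (bigD1 (Ordinal jm)) //= [X in _ + X]big1 => [|i _]; last first.
  by rewrite brformZl; have [_ _ ->] := B i j (ltn_ord i) jm; rewrite mulr0.
rewrite [X in _ - (_ + X)]big1 => [|i ij]; last first.
  rewrite brformZl; have [-> _ _] := B i j (ltn_ord i) jm.
  have /negPf -> : (i : nat) != j by apply: contra ij => /eqP E; apply/eqP/val_inj.
  by rewrite mulr0.
rewrite brformZl; have [-> _ _] := B j j jm jm.
by rewrite eqxx mulr1 !addr0 subrr.
Qed.

Lemma project_X x j : (j < m)%N -> brform (project m X Y x) (X j) = 0.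
Proof.
have [X0 Ys B] := dXY; move=> jm; rewrite brformDl brformDl brformNl !brform_suml.
rewrite [X in _ - X]big1 => [|i _]; last first.
  by rewrite brformZl; have [_ -> _] := B i j (ltn_ord i) jm; rewrite mulr0.
rewrite (bigD1 (Ordinal jm)) //= big1 => [|i ij]; last first.
  rewrite brformZl dual_YX //.
  have /negPf -> : (i : nat) != j by apply: contra ij => /eqP E; apply/eqP/val_inj.
  by rewrite oppr0 mulr0.
by rewrite brformZl dual_YX // eqxx mulrN1 subr0 addr0 subrr.
Qed.

Lemma project_part a x : x \in part L a -> project m X Y x \in part L a.
Proof.
have [X0 Ys _] := dXY; move=> xa; rewrite rpredD ?rpredB //; apply: memv_suml => i _.
  have [E|ne] := eqVneq (a (+) s) s.
    have -> : a = false by apply: (@addIb s); rewrite E.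
    by rewrite memvZ // X0.
  by rewrite (brform_parity xa (Ys i _)) // scale0r mem0v.
have [E|ne] := eqVneq (a (+) false) s.
  by rewrite memvZ // -[a]addbF E Ys.
by rewrite (brform_parity xa (X0 i _)) // scale0r mem0v.
Qed.

Lemma dual_size : (m <= \dim {:L})%N.
Proof.
have [_ _ B] := dXY; have fX : free [tuple X i | i < m].
  have XE (i : 'I_m) : [tuple X i | i < m]`_i = X i by rewrite -tnth_nth tnth_mktuple.
  apply/freeP => c; under eq_bigr do rewrite XE.
  move=> E j; have := congr1 (fun z => brform z (Y j)) E.
  rewrite brform_suml (brform_eq0 (br0l _)) (bigD1 j) //= big1 => [|i ij].
    rewrite brformZl; have [-> _ _] := B j j (ltn_ord j) (ltn_ord j).
    by rewrite eqxx mulr1 addr0.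
  rewrite brformZl; have [-> _ _] := B i j (ltn_ord i) (ltn_ord j).
  have /negPf -> : (i : nat) != j by apply: contra ij => /eqP E'; apply/eqP/val_inj.
  by rewrite mulr0.
move: fX; rewrite /free size_tuple => /eqP {1}<-.
exact: dimvS (subvf _).
Qed.

(** A maximal dual system is found by adding pairs as long as the form does not
    vanish on the orthogonal complement. *)
Lemma dual_extend x y : x \in part L false -> y \in part L s ->
    brform (project m X Y x) (project m X Y y) != 0 ->
  exists X' Y', dual_system m.+1 X' Y'.
Proof.
set x' := project m X Y x; set y' := project m X Y y => x0 ys c0.
have [X0 Ys B] := dXY; have x'0 : x' \in part L false by apply: project_part.
have y's : y' \in part L s by apply: project_part.
pose y'' := (brform x' y')^-1 *: y'.
have y''s : y'' \in part L s by rewrite memvZ.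
have xy : brform x' y'' = 1 by rewrite brformZr mulVf.
have yy : brform y'' y'' = 0.
  case E: s y''s => ys'; last by rewrite brform_eq0 // br_even_self.
  by rewrite (brform_parity ys' ys') // E.
have xx : brform x' x' = 0 by rewrite brform_eq0 // br_even_self.
have xX i : (i < m)%N -> brform x' (X i) = 0 by apply: project_X.
have xY i : (i < m)%N -> brform x' (Y i) = 0 by apply: project_Y.
have yX i : (i < m)%N -> brform y'' (X i) = 0 by move=> im; rewrite brformZl project_X // mulr0.
have yY i : (i < m)%N -> brform y'' (Y i) = 0 by move=> im; rewrite brformZl project_Y // mulr0.
have Yx i : (i < m)%N -> brform (X i) x' = 0.
  by move=> im; rewrite (brform_skew x'0 (X0 i im)) xX // oppr0.
have Xy i : (i < m)%N -> brform (X i) y'' = 0.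
  move=> im; have := brform_skew (X0 i im) y''s; rewrite yX // => /esym/eqP.
  by rewrite oppr_eq0 => /eqP.
have Yy i : (i < m)%N -> brform (Y i) y'' = 0.
  move=> im; have Yi := Ys i im; case E: s Yi y''s => Yi ys'.
    by rewrite (brform_odd ys' Yi) yY.
  by rewrite (brform_skew ys' Yi) yY // oppr0.
exists (fun i => if i == m then x' else X i), (fun i => if i == m then y'' else Y i).
split=> [i|i|i j]; rewrite !ltnS (leq_eqVlt i).
- by case: eqP => //= _ /X0.
- by case: eqP => //= _ /Ys.
rewrite (leq_eqVlt j); case: eqP => [->|im] /= Hi; case: eqP => [->|jm] /= Hj.
- by rewrite eqxx.
- by rewrite xX // xY // yY // eq_sym; case: eqP jm.
- by rewrite Yx // Xy // Yy //; case: eqP im.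
exact: B.
Qed.
End System.

(** A dual system whose orthogonal complement is isotropic. *)
Definition radical_system m X Y : Prop := dual_system m X Y /\
  forall x y, x \in part L false -> y \in part L s ->
    brform (project m X Y x) (project m X Y y) = 0.

Lemma dual_step m X Y : dual_system m X Y ->
  radical_system m X Y \/ exists X' Y', dual_system m.+1 X' Y'.
Proof.
move=> dXY; pose pr := project m X Y.
have [/allP H|/allPn[x xL /allPn[y yL n0]]] := boolP (all (fun x => all (fun y =>
    brform (pr x) (pr y) == 0) (vbasis (part L s))) (vbasis (part L false))); last first.
  by right; apply: (dual_extend dXY _ _ n0); apply: vbasis_mem.
left; split=> // x y x0 ys; apply: brform_eq0; apply/eqP; rewrite -memv0.
have img (U : {vspace L}) z : z \in U -> pr z \in <<map pr (vbasis U)>>%VS.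
  move=> zU; rewrite /pr -[project m X Y z]lfunE.
  have -> : map (project m X Y) (vbasis U) = map (linfun (project m X Y)) (vbasis U).
    by apply: eq_map => z'; rewrite lfunE.
  by rewrite -limg_span memv_img // (span_basis (vbasisP U)).
apply: span_brv (img _ _ x0) (img _ _ ys) => _ _ /mapP[x' xL ->] /mapP[y' yL ->].
by rewrite memv0 brformE (eqP (allP (H x' xL) y' yL)) scale0r.
Qed.

Lemma radical_system_exists : exists m X Y, radical_system m X Y.
Proof.
have start : dual_system 0 (fun _ => 0) (fun _ => 0) by split.
suff H n m X Y : dual_system m X Y -> (\dim {:L} - m < n)%N ->
    exists m X Y, radical_system m X Y.
  exact: H start (ltnSn _).
elim: n m X Y => // n IH m X Y dXY mn.
case: (dual_step dXY) => [r|[X' [Y' d']]]; first by exists m, X, Y.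
apply: (IH _ _ _ d'); move: mn (dual_size d'); clear; lia.
Qed.

(** The orthogonal complement of a maximal dual system is central, up to the
    odd part when [w] is even. *)
Lemma radical_center m X Y a x : radical_system m X Y -> x \in part L a ->
  (a = false \/ a = s) -> project m X Y x \in Z.
Proof.
move=> [dXY H] xa as0; have xp := project_part dXY xa.
apply: (brform_center xp) => b y yb ab.
have -> : y = project m X Y y + (\sum_(i < m) brform y (Y i) *: X i -
    \sum_(i < m) brform y (X i) *: Y i).
  by rewrite addrA /project -!addrA (addrC (\sum_(i < m) _ *: Y i)) !addrA !subrK.
rewrite brformDr; set px := project m X Y x in xp *.
have -> : brform px (\sum_(i < m) brform y (Y i) *: X i - \sum_(i < m) brform y (X i) *: Y i) = 0.
  rewrite brformDr -scaleN1r brformZr /brform !br_sumr !linear_sum /=.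
  rewrite !big1 ?mulr0 ?addr0 // => i _; rewrite brZr linearZ /=.
    by rewrite -/(brform px _) /px project_Y // mulr0.
  by rewrite -/(brform px _) /px project_X // mulr0.
rewrite addr0; case: as0 => E; rewrite E in xa ab.
  by apply: H => //; rewrite -ab.
have b0 : b = false by apply: (@addbI s); rewrite ab addbF.
rewrite b0 in yb; have yp := project_part dXY yb.
by rewrite (brform_skew yp xp) H ?oppr0.
Qed.

End Heisenberg.

Arguments brform_eq0 {F L w x y}.
Arguments brform_odd {F L w x y}.
Arguments brform_skew {F L w a x y}.

(** ** The tables of the Heisenberg superalgebras *)

Lemma eq_elabel i j : (elabel i == elabel j) = (i == j).
Proof. by apply/eqP/eqP => [[]|->]. Qed.
Lemma eq_flabel i j : (flabel i == flabel j) = (i == j).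
Proof. by apply/eqP/eqP => [[]|->]. Qed.

Lemma sum_iota_eq m i : \sum_(i' <- iota 1 m) ((i == i') : nat)%:Z = ((0 < i <= m)%N : nat)%:Z.
Proof.
have [im|im] := boolP (i \in iota 1 m).
  rewrite (bigD1_seq i) ?iota_uniq //= eqxx big1 => [|i' ne].
    by move: im; rewrite mem_iota add1n ltnS => ->.
  by rewrite eq_sym (negPf ne).
rewrite big1_seq => [|i' /= i'm]; first by move: im; rewrite mem_iota add1n ltnS => /negPf ->.
by case: eqP => // E; rewrite E i'm in im.
Qed.

Section HeisTables.
Variables m n : nat.
Local Notation ze := (elabel (2 * m).+1).
Local Notation zo := (flabel m.+1).

Lemma coef_H_ee i j : (0 < i < j)%N ->
  coef (table_H m n) (elabel i) (elabel j) ze = (((i <= m) && (j == m + i))%N : nat)%:Z.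
Proof.
case/andP=> i0 ij; rewrite /coef big_cat !big_map /= [X in _ + X]big1 ?addr0 => [|i' _].
  transitivity (\sum_(i' <- iota 1 m) ((i == i') : nat)%:Z * ((j == m + i)%N : nat)%:Z).
    apply: eq_bigr => i' _; rewrite eqxx /= !eq_elabel.
    case: (eqVneq i i') => [<-|ne] /=; last first.
      by rewrite mul0r; case: andP => // -[/eqP Ei /eqP Ej]; move: ij; lia.
    rewrite mul1r; case: eqP => // _; have -> : (j == i) = false by apply/eqP; lia.
    by rewrite andbF.
  by rewrite -mulr_suml sum_iota_eq i0 /=; case: (i <= m)%N; rewrite ?mul1r ?mul0r.
by rewrite eqxx.
Qed.

Lemma coef_H_ff i j : (0 < i <= n)%N -> (0 < j)%N ->
  coef (table_H m n) (flabel i) (flabel j) ze = ((i == j) : nat)%:Z.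
Proof.
move=> i0 j0; rewrite /coef big_cat !big_map /= big1 ?add0r => [|i' _]; last by rewrite eqxx.
transitivity (\sum_(i' <- iota 1 n) ((i == i') : nat)%:Z * ((i == j) : nat)%:Z).
  apply: eq_bigr => i' _; rewrite eqxx /= !eq_flabel.
  case: (eqVneq i i') => [<-|ne] /=; rewrite ?mul1r ?mul0r //.
  by rewrite [i == j]eq_sym; case: eqP.
by rewrite -mulr_suml sum_iota_eq i0 mul1r.
Qed.

Lemma coef_Hodd_ef i j : (0 < i)%N -> (0 < j)%N ->
  coef (table_Hodd m) (elabel i) (flabel j) zo = (((i == j) && (i <= m))%N : nat)%:Z.
Proof.
move=> i0 j0; rewrite /coef big_map /=.
transitivity (\sum_(i' <- iota 1 m) ((i == i') : nat)%:Z * ((i == j) : nat)%:Z).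
  apply: eq_bigr => i' _; rewrite eqxx /= !eq_elabel !eq_flabel.
  case: (eqVneq i i') => [<-|ne] /=; rewrite ?mul1r ?mul0r //.
  by rewrite eq_sym; case: eqP.
by rewrite -mulr_suml sum_iota_eq i0 /=; case: (i <= m)%N; rewrite ?mul1r ?mul0r ?andbT ?andbF.
Qed.

Definition single_value (t : table) (z0 : label) := all (fun r => r.2 == z0) t.

Lemma single_H : single_value (table_H m n) ze.
Proof. by apply/allP => r; rewrite mem_cat => /orP[] /mapP[i _ ->]; rewrite /= eqxx. Qed.

Lemma single_Hodd : single_value (table_Hodd m) zo.
Proof. by apply/allP => r /mapP[i _ ->]; rewrite /= eqxx. Qed.

End HeisTables.

Section Small.
Variables (F : fieldType) (L : lieSuperalg F).
Local Notation Z := (center L).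
Local Notation D := (derived L).
Local Notation N := (cogen L).

Lemma single_sum a b t z0 (x : label -> L) i j : single_value t z0 ->
    z0 \in labels a b ->
  \sum_(k <- labels a b) (coef t i j k)%:~R *: x k = (coef t i j z0)%:~R *: x z0.
Proof.
move=> /allP st zl; rewrite (bigD1_seq z0) ?uniq_labels //= big1 ?addr0 // => k kz.
rewrite /coef big_seq big1 ?scale0r // => -[[[x1 y1] c1] z1] /st /= /eqP ->.
by rewrite kz.
Qed.

Lemma single_derived a b t z0 (x : label -> L) : single_value t z0 ->
    z0 \in labels a b -> realizes a b t x -> (\dim D <= 1)%N.
Proof.
move=> st zl [_ xb _ xZ]; suff s : (D <= <[x z0]>)%VS.
  by apply: leq_trans (dimvS s) _; rewrite dim_vline; case: (_ != 0).
apply: brv_subP => u v; rewrite -xZ => /memv_addP[u' uX [z zZ ->]].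
move=> /memv_addP[v' vX [z' zZ' ->]].
rewrite brDl !brDr !(center_bracket _ zZ) !(bracket_center _ zZ') !addr0.
apply: span_brv uX vX => _ _ /mapP[i il ->] /mapP[j jl ->].
by rewrite xb // (single_sum _ _ _ st zl) memvZ // memv_line.
Qed.

End Small.

Section Heisenberg2.
Variables (F : fieldType) (L : lieSuperalg F).
Hypothesis nz2 : (2%:R : F) != 0.
Implicit Types (x y z : L).
Local Notation Z := (center L).
Local Notation D := (derived L).
Variables (w : L).
Hypothesis w0 : w != 0.
Hypothesis wZ : w \in Z.
Hypothesis Dw : (D <= <[w]>)%VS.
Local Notation form := (brform w).

Lemma brform_bracket0 x y : form x y = 0 -> ⟦x, y⟧ = 0.
Proof. by rewrite (brformE Dw) => ->; rewrite scale0r. Qed.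

(** The pairing with a basis of [L_b] modulo its central part, [b = a + s], has the
    central part of [L_a] as kernel; used for both values of [a] it shows that the
    pairing of even with odd elements is perfect modulo the center. *)
Lemma brform_rank s a : w \in part L s ->
  (\dim (part L a) + \dim (part L (a (+) s) :&: Z) <=
   \dim (part L (a (+) s)) + \dim (part L a :&: Z))%N.
Proof.
move=> ws; set b := a (+) s; set C := (part L b :\: Z)%VS.
pose phi (x : L) : 'rV[F]_(\dim C) := \row_j form x (vbasis C)`_j.
have phil : linear phi.
  by move=> c x y; apply/rowP => j; rewrite !mxE brformDl brformZl.
pose ph : {linear L -> 'rV[F]_(\dim C)} :=
  HB.pack phi (GRing.isLinear.Build F L 'rV[F]_(\dim C) *:%R phi phil).
have phE x : linfun ph x = phi x by rewrite lfunE.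
have := limg_ker_dim (linfun ph) (part L a).
have ker : (part L a :&: lker (linfun ph) <= part L a :&: Z)%VS.
  apply/subvP => x; rewrite !memv_cap memv_ker phE => /andP[xa /eqP/rowP x0].
  rewrite xa /=; apply: (brform_center ws Dw xa) => b' y yb ab.
  have {ab} Eb : b' = b by rewrite /b -ab addKb.
  rewrite Eb in yb; move: yb; rewrite -(addv_diff_cap (part L b) Z) -/C.
  case/memv_addP=> c cC [z]; rewrite memv_cap => /andP[_ zZ] ->.
  rewrite brformDr (brform_eq0 (bracket_center _ zZ)) addr0.
  apply: brform_eq0; rewrite -(span_basis (vbasisP C)) in cC.
  apply/eqP; rewrite -memv0; apply: span_brv (memv_span1 x) cC => x' c'.
  rewrite inE => /eqP -> /(nthP 0)[j]; rewrite size_tuple => jC <-.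
  by have := x0 (Ordinal jC); rewrite !mxE memv0 => /brform_bracket0 ->.
have im : (\dim (linfun ph @: part L a) <= \dim C)%N.
  by apply: leq_trans (dimvS (subvf _)) _; rewrite dimvf -[X in (_ <= X)%N]mul1n.
have := dimvS ker; have := dimv_cap_compl (part L b) Z; rewrite -/C.
move: im (\dim (part L a :&: lker (linfun ph))).
by move: (\dim (linfun ph @: part L a)) => A; clear; lia.
Qed.

Lemma odd_realizes : w \in part L true ->
  exists m (x : label -> L), realizes m m.+1 (table_Hodd m) x.
Proof.
move=> w1; have [m [X [Y rXY]]] := radical_system_exists nz2 w1 Dw.
have [dXY _] := rXY; have [X0 Y1 B] := dXY.
pose x (l : label) : L := match l with
  inl i => X i.-1 | inr j => if (j <= m)%N then Y j.-1 else w end.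
exists m, x.
have xp : {in labels m m.+1, forall i, x i \in part L (parity i)}.
  move=> i /labelsP[[j|j] ->] /=; first exact: X0.
  by case: ifP => // jm; apply: Y1.
have zl : flabel m.+1 \in labels m m.+1 by apply/labelsP; exists (inr ord_max).
have xz : x (flabel m.+1) = w by rewrite /= ltnn.
have par i j : i \in labels m m.+1 -> j \in labels m m.+1 ->
    parity i = parity j -> ⟦x i, x j⟧ = 0.
  move=> il jl pij; apply: brform_bracket0.
  apply: (brform_parity w1 Dw (xp i il) (xp j jl)); by rewrite pij addbb.
have rel : table_rel m m.+1 (table_Hodd m) x.
  apply: (pairs_rel nz2 (lie_table_Hodd m) xp) => -[i j] ij /=.
  rewrite (single_sum _ _ _ (single_Hodd m) zl) xz.
  have gt : graded_table (table_Hodd m) by have /andP[] := lie_table_Hodd m.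
  case: (mem_label_pairs ij) => -[i' [j' [i'm j'm [-> ->]]]].
  - rewrite coef_graded // scale0r; apply: par => //; apply/labelsP.
      by exists (inl (Ordinal (ltn_trans i'm j'm))).
    by exists (inl (Ordinal j'm)).
  - rewrite coef_Hodd_ef // (brformE Dw) /=; case: ifP => bm'.
      have [-> _ _] := B i' j' i'm bm'; rewrite eqSS i'm andbT.
      by case: eqP.
    rewrite (brform_eq0 (bracket_center _ wZ)) scale0r.
    by rewrite eqSS; case: eqP => [E|]; rewrite ?scale0r //; move: bm'; rewrite -E i'm.
  rewrite coef_graded // scale0r; apply: par => //; apply/labelsP.
    by exists (inr (Ordinal (leq_ltn_trans i'm j'm))).
  by exists (inr (Ordinal j'm)).
have Sx l : l \in labels m m.+1 -> x l \in <<[seq x i | i <- labels m m.+1]>>%VS.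
  by move=> ll; rewrite memv_span // map_f.
have XS (i : 'I_m) : X i \in <<[seq x i | i <- labels m m.+1]>>%VS.
  by apply: (Sx (elabel i.+1)); apply/labelsP; exists (inl i).
have YS (i : 'I_m) : Y i \in <<[seq x i | i <- labels m m.+1]>>%VS.
  have := Sx (flabel i.+1); rewrite /= ltn_ord; apply; apply/labelsP.
  by exists (inr (widen_ord (leqnSn m) i)).
split=> //.
  apply: free_labels (uniq_labels _ _) _ => c E.
  have pairX (i : 'I_m) : c (elabel i.+1) = 0.
    have := congr1 (fun z => form z (Y i)) E.
    rewrite /= (brform_eq0 (br0l _)) sum_labels /= big_sumType /= brformDl !brform_suml.
    rewrite [X in _ + X]big1 => [|j _]; last first.
      rewrite brformZl; case: ifP => jm; last by rewrite (brform_eq0 (center_bracket _ wZ)) mulr0.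
      by have [_ _ ->] := B j i jm (ltn_ord i); rewrite mulr0.
    rewrite (bigD1 i) //= big1 => [|j ji].
      rewrite brformZl; have [-> _ _] := B i i (ltn_ord i) (ltn_ord i).
      by rewrite eqxx mulr1 !addr0.
    rewrite brformZl; have [-> _ _] := B j i (ltn_ord j) (ltn_ord i).
    by rewrite (inj_eq val_inj) (negPf ji) mulr0.
  have pairY (i : 'I_m) : c (flabel i.+1) = 0.
    have := congr1 (fun z => form z (X i)) E.
    rewrite /= (brform_eq0 (br0l _)) sum_labels /= big_sumType /= brformDl !brform_suml.
    rewrite [X in X + _]big1 => [|j _]; last first.
      by rewrite brformZl; have [_ -> _] := B j i (ltn_ord j) (ltn_ord i); rewrite mulr0.
    rewrite add0r big_ord_recr /= ltnn brformZl (brform_eq0 (center_bracket _ wZ)) mulr0 addr0.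
    rewrite (bigD1 i) //= big1 => [|j ji].
      rewrite ltn_ord brformZl (dual_YX dXY) //.
      by rewrite eqxx mulrN1 addr0 => /eqP; rewrite oppr_eq0 => /eqP.
    rewrite ltn_ord brformZl (dual_YX dXY) //.
    by rewrite (inj_eq val_inj) (negPf ji) oppr0 mulr0.
  have cz : c (flabel m.+1) = 0.
    move: E; rewrite sum_labels /= big_sumType /= big1 => [|j _]; last by rewrite pairX scale0r.
    rewrite add0r big_ord_recr /= ltnn big1 => [|j _]; last by rewrite pairY scale0r.
    by rewrite add0r => /eqP; rewrite scaler_eq0 (negPf w0) orbF => /eqP.
  move=> i /labelsP[[j|j] ->] /=; first exact: pairX.
  have [jm|jm] := ltnP j m; first exact: (pairY (Ordinal jm)).
  by have -> : j = m :> nat by have := ltn_ord j; lia.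
apply/eqP; rewrite -subvf_eq; apply/subvP => u _.
suff H a y : y \in part L a -> y \in (<<[seq x i | i <- labels m m.+1]>> + Z)%VS.
  by have [u0 [u1 [/H L0 /H L1 ->]]] := part_decomp u; rewrite rpredD.
move=> ya; have pZ : project w m X Y y \in Z.
  by apply: (radical_center w1 Dw rXY ya); case: a ya; [right | left].
have -> : y = (\sum_(i < m) form y (Y i) *: X i - \sum_(i < m) form y (X i) *: Y i) +
    project w m X Y y.
  by rewrite addrC /project -!addrA (addrC (\sum_(i < m) _ *: Y i)) !addrA !subrK.
by rewrite memv_add // memvB //; apply: memv_suml => i _; rewrite memvZ.
Qed.

End Heisenberg2.

(** ** Even center: orthonormal odd vectors *)

Section EvenCenter.
Variables (F : fieldType) (L : lieSuperalg F).
Hypothesis nz2 : (2%:R : F) != 0.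
Implicit Types (x y z : L).
Local Notation Z := (center L).
Local Notation D := (derived L).
Variables (w : L).
Hypothesis ws : w \in part L false.
Hypothesis w0 : w != 0.
Hypothesis wZ : w \in Z.
Hypothesis Dw : (D <= <[w]>)%VS.
Local Notation form := (brform w).

Definition orthonormal n (f : nat -> L) : Prop :=
  (forall i, (i < n)%N -> f i \in part L true) /\
  (forall i j, (i < n)%N -> (j < n)%N -> form (f i) (f j) = (i == j)%:R).

Definition orth n (f : nat -> L) x : L := x - \sum_(i < n) form x (f i) *: f i.

Fact orth_linear n f : linear (orth n f).
Proof.
move=> c x y; rewrite /orth scalerBr !scaler_sumr.
have -> : \sum_(i < n) form (c *: x + y) (f i) *: f i =
    \sum_(i < n) c *: (form x (f i) *: f i) + \sum_(i < n) form y (f i) *: f i.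
  rewrite -big_split; apply: eq_bigr => i _.
  by rewrite brformDl brformZl scalerDl scalerA.
by rewrite opprD addrACA.
Qed.
HB.instance Definition _ n f :=
  GRing.isLinear.Build F L L *:%R (orth n f) (orth_linear n f).

Section System.
Variables (n : nat) (f : nat -> L).
Hypothesis onf : orthonormal n f.

Lemma orth_form x j : (j < n)%N -> form (orth n f x) (f j) = 0.
Proof.
have [f1 B] := onf; move=> jn; rewrite brformDl brformNl !brform_suml.
rewrite (bigD1 (Ordinal jn)) //= big1 => [|i ij]; rewrite brformZl B //.
  by rewrite eqxx mulr1 addr0 subrr.
have /negPf -> : (i : nat) != j by apply: contra ij => /eqP E; apply/eqP/val_inj.
by rewrite mulr0.
Qed.

Lemma orth_part x : x \in part L true -> orth n f x \in part L true.
Proof.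
have [f1 B] := onf; move=> x1; rewrite memvB //; apply: memv_suml => i _.
by rewrite memvZ // f1.
Qed.

Lemma orthonormal_size : (n <= \dim {:L})%N.
Proof.
have [f1 B] := onf; have fX : free [tuple f i | i < n].
  have fE (i : 'I_n) : [tuple f i | i < n]`_i = f i by rewrite -tnth_nth tnth_mktuple.
  apply/freeP => c; under eq_bigr do rewrite fE.
  move=> E j; have := congr1 (fun z => form z (f j)) E.
  rewrite brform_suml (brform_eq0 (br0l _)) (bigD1 j) //= big1 => [|i ij].
    by rewrite brformZl B // eqxx mulr1 addr0.
  by rewrite brformZl B // (inj_eq val_inj) (negPf ij) mulr0.
move: fX; rewrite /free size_tuple => /eqP {1}<-.
exact: dimvS (subvf _).
Qed.

(** A symmetric form with a nonzero value has a nonzero diagonal value, which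
    is made 1 by extracting a square root. *)
Lemma orthonormal_extend x y : square_closed F -> x \in part L true ->
    y \in part L true -> form (orth n f x) (orth n f y) != 0 ->
  exists f', orthonormal n.+1 f'.
Proof.
move=> sq x1 y1 c0; have [f1 B] := onf.
have [z z1 z0] : exists2 z, z \in part L true & form (orth n f z) (orth n f z) != 0.
  have [xx|] := eqVneq (form (orth n f x) (orth n f x)) 0; last by exists x.
  have [yy|] := eqVneq (form (orth n f y) (orth n f y)) 0; last by exists y.
  exists (x + y); first by rewrite memvD.
  rewrite linearD /=; move: xx yy c0 (orth_part x1) (orth_part y1).
  move: (orth n f x) (orth n f y) => u v xx yy c0 u1 v1.
  rewrite brformDl !brformDr xx yy add0r addr0 (brform_odd u1 v1).
  by rewrite -mulr2n -mulr_natl mulf_neq0.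
have [d dE] := sq (form (orth n f z) (orth n f z)).
have d0 : d != 0 by apply: contraNneq z0 => E; rewrite -dE E expr0n.
pose z' := d^-1 *: orth n f z.
have z'1 : z' \in part L true by rewrite memvZ // orth_part.
have zz : form z' z' = 1 by rewrite brformZl brformZr -dE expr2 mulKf // mulVf.
have zf i : (i < n)%N -> form z' (f i) = 0 by move=> i_n; rewrite brformZl orth_form // mulr0.
exists (fun i => if i == n then z' else f i).
split=> [i|i j]; rewrite !ltnS (leq_eqVlt i).
  by case: eqP => //= _ /f1.
rewrite (leq_eqVlt j); case: eqP => [->|i_n] /= Hi; case: eqP => [->|jn] /= Hj.
- by rewrite eqxx.
- by rewrite zf // eq_sym; case: eqP jn.
- by rewrite (brform_odd z'1 (f1 i Hi)) zf //; case: eqP i_n.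
exact: B.
Qed.
End System.

Lemma orthonormal_exists : square_closed F -> exists n f, orthonormal n f /\
  forall x y, x \in part L true -> y \in part L true ->
    form (orth n f x) (orth n f y) = 0.
Proof.
move=> sq; have start : orthonormal 0 (fun _ => 0) by split.
suff H b n f : orthonormal n f -> (\dim {:L} - n < b)%N -> exists n f, orthonormal n f /\
    forall x y, x \in part L true -> y \in part L true -> form (orth n f x) (orth n f y) = 0.
  exact: H start (ltnSn _).
elim: b n f => // b IH n f onf nb; pose pr := orth n f.
have [/allP H|/allPn[x xL /allPn[y yL n0]]] := boolP (all (fun x => all (fun y =>
    form (pr x) (pr y) == 0) (vbasis (part L true))) (vbasis (part L true))); last first.
  have [f' on'] := orthonormal_extend onf sq (vbasis_mem xL) (vbasis_mem yL) n0.
  by apply: (IH _ _ on'); have := orthonormal_size on'; lia.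
exists n, f; split=> // x y x1 y1; apply: brform_eq0; apply/eqP; rewrite -memv0.
have img z : z \in part L true -> pr z \in <<map pr (vbasis (part L true))>>%VS.
  move=> zU; rewrite /pr -[orth n f z]lfunE.
  have -> : map (orth n f) (vbasis (part L true)) =
      map (linfun (orth n f)) (vbasis (part L true)).
    by apply: eq_map => z'; rewrite lfunE.
  by rewrite -limg_span memv_img // (span_basis (vbasisP _)).
apply: span_brv (img _ x1) (img _ y1) => _ _ /mapP[x' xL ->] /mapP[y' yL ->].
by rewrite memv0 (brformE Dw) (eqP (allP (H x' xL) y' yL)) scale0r.
Qed.

Lemma even_realizes : square_closed F ->
  exists m n (x : label -> L), realizes (2 * m).+1 n (table_H m n) x.
Proof.
move=> sq; have [m [X [Y rXY]]] := radical_system_exists nz2 ws Dw.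
have [dXY _] := rXY; have [X0 Y0 B] := dXY.
have [n [f [onf fH]]] := orthonormal_exists sq; have [f1 Bf] := onf.
pose x (l : label) : L := match l with
  | inl i => if (i <= m)%N then X i.-1 else if (i <= 2 * m)%N then Y (i - m).-1 else w
  | inr j => f j.-1 end.
exists m, n, x; set a := (2 * m).+1.
have xp : {in labels a n, forall i, x i \in part L (parity i)}.
  move=> i /labelsP[[j|j] ->] /=; last exact: f1.
  case: ifP => jm; first exact: X0.
  by case: ifP => // jm2; apply: Y0; lia.
have zl : elabel a \in labels a n by apply/labelsP; exists (inl ord_max).
have xz : x (elabel a) = w.
  by rewrite /= /a; case: ifP => [|_]; [lia | case: ifP => //; lia].
have zwl y : form w y = 0 by rewrite (brform_eq0 (center_bracket _ wZ)).
have zwr y : form y w = 0 by rewrite (brform_eq0 (bracket_center _ wZ)).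
have gt : graded_table (table_H m n) by have /andP[] := lie_table_H m n.
have rel : table_rel a n (table_H m n) x.
  apply: (pairs_rel nz2 (lie_table_H m n) xp) => -[i j] ij /=.
  rewrite (single_sum _ _ _ (single_H m n) zl) xz (brformE Dw); congr (_ *: _).
  case: (mem_label_pairs ij) => -[i' [j' [i'm j'm [-> ->]]]].
  - rewrite coef_H_ee ?ltnS // /=; case: (ltnP i' m) => im; case: (ltnP j' m) => jm.
    + have [_ -> _] := B i' j' im jm.
      by case: eqP => //; lia.
    + case: ifP => jm2.
        have jm' : ((j'.+1 - m).-1 < m)%N by lia.
        have [-> _ _] := B i' _ im jm'; rewrite /=.
        by case: eqP; case: eqP => //; lia.
      by rewrite zwr; case: eqP => //; lia.
    + lia.
    rewrite /=; case: ifP => im2; last by rewrite zwl.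
    case: ifP => jm2; last by rewrite zwr.
    have im' : ((i'.+1 - m).-1 < m)%N by lia.
    have jm' : ((j'.+1 - m).-1 < m)%N by lia.
    by have [_ _ ->] := B _ _ im' jm'.
  - rewrite coef_graded //.
    have il : elabel i'.+1 \in labels a n by apply/labelsP; exists (inl (Ordinal i'm)).
    have jl : flabel j'.+1 \in labels a n by apply/labelsP; exists (inr (Ordinal j'm)).
    exact: (brform_parity ws Dw (xp _ il) (xp _ jl)).
  have i'n := leq_ltn_trans i'm j'm.
  by rewrite coef_H_ff //= Bf // eqSS; case: eqP.
have Sx l : l \in labels a n -> x l \in <<[seq x i | i <- labels a n]>>%VS.
  by move=> ll; rewrite memv_span // map_f.
have XE (i : 'I_m) : X i = x (elabel i.+1) by rewrite /= ltn_ord.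
have YE (i : 'I_m) : Y i = x (elabel (m + i).+1).
  have im := ltn_ord i; rewrite /=; case: ifP => [|_]; first lia.
  by case: ifP => [_|]; [congr Y; lia | lia].
have Xl (i : 'I_m) : elabel i.+1 \in labels a n.
  have im : (i < a)%N by have := ltn_ord i; rewrite /a; lia.
  by apply/labelsP; exists (inl (Ordinal im)).
have Yl (i : 'I_m) : elabel (m + i).+1 \in labels a n.
  have im : (m + i < a)%N by have := ltn_ord i; rewrite /a; lia.
  by apply/labelsP; exists (inl (Ordinal im)).
have fl (j : 'I_n) : flabel j.+1 \in labels a n by apply/labelsP; exists (inr j).
split=> //.
  apply: free_labels (uniq_labels _ _) _ => c E.
  (* pairing the relation with a basis vector leaves a single coefficient *)
  have pairing l l' : l \in labels a n -> l' \in labels a n -> form (x l) (x l') != 0 ->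
      {in labels a n, forall l2, l2 != l -> form (x l2) (x l') = 0} -> c l = 0.
    move=> ll ll' n0 H; have := congr1 (fun z => form z (x l')) E.
    rewrite /= (brform_eq0 (br0l _)).
    have -> : form (\sum_(i <- labels a n) c i *: x i) (x l') =
        \sum_(i <- labels a n) c i * form (x i) (x l').
      rewrite /brform br_suml linear_sum /=; apply: eq_bigr => i _.
      by rewrite brZl linearZ.
    rewrite (bigD1_seq l) ?uniq_labels //= big1_seq => [|i /andP[il iL]].
      by rewrite addr0 => /eqP; rewrite mulf_eq0 (negPf n0) orbF => /eqP.
    by rewrite H // mulr0.
  have eo i j : (i < a)%N -> (j < n)%N -> form (x (elabel i.+1)) (x (flabel j.+1)) = 0 /\
      form (x (flabel j.+1)) (x (elabel i.+1)) = 0.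
    move=> ia jn.
    have il : elabel i.+1 \in labels a n by apply/labelsP; exists (inl (Ordinal ia)).
    have jl : flabel j.+1 \in labels a n by apply/labelsP; exists (inr (Ordinal jn)).
    split; first exact: (brform_parity ws Dw (xp _ il) (xp _ jl)).
    exact: (brform_parity ws Dw (xp _ jl) (xp _ il)).
  have evens (l2 : 'I_a) : [\/ exists i : 'I_m, l2.+1 = i.+1,
      exists i : 'I_m, l2.+1 = (m + i).+1 | l2.+1 = a].
    have l2a := ltn_ord l2; have [im|im] := ltnP l2 m.
      by apply: Or31; exists (Ordinal im).
    have [im2|im2] := ltnP l2 (2 * m).
      have im3 : (l2 - m < m)%N by lia.
      by apply: Or32; exists (Ordinal im3) => /=; lia.
    by apply: Or33; move: (l2 : nat) l2a im2 => l3; rewrite /a; lia.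
  have cX (i : 'I_m) : c (elabel i.+1) = 0.
    apply: (pairing _ (elabel (m + i).+1)) => //.
      rewrite -XE -YE; have [-> _ _] := B i i (ltn_ord i) (ltn_ord i).
      by rewrite eqxx oner_eq0.
    move=> _ /labelsP[[l2|l2] ->] ne; last first.
      have mia : (m + i < a)%N by have := ltn_ord i; rewrite /a; lia.
      by have [_ ->] := eo _ _ mia (ltn_ord l2).
    move: ne; rewrite /olab eq_elabel -YE.
    case: (evens l2) => [[i' ->]|[i' ->]|->] ne; rewrite -?XE -?YE ?xz ?zwl //.
      have [-> _ _] := B i' i (ltn_ord i') (ltn_ord i).
      by move: ne; rewrite eqSS => /negPf ->.
    by have [_ _ ->] := B i' i (ltn_ord i') (ltn_ord i).
  have cY (i : 'I_m) : c (elabel (m + i).+1) = 0.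
    apply: (pairing _ (elabel i.+1)) => //.
      rewrite -XE -YE (dual_YX dXY) //.
      by rewrite eqxx oppr_eq0 oner_eq0.
    move=> _ /labelsP[[l2|l2] ->] ne; last first.
      have ia : (i < a)%N by have := ltn_ord i; rewrite /a; lia.
      by have [_ ->] := eo _ _ ia (ltn_ord l2).
    move: ne; rewrite /olab eq_elabel -XE.
    case: (evens l2) => [[i' ->]|[i' ->]|->] ne; rewrite -?XE -?YE ?xz ?zwl //.
      by have [_ -> _] := B i' i (ltn_ord i') (ltn_ord i).
    rewrite (dual_YX dXY) //.
    by move: ne; rewrite eqSS eqn_add2l => /negPf ->; rewrite oppr0.
  have cf (j : 'I_n) : c (flabel j.+1) = 0.
    apply: (pairing _ (flabel j.+1)) => //.
      by rewrite /= Bf // eqxx oner_eq0.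
    move=> _ /labelsP[[l2|l2] ->] ne; first by have [->] := eo l2 j (ltn_ord l2) (ltn_ord j).
    move: ne; rewrite /olab eq_flabel eqSS /= Bf //.
    by move=> /negPf ->.
  have cz : c (elabel a) = 0.
    move: E; rewrite (bigD1_seq (elabel a)) ?uniq_labels //= -/(x (elabel a)) xz big1_seq.
      by rewrite addr0 => /eqP; rewrite scaler_eq0 (negPf w0) orbF => /eqP.
    move=> l3 /andP[ne /labelsP[[l2|l2] E]]; rewrite E in ne *; last by rewrite cf scale0r.
    move: ne; rewrite /olab; case: (evens l2) => [[i' ->]|[i' ->]|->]; last by rewrite eqxx.
      by rewrite cX scale0r.
    by rewrite cY scale0r.
  move=> _ /labelsP[[l2|l2] ->]; last exact: cf.
  by rewrite /olab; case: (evens l2) => [[i' ->]|[i' ->]|->].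
apply/eqP; rewrite -subvf_eq; apply/subvP => u _.
have [u0 [u1 [L0 L1 ->]]] := part_decomp u; apply: rpredD.
  have pZ : project w m X Y u0 \in Z.
    by apply: (radical_center ws Dw rXY L0); left.
  have -> : u0 = (\sum_(i < m) form u0 (Y i) *: X i - \sum_(i < m) form u0 (X i) *: Y i) +
      project w m X Y u0.
    by rewrite addrC /project -!addrA (addrC (\sum_(i < m) _ *: Y i)) !addrA !subrK.
  rewrite memv_add // memvB //; apply: memv_suml => i _; rewrite memvZ //.
    by rewrite XE Sx.
  by rewrite YE Sx.
have op := orth_part onf L1.
have pZ : orth n f u1 \in Z.
  apply: (brform_center ws Dw op) => b y yb; case: b yb => // y1 _.
  have -> : y = orth n f y + \sum_(i < n) form y (f i) *: f i by rewrite subrK.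
  rewrite brformDr fH // add0r /brform br_sumr linear_sum big1 //= => i _.
  by rewrite brZr linearZ /= -/(form (orth n f u1) (f i)) (orth_form onf) // mulr0.
have -> : u1 = \sum_(i < n) form u1 (f i) *: f i + orth n f u1 by rewrite addrC subrK.
by rewrite memv_add //; apply: memv_suml => i _; rewrite memvZ // (Sx (flabel i.+1)).
Qed.

End EvenCenter.

(** * The classification *)

(** The total [t] of st is [(d-1)(r-1) + (z-1)], with [d] generators of
    [L/Z(L)], [r = dim L^2] and [z = dim (L^2 cap Z(L))]. *)
Lemma total_cases d r z t : (d * r + z = t + d + r)%N -> (t <= 2)%N ->
    (z <= r)%N -> ((0 < r) -> (0 < z))%N -> ((1 < r) -> (1 < d))%N ->
  ((r <= 1)%N /\ t = 0%N) \/
  [\/ [/\ t = 1, d = 2, r = 2 & z = 1]%N, [/\ t = 2, d = 2, r = 2 & z = 2]%N,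
      [/\ t = 2, d = 3, r = 2 & z = 1]%N | [/\ t = 2, d = 2, r = 3 & z = 1]%N].
Proof.
move=> E t2 zr z0 d1; case: (leqP r 1) => r1; [left | right].
  by split=> //; case: r E zr z0 {d1} r1 => [|[|//]]; lia.
have {}d1 := d1 r1; have {}z0 : (0 < z)%N by apply: z0; lia.
have E' : (d.-1 * r.-1 + z.-1 = t)%N.
  by case: d d1 E => // d _; case: r r1 zr => // r _ _; case: z z0 => // z _; rewrite /= mulSn mulnS; lia.
have d3 : (d <= 3)%N.
  rewrite leqNgt; apply/negP => d4; have : (3 * 1 <= d.-1 * r.-1)%N by rewrite leq_mul //; lia.
  lia.
have r3 : (r <= 3)%N.
  rewrite leqNgt; apply/negP => r4; have : (1 * 3 <= d.-1 * r.-1)%N by rewrite leq_mul //; lia.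
  lia.
case: d d1 d3 E' {E} => [|[|[|[|d]]]] // _ _; case: r r1 r3 zr => [|[|[|[|r]]]] // _ _ zr E'.
- case: z zr z0 E' => [|[|[|z]]] // _ _ E'.
  + by apply: Or41; split; lia.
  by apply: Or42; split; lia.
- by apply: Or44; split; lia.
- by apply: Or43; split; lia.
by exfalso; lia.
Qed.

Section Small.
Variables (F : fieldType) (L : lieSuperalg F).
Hypothesis nilL : nilpotent_lie L.
Local Notation Z := (center L).
Local Notation D := (derived L).
Local Notation N := (cogen L).
Local Notation lc := (lower_central L).

(** The last nonzero term of the lower central series lies in both. *)
Lemma center_meets : (0 < \dim D)%N -> (0 < \dim (D :&: Z))%N.
Proof.
move=> D0; have exn : exists n, lc n == 0%VS by have [n E] := nilL; exists n; rewrite E.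
have [n /eqP lcn minn] := ex_minnP exn.
have n2 : (1 < n)%N.
  rewrite ltnNge; apply/negP => n1; have := lc_le L n1; rewrite lcn subv0.
  by rewrite -dimv_eq0 -[lc 1]/D; move: D0; rewrite lt0n => /negPf ->.
case: n n2 lcn minn => // n n1 lcn minn.
have le : (lc n <= D :&: Z)%VS by rewrite subv_cap (lc_center lcn) andbT; exact: (@lc_le _ L 1 n n1).
apply: leq_trans (dimvS le); rewrite lt0n dimv_eq0.
by apply/negP => /minn; rewrite ltnn.
Qed.

Lemma small_central : (\dim D <= 1)%N -> (D <= Z)%VS.
Proof. by move=> d1; rewrite -[D]/(lc 1); apply: lc_center; apply: (lc_vanish nilL). Qed.

(** Here [L^2] is central and [N = Z(L)]. For an odd [L^2] the equality [p = q] is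
    the perfectness of the pairing [brform_rank]. *)
Lemma small_st p q (gd : gen_dims L p q) : (\dim D <= 1)%N -> st L p q = (0, 0).
Proof.
move=> d1; have DZ := small_central d1.
have EN : N = Z by apply/addv_idPr.
have Emeet s : meet_dim L s = derived_dim L s.
  by rewrite /meet_dim /derived_dim (capv_idPl DZ).
apply/(st_dims _ _ gd); rewrite !Emeet.
have [g0 g1] := gd; rewrite EN in g0 g1; have ds := derived_dim_sum L.
case: (posnP (\dim D)) => [D0|D1].
  have Zf : Z = fullv.
    apply/eqP; rewrite -subvf_eq; apply: (lc_center (n := 0)).
    by apply/eqP; rewrite -dimv_eq0 -[lc 1]/D D0.
  rewrite Zf !capfv in g0 g1.
  have [-> ->] : derived_dim L false = 0%N /\ derived_dim L true = 0%N by lia.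
  by split; lia.
have dD : \dim D = 1%N by lia.
have [w [s [ws w0 ED]]] := graded_line (graded_derived L) dD.
have Dw : (D <= <[w]>)%VS by rewrite ED.
have ddE : derived_dim L s = 1%N.
  rewrite /derived_dim (capv_idPl _) ?dD // ED -memvE //.
case: s ws ddE => ws ddE.
  have d0 : derived_dim L false = 0%N by lia.
  have r0 := brform_rank Dw false ws; have r1 := brform_rank Dw true ws.
  rewrite /= ![(part L _ :&: Z)%VS]capvC in r0 r1.
  rewrite d0 ddE; have -> : p = q by lia.
  by split; lia.
have d0 : derived_dim L true = 0%N by lia.
by rewrite d0 ddE; split; lia.
Qed.

End Small.

(** An abelian algebra is covered too: any nonzero homogeneous [w] makes it a
    Heisenberg superalgebra without pairs plus an abelian one. *)
Lemma heisenberg_list (F : fieldType) (L : lieSuperalg F) k l :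
    (2%:R : F) != 0 -> nilpotent_lie L -> sdim L = (k, l) -> (1 <= k + l)%N ->
    (\dim (derived L) <= 1)%N -> square_closed F ->
  (exists m n : nat, (2 * m + 1 <= k)%N /\ (n <= l)%N /\
     lie_iso L (lie_sum (heis_even F m n) (abelian_alg F (k - 2 * m - 1) (l - n)))) \/
  (exists m : nat, (m <= k)%N /\ (m + 1 <= l)%N /\
     lie_iso L (lie_sum (heis_odd F m) (abelian_alg F (k - m) (l - m - 1)))).
Proof.
move=> nz2 nilL sL kl d1 sq; have DZ := small_central nilL d1.
have [w [s [ws w0 wZ Dw]]] : exists w s, [/\ w \in part L s, w != 0, w \in center L & (derived L <= <[w]>)%VS].
  case: (posnP (\dim (derived L))) => [D0|D1].
    have D00 : derived L = 0%VS by apply/eqP; rewrite -dimv_eq0 D0.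
    have Zf : (fullv <= center L)%VS by apply: (lc_center (n := 0)).
    have [s s0] : exists s, part L s != 0%VS.
      case: sL => Ek El; case: (posnP k) => [k0|k0]; [exists true | exists false];
        by rewrite -dimv_eq0 ?Ek ?El; lia.
    exists (vpick (part L s)), s; rewrite memv_pick vpick0 s0 D00 sub0v.
    by split=> //; apply: (subvP Zf); apply: memvf.
  have dD : \dim (derived L) = 1%N by lia.
  have [w [s [ws w0 ED]]] := graded_line (graded_derived L) dD.
  exists w, s; split=> //; last by rewrite ED.
  by apply: (subvP DZ); rewrite ED memv_line.
case: s ws => ws; [right | left].
  have [m [x xR]] := odd_realizes nz2 w0 wZ Dw ws.
  have [mk ml iso] := realizes_iso (lie_table_Hodd m) sL xR.
  exists m; split=> //; split; first by rewrite addn1.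
  by rewrite -subnDA addn1.
have [m [n [x xR]]] := even_realizes nz2 ws w0 wZ Dw sq.
have [mk ml iso] := realizes_iso (lie_table_H m n) sL xR.
exists m, n; split; first by rewrite addn1.
by split=> //; rewrite -subnDA addn1.
Qed.

Section Classification.
Variables (F : fieldType) (L : lieSuperalg F).
Hypothesis nz2 : (2%:R : F) != 0.
Hypothesis nz3 : (3%:R : F) != 0.
Hypothesis nilL : nilpotent_lie L.
Implicit Types (x y z : L) (G S : seq L).
Local Notation Z := (center L).
Local Notation D := (derived L).
Local Notation N := (cogen L).
Local Notation lc := (lower_central L).
Local Notation spans G := ((<<G>> + N)%VS = fullv).
Variables (k l p q : nat).
Hypothesis sL : sdim L = (k, l).
Hypothesis gd : gen_dims L p q.

Variables X Y : seq L.
Hypothesis gXY : gen_pair X Y.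
Hypothesis sX : size X = p.
Hypothesis sY : size Y = q.

Lemma gens_homogeneous g : g \in X ++ Y -> homogeneous g.
Proof.
by have [X0 Y1 _] := gXY; rewrite mem_cat => /orP[/X0|/Y1]; [exists false | exists true].
Qed.

Lemma many_gens : (1 < \dim D)%N -> (1 < p + q)%N.
Proof.
move=> D1; have [_ _ full] := gXY; rewrite ltnNge; apply/negP => d1.
have sG : size (X ++ Y) = (p + q)%N by rewrite size_cat sX sY.
have hG := gens_homogeneous; move: full sG hG; case: (X ++ Y) => [|g [|g' G]] full sG hG.
- by have := derived_0gen nilL full; lia.
- have [s gs] := hG g (mem_head _ _).
  by have := derived_1gen nz2 nz3 nilL gs full; lia.
by move: sG d1; rewrite /= => <-.
Qed.

Lemma two_gens : (p + q = 2)%N ->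
  [\/ exists e e', [/\ e \in part L false, e' \in part L false & spans [:: e; e']],
      exists e f, [/\ e \in part L false, f \in part L true & spans [:: e; f]] |
      [/\ p = 0, q = 2 & exists f g, [/\ f \in part L true, g \in part L true & spans [:: f; g]]]%N].
Proof.
have [X0 Y1 full] := gXY; move: X0 Y1 full sX sY.
case: X => [|e [|e' [|e'' X']]]; case: Y => [|f [|f' [|f'' Y']]] X0 Y1 full /= <- <- // _.
- apply: Or33; split=> //; exists f, f'; split=> //; apply: Y1; rewrite !inE eqxx ?orbT //.
- by apply: Or32; exists e, f; split=> //; [apply: X0 | apply: Y1]; rewrite !inE eqxx.
by apply: Or31; exists e, e'; split=> //; apply: X0; rewrite !inE eqxx ?orbT.
Qed.

(** Two odd generators with central brackets: all of [L^2] is even. *)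
Lemma odd_central_st f g : p = 0%N -> q = 2%N -> f \in part L true -> g \in part L true ->
  spans [:: f; g] -> \dim D = 2%N -> \dim (D :&: Z) = 2%N -> st L p q = (0, 2).
Proof.
move=> p0 q2 f1 g1 full dD dDZ.
have D0 : (D <= part L false)%VS.
  apply: (lc1_gen full); first by rewrite (central_lc2 dD dDZ) sub0v.
  move=> x y xG yG.
  have x1 : x \in part L true by move: xG; rewrite !inE => /orP[] /eqP ->.
  have y1 : y \in part L true by move: yG; rewrite !inE => /orP[] /eqP ->.
  by have := bracket_part x1 y1.
have d0 : derived_dim L false = 2%N by rewrite /derived_dim (capv_idPl D0).
have d1 : derived_dim L true = 0%N by have := derived_dim_sum L; lia.
have z1 : meet_dim L true = 0%N by have := meet_dim_le L true; lia.
have z0 : meet_dim L false = 2%N by have := meet_dim_sum L; lia.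
by apply/(st_dims _ _ gd); rewrite p0 q2 d0 d1 z0 z1.
Qed.

(** For [p = 0], [q = 2] and a central [L^2] the isomorphism class needs square
    roots, but st does not; the alternative records its value. *)
Lemma classification a b : st L p q = (a%:Z, b%:Z) -> (a + b <= 2)%N ->
  [\/ (\dim D <= 1)%N /\ (a + b = 0)%N,
     factor lie_table_4_0_2 k l L \/ factor lie_table_1_3_1 k l L,
     st L p q = (0, 2) /\ (square_closed F ->
       factor lie_table_2_2_1 k l L \/ factor lie_table_2_2_4 k l L) |
     [\/ factor lie_table_2_2_6 k l L,
        [\/ factor lie_table_5_0_5 k l L, factor lie_table_4_1_6 k l L |
          factor lie_table_2_3_24 k l L],
        factor lie_table_5_0_3 k l L \/ factor lie_table_5_0_4 k l L |
        [\/ factor lie_table_1_4_7 k l L, factor lie_table_2_3_23 k l L,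
          factor lie_table_3_2_13 k l L | factor lie_table_2_3_18 k l L]]].
Proof.
move=> stE ab; have [_ _ full] := gXY.
have sG : size (X ++ Y) = (p + q)%N by rewrite size_cat sX sY.
have hG := gens_homogeneous.
have tot : ((p + q) * \dim D + \dim (D :&: Z) = (a + b) + (p + q) + \dim D)%N.
  have [E0 E1] := (st_dims _ _ gd).1 stE.
  have d := derived_dim_sum L; have z := meet_dim_sum L; rewrite -d -z mulnDl !mulnDr; lia.
have zr : (\dim (D :&: Z) <= \dim D)%N by apply: dimvS; apply: capvSl.
have [[D1 ab0]|] := total_cases tot ab zr (center_meets nilL) many_gens; first by apply: Or41.
case=> -[t d r z].
- by apply: Or42; apply: (dim2_gen2 nz2 nz3 nilL sL gd hG full); rewrite ?sG.
- have [[e [e' [e0 e'0 f]]]|[e [f [e0 f1 fu]]]|[p0 q2 [f [g [f1 g1 fu]]]]] := two_gens d.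
  + by case: (dim22_even nz2 r z e0 e'0 f).
  + by apply: Or44; apply: Or41; apply: (dim22_mixed nz2 nilL sL gd r z d e0 f1 fu).
  apply: Or43; split; first exact: odd_central_st p0 q2 f1 g1 fu r z.
  by move=> sq; apply: (dim22_odd nz2 nilL sL gd r z d sq f1 g1 fu).
- by apply: Or44; apply: Or42; apply: (dim2_gen3 nz2 nz3 nilL sL gd hG full); rewrite ?sG.
have [[e [e' [e0 e'0 fu]]]|[e [f [e0 f1 fu]]]|[p0 q2 [f [g [f1 g1 fu]]]]] := two_gens d.
- by apply: Or44; apply: Or43; apply: (dim3_even nz2 nilL sL gd d r z e0 e'0 fu).
- apply: Or44; apply: Or44.
  have [H|H|H] := dim3_mixed nz2 nz3 nilL sL gd d r z e0 f1 fu.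
  + exact: Or41.
  + exact: Or42.
  exact: Or43.
by apply: Or44; apply: Or44; apply: Or44; apply: (dim3_odd nz2 nz3 nilL sL gd d r z f1 g1 fu).
Qed.

End Classification.

Section Listed.
Variables (F : fieldType) (L : lieSuperalg F).
Hypothesis nz2 : (2%:R : F) != 0.
Hypothesis nilL : nilpotent_lie L.
Variables (k l p q : nat).
Hypothesis gd : gen_dims L p q.

Lemma factor_st a b t (lt : lie_table a b t) v :
  [&& elimination_ok a b t, derived_ok a b t & table_st a b t == v] ->
  factor lt k l L -> st L p q = v.
Proof.
by case/and3P=> ok1 ok2 /eqP <- [_ _ /iso_realizes[x xR]]; apply: (realizes_st nz2 xR).
Qed.

Lemma factor_excluded a b t (lt : lie_table a b t) v :
  [&& elimination_ok a b t, derived_ok a b t & table_st a b t != v] ->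
  factor lt k l L -> st L p q <> v.
Proof.
case/and3P=> ok1 ok2 /eqP ne H E; apply: ne; rewrite -E.
by apply/esym; apply: (factor_st _ H); rewrite ok1 ok2 eqxx.
Qed.

Lemma factorE a b t (lt : lie_table a b t) : factor lt k l L <->
  (a <= k)%N /\ (b <= l)%N /\
    lie_iso L (lie_sum (table_alg F lt) (abelian_alg F (k - a) (l - b))).
Proof. by split=> [[? ? ?]|[? [? ?]]]. Qed.

Lemma factorE0 a t (lt : lie_table a 0 t) : factor lt k l L <->
  (a <= k)%N /\ lie_iso L (lie_sum (table_alg F lt) (abelian_alg F (k - a) l)).
Proof. by rewrite /factor subn0; split=> [[? _ ?]|[? ?]]. Qed.

Lemma abelian_st : lie_iso L (abelian_alg F k l) -> st L p q = (0, 0).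
Proof.
move=> [h [[_ hb] /eqP h0 _]]; apply: (small_st nilL gd).
have -> : derived L = 0%VS; last by rewrite dimv0.
apply/eqP; rewrite -subv0; apply: brv_subP => u v _ _; rewrite memv0; apply/eqP.
by apply: (lker0P h0); rewrite hb abelian_br linear0.
Qed.

Lemma heis_even_st m n a b :
  lie_iso L (lie_sum (heis_even F m n) (abelian_alg F a b)) -> st L p q = (0, 0).
Proof.
move=> /iso_realizes[x xR]; apply: (small_st nilL gd).
apply: (single_derived (single_H m n) _ xR).
by apply/labelsP; exists (inl ord_max).
Qed.

Lemma heis_odd_st m a b :
  lie_iso L (lie_sum (heis_odd F m) (abelian_alg F a b)) -> st L p q = (0, 0).
Proof.
move=> /iso_realizes[x xR]; apply: (small_st nilL gd).
apply: (single_derived (single_Hodd m) _ xR).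
by apply/labelsP; exists (inr ord_max).
Qed.

End Listed.

Ltac destruct_cases := repeat match goal with
  | H : _ \/ _ |- _ => destruct H
  | H : or3 _ _ _ |- _ => destruct H
  | H : or4 _ _ _ _ |- _ => destruct H
  end.

(** The value of st, or a contradiction with it, is computed from the table. *)
Ltac st_value nz2 gd := match goal with H : factor _ _ _ _ |- _ =>
  by apply: (factor_st nz2 gd _ H); vm_compute end.

Ltac st_excluded nz2 gd := match goal with
  | H : factor _ _ _ _, E : st _ _ _ = _ |- _ =>
    by case: (factor_excluded nz2 gd (v := _) _ H E); vm_compute
  end.

Theorem mainTheorem2 (F : fieldType)
  (char_neq2 : 2%N \notin [pchar F]) (char_neq3 : 3%N \notin [pchar F])
  (L : lieSuperalg F) (k l : nat)
  (L_nonzero : (1 <= k + l)%N)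
  (sdim_L : sdim L = (k, l))
  (nilpotent_L : nilpotent_lie L)
  (quotient_fg : finitely_generated (central_quotient L))
  (p q : nat) (gen_pq : min_generator_pair (central_quotient L) p q) :
   (* (i) *)
   (let listed :=
      ((1 <= k + l)%N /\ lie_iso L (abelian_alg F k l)) \/
      (exists m n : nat, (2 * m + 1 <= k)%N /\ (n <= l)%N /\
       lie_iso L (lie_sum (heis_even F m n)
                          (abelian_alg F (k - 2 * m - 1) (l - n)))) \/
      (exists m : nat, (m <= k)%N /\ (m + 1 <= l)%N /\
       lie_iso L (lie_sum (heis_odd F m)
                          (abelian_alg F (k - m) (l - m - 1)))) in
    (listed -> st L p q = (0, 0)) /\
    (square_closed F -> st L p q = (0, 0) -> listed)) /\
   (* (ii) *)
   (st L p q = (1, 0) <->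
      ((4 <= k)%N /\
       lie_iso L (lie_sum (alg_4_0_2 F) (abelian_alg F (k - 4) l))) \/
      ((1 <= k)%N /\ (3 <= l)%N /\
       lie_iso L (lie_sum (alg_1_3_1 F) (abelian_alg F (k - 1) (l - 3))))) /\
   (* (iii) *)
   (st L p q <> (0, 1)) /\
   (* (iv) *)
   (st L p q = (2, 0) <->
      ((5 <= k)%N /\
       lie_iso L (lie_sum (alg_5_0_3 F) (abelian_alg F (k - 5) l))) \/
      ((5 <= k)%N /\
       lie_iso L (lie_sum (alg_5_0_4 F) (abelian_alg F (k - 5) l))) \/
      ((5 <= k)%N /\
       lie_iso L (lie_sum (alg_5_0_5 F) (abelian_alg F (k - 5) l))) \/
      ((1 <= k)%N /\ (4 <= l)%N /\
       lie_iso L (lie_sum (alg_1_4_7 F) (abelian_alg F (k - 1) (l - 4)))) \/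
      ((2 <= k)%N /\ (3 <= l)%N /\
       lie_iso L (lie_sum (alg_2_3_23 F) (abelian_alg F (k - 2) (l - 3))))) /\
   (* (v) *)
   (let listed :=
      ((2 <= k)%N /\ (2 <= l)%N /\
       lie_iso L (lie_sum (alg_2_2_1 F) (abelian_alg F (k - 2) (l - 2)))) \/
      ((2 <= k)%N /\ (2 <= l)%N /\
       lie_iso L (lie_sum (alg_2_2_4 F) (abelian_alg F (k - 2) (l - 2)))) \/
      ((2 <= k)%N /\ (3 <= l)%N /\
       lie_iso L (lie_sum (alg_2_3_18 F) (abelian_alg F (k - 2) (l - 3)))) \/
      ((2 <= k)%N /\ (3 <= l)%N /\
       lie_iso L (lie_sum (alg_2_3_19 F) (abelian_alg F (k - 2) (l - 3)))) \/
      ((2 <= k)%N /\ (3 <= l)%N /\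
       lie_iso L (lie_sum (alg_2_3_24 F) (abelian_alg F (k - 2) (l - 3)))) in
    (listed -> st L p q = (0, 2)) /\
    (square_closed F -> st L p q = (0, 2) -> listed)) /\
   (* (vi) *)
   (st L p q = (1, 1) <->
      ((2 <= k)%N /\ (2 <= l)%N /\
       lie_iso L (lie_sum (alg_2_2_6 F) (abelian_alg F (k - 2) (l - 2)))) \/
      ((4 <= k)%N /\ (1 <= l)%N /\
       lie_iso L (lie_sum (alg_4_1_6 F) (abelian_alg F (k - 4) (l - 1)))) \/
      ((3 <= k)%N /\ (2 <= l)%N /\
       lie_iso L (lie_sum (alg_3_2_13 F) (abelian_alg F (k - 3) (l - 2))))).

Proof.
have nz2 : (2%:R : F) != 0 by apply: contra char_neq2 => /eqP E; rewrite inE /= E eqxx.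
have nz3 : (3%:R : F) != 0 by apply: contra char_neq3 => /eqP E; rewrite inE /= E eqxx.
have [X [Y [gXY sX sY gd]]] := min_generator_lift nilpotent_L gen_pq.
have classify a b E ab :=
  classification nz2 nz3 nilpotent_L sdim_L gd gXY sX sY (a := a) (b := b) E ab.
rewrite /alg_4_0_2 /alg_1_3_1 /alg_5_0_3 /alg_5_0_4 /alg_5_0_5 /alg_1_4_7 /alg_2_3_23
  /alg_2_2_1 /alg_2_2_4 /alg_2_3_18 /alg_2_3_19 /alg_2_3_24 /alg_2_2_6 /alg_4_1_6
  /alg_3_2_13 -!factorE -!factorE0 /=.
split; [|split; [|split; [|split; [|split]]]].
- split=> [|sq E].
    case=> [[_]|[[m [n [_ [_]]]]|[m [_ [_]]]]].
    + exact: abelian_st.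
    + exact: heis_even_st.
    exact: heis_odd_st.
  right; apply: (heisenberg_list nz2 nilpotent_L sdim_L) => //.
  case: (classify 0%N 0%N E isT) => [[] //|H|[E' _]|H]; exfalso.
  + by destruct_cases; st_excluded nz2 gd.
  + by rewrite E' in E.
  by destruct_cases; st_excluded nz2 gd.
- split=> [E|H]; last by destruct_cases; st_value nz2 gd.
  case: (classify 1%N 0%N E isT) => [[] //|//|[E' _]|H]; exfalso.
    by rewrite E' in E.
  by destruct_cases; st_excluded nz2 gd.
- move=> E; case: (classify 0%N 1%N E isT) => [[] //|H|[E' _]|H].
  + by destruct_cases; st_excluded nz2 gd.
  + by rewrite E' in E.
  by destruct_cases; st_excluded nz2 gd.
- split=> [E|H]; last by destruct_cases; st_value nz2 gd.
  case: (classify 2%N 0%N E isT) => [[] //|H|[E' _]|H].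
  + by destruct_cases; st_excluded nz2 gd.
  + by rewrite E' in E.
  by destruct_cases; try st_excluded nz2 gd; tauto.
- split=> [H|sq E]; first by destruct_cases; st_value nz2 gd.
  case: (classify 0%N 2%N E isT) => [[] //|H|[_ /(_ sq)]|H]; [|tauto|].
    by destruct_cases; st_excluded nz2 gd.
  by destruct_cases; try st_excluded nz2 gd; tauto.
split=> [E|H]; last by destruct_cases; st_value nz2 gd.
case: (classify 1%N 1%N E isT) => [[] //|H|[E' _]|H].
- by destruct_cases; st_excluded nz2 gd.
- by rewrite E' in E.
by destruct_cases; try st_excluded nz2 gd; tauto.
Qed.
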